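(* Let $f\in L^2(\mathbb{R}^d)$, $f\ne0$, $\alpha>d/2$, and $\bar t,\bar\omega\in\mathbb{R}^d$. Then \[ |\operatorname{supp}f|\,\big\||\omega-\bar\omega|^\alpha\widehat f\big\|_2^{d/\alpha}>\frac{1}{K}\|f\|_2^{d/\alpha} \quad\text{and}\quad |\operatorname{supp}\widehat f|\,\big\||t-\bar t|^\alpha f\big\|_2^{d/\alpha}>\frac{1}{K}\|f\|_2^{d/\alpha}, \] where $K=K(d,\alpha,2)=\frac{\pi^{d/2}}{\alpha}\Gamma(d/2)^{-1}\Gamma\big(\frac{d}{2\alpha}\big)\Gamma\big(1-\frac{d}{2\alpha}\big)\big(\frac{2\alpha}{d}-1\big)^{\frac{d}{2\alpha}}\big(1-\frac{d}{2\alpha}\big)^{-1}$ (with the convention $\infty\cdot c=\infty$ for $c>0$, and the inequalities being trivially true when a left-hand factor is infinite).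
   Context: Fourier transform $\widehat f(\omega)=\int e^{-2\pi i x\cdot\omega}f(x)\,dx$, extended to $L^2$. $|\operatorname{supp} g|$ denotes the Lebesgue measure of the (essential) support $\{g\neq0\}$ of $g$. $\Gamma$ is the Gamma function. *)

(* Defs.v *)
From HB Require Import structures.
From mathcomp Require Import all_boot all_order all_algebra.
From mathcomp Require Import all_classical all_reals all_analysis.
From mathcomp.real_closed Require Import complex.

Set Implicit Arguments.
Unset Strict Implicit.
Unset Printing Implicit Defensive.

Import Order.TTheory GRing.Theory Num.Theory.
Local Open Scope classical_set_scope.
Local Open Scope ring_scope.

(* d.-tuple R carries MathComp-Analysis's product sigma-algebra
   (generated by the coordinate maps; = Borel sigma-algebra of R^d). *)

Definition dotp (R : realType) (n : nat) (x y : n.-tuple R) : R :=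
  \sum_(i < n) tnth x i * tnth y i.

Definition enorm (R : realType) (n : nat) (x : n.-tuple R) : R :=
  Num.sqrt (dotp x x).

Definition tsub (R : realType) (n : nat) (x y : n.-tuple R) : n.-tuple R :=
  [tuple tnth x i - tnth y i | i < n].

(* mu is the Lebesgue measure of R^n: it gives every closed box its volume.
   (Such a measure on the product/Borel sigma-algebra exists and is unique.) *)
Definition is_lebesgue_measure (R : realType) (n : nat)
    (mu : {measure set (n.-tuple R) -> \bar R}) : Prop :=
  forall a b : n.-tuple R, (forall i, tnth a i <= tnth b i) ->
    mu [set x | forall i, tnth a i <= tnth x i <= tnth b i] =
    (\prod_(i < n) (tnth b i - tnth a i))%:E.

Definition cmod2 (R : realType) (z : R[i]) : R :=
  complex.Re z ^+ 2 + complex.Im z ^+ 2.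

Definition cmeasurable (R : realType) (n : nat) (f : n.-tuple R -> R[i]) : Prop :=
  measurable_fun setT (fun x => complex.Re (f x)) /\
  measurable_fun setT (fun x => complex.Im (f x)).

Definition supp (R : realType) (n : nat) (g : n.-tuple R -> R[i]) :
    set (n.-tuple R) := [set x | g x != 0].

Definition L2norm (R : realType) (n : nat)
    (mu : {measure set (n.-tuple R) -> \bar R}) (g : n.-tuple R -> R[i]) : \bar R :=
  ((\int[mu]_x (cmod2 (g x))%:E) `^ (2^-1))%E.

Definition in_L2 (R : realType) (n : nat)
    (mu : {measure set (n.-tuple R) -> \bar R}) (g : n.-tuple R -> R[i]) : Prop :=
  cmeasurable g /\ (\int[mu]_x (cmod2 (g x))%:E < +oo)%E.

(* Truncated Fourier integral  \int_{|x| <= N} e^{-2 pi i x.w} f(x) dx,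
   computed through real and imaginary parts:
   e^{-i th}(a + i b) = (a cos th + b sin th) + i (b cos th - a sin th). *)
Definition trunc_fourier (R : realType) (n : nat)
    (mu : {measure set (n.-tuple R) -> \bar R}) (f : n.-tuple R -> R[i])
    (N : nat) (w : n.-tuple R) : R[i] :=
  let B := [set x : n.-tuple R | enorm x <= N%:R] in
  let th x := 2 * pi * dotp x w in
  Complex
    (\int[mu]_(x in B) (complex.Re (f x) * cos (th x) + complex.Im (f x) * sin (th x)))
    (\int[mu]_(x in B) (complex.Im (f x) * cos (th x) - complex.Re (f x) * sin (th x))).

(* fhat is (a measurable representative of) the L^2 Fourier transform of f:
   the L^2-limit of the truncated Fourier integrals (Plancherel). *)
Definition is_fourier_L2 (R : realType) (n : nat)
    (mu : {measure set (n.-tuple R) -> \bar R}) (f fhat : n.-tuple R -> R[i]) : Prop :=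
  cmeasurable fhat /\
  ((fun N : nat => (\int[mu]_w (cmod2 (fhat w - trunc_fourier mu f N w))%:E)%E)
     @ \oo --> 0%E).

Definition weighted (R : realType) (n : nat) (xbar : n.-tuple R) (a : R)
    (g : n.-tuple R -> R[i]) : n.-tuple R -> R[i] :=
  fun x => (((enorm (tsub x xbar)) `^ a)%:C)%C * g x.

Definition Gamma (R : realType) (s : R) : R :=
  \int[lebesgue_measure]_(t in `]0, +oo[%classic) (t `^ (s - 1) * expR (- t)).

Definition Kconst (R : realType) (d : nat) (a : R) : R :=
  pi `^ (d%:R / 2) / a * (Gamma (d%:R / 2))^-1
  * Gamma (d%:R / (2 * a)) * Gamma (1 - d%:R / (2 * a))
  * (2 * a / d%:R - 1) `^ (d%:R / (2 * a))
  * (1 - d%:R / (2 * a))^-1.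

(* Main.v *)
Require Import Defs.
From HB Require Import structures.
From mathcomp Require Import all_boot all_order all_algebra.
From mathcomp Require Import all_classical all_reals all_analysis.
From mathcomp.real_closed Require Import complex.
From mathcomp Require Import measurable_realfun lebesgue_integral ring lra.
Import Order.TTheory GRing.Theory Num.Theory.
Import numFieldNormedType.Exports.
Local Open Scope classical_set_scope.
Local Open Scope ring_scope.
Set Implicit Arguments.
Unset Strict Implicit.
Unset Printing Implicit Defensive.

(**
Write [F] for the Fourier integral of [f], [A] for the squared norm of [f],
[s = d/(2a)] (so [0 < s < 1]), [M] for the integral of [|f|] and [N] for the
integral of [|F|].  When both factors of a right-hand side are finite, [f] is
integrable, [fhat = F] almost everywhere, and three facts combine.

Strict energy bound: [|F| <= M] pointwise, so Plancherel gives
[A = int |F|^2 <= M N].  Equality would force [|F| = M] almost everywhere on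
[{F <> 0}], so that [E = {|F| = M}] has finite positive measure.  But [|F(w0)| = M] means
that [f(x) e^(-2 pi i x.w0)] has constant phase; hence [E] is closed under
[(w0, w1) |-> 2 w1 - w0], which dilates measures by [2^d > 1].

Cauchy-Schwarz: [(int |g|)^2 <= |supp g| int |g|^2].

Carlson: [(int |g|)^2 <= K (int |g|^2)^(1-s) (int |x - xbar|^(2a) |g|^2)^s], which
is Cauchy-Schwarz with the weight [1 + u |x - xbar|^(2a)].  The integral of its
inverse follows by writing [1/(1 + y) = int_0^oo e^(-t(1 + y)) dt] and scaling
[int e^(-c |x|^(2a)) dx]; the volume of the ball is read off the Gaussian [e^(-|x|^2)].

Applying Cauchy-Schwarz to one of [f], [F] and Carlson to the other yields
[A^2 < M^2 N^2 <= K |supp| A^(2-s) B^s], with [B] the weighted integral.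
*)

(** * Lebesgue measure on tuples *)

(** The measure is given only by the volumes of boxes, and the transform only as an L^2-limit of
    truncated integrals. Box volumes determine the measure, boxes being a generating pi-system; from
    this come affine scaling and the splitting of R^(n+1) as R x R^n that carries the Gaussian
    computation by induction. Plancherel is proved for f both integrable and square integrable:
    damping |F|^2 by a wide Gaussian turns its integral into that of f(x) conj (f(y)) against a heat
    kernel in x - y, and the error averages |f(x + h) - f(x)|^2 over small h, so it vanishes by
    continuity of translations in L^2.

    The bound A < M N is symmetric in M and N, so one energy estimate for the transform of f serves
    both inequalities, with Cauchy-Schwarz and Carlson exchanging places. All strictness sits there;
    those two estimates enter in non-strict form.

    When a factor on the right is infinite, the product is infinite only if the other factor is
    nonzero. For that, fhat must not vanish almost everywhere, and here f need not be integrable: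
    Plancherel is applied to the truncations of f. *)

Lemma measurable_tnth_real (R : realType) n (i : 'I_n) :
  measurable_fun [set: n.-tuple R] (fun x : n.-tuple R => tnth x i).
Proof. exact: measurable_tnth. Qed.
#[local] Hint Extern 0 (measurable_fun _ (fun x => tnth x _)) =>
  (exact: measurable_tnth_real) : core.

Section boxes.
Context {R : realType} {n : nat}.
Implicit Types a b x : n.-tuple R.

Definition box a b : set (n.-tuple R) :=
  [set x | forall i, tnth a i <= tnth x i <= tnth b i].

Definition boxes : set (set (n.-tuple R)) := [set box p.1 p.2 | p in setT].

Lemma boxesP a b : boxes (box a b).
Proof. by exists (a, b). Qed.

Lemma measurable_box a b : measurable (box a b).
Proof.
rewrite (_ : box a b = \big[setI/setT]_(i < n)
    ((fun x : n.-tuple R => tnth x i) @^-1` `[tnth a i, tnth b i])).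
  apply: big_ind => //; first exact: measurableI.
  by move=> i _; rewrite -[X in measurable X]setTI; exact: measurable_tnth_real.
rewrite -bigcap_seq; apply/seteqP; split => [x xab i _|x xab i].
  by rewrite /= in_itv/= xab.
by have := xab i; rewrite /= mem_index_enum in_itv/=; exact.
Qed.

Lemma tnth_le_sum x i : `|tnth x i| <= \sum_(j < n) `|tnth x j|.
Proof. by rewrite (bigD1 i)//= lerDl sumr_ge0. Qed.

Definition cube (k : nat) : set (n.-tuple R) :=
  box [tuple - k%:R | _ < n] [tuple k%:R | _ < n].

Lemma cubeP k x : cube k x <-> forall i, `|tnth x i| <= k%:R.
Proof.
by split=> + i => /(_ i); rewrite !tnth_mktuple ler_norml.
Qed.

Lemma in_cube x : exists k, cube k x.
Proof.
exists (Num.truncn (\sum_(j < n) `|tnth x j|)).+1; apply/cubeP => i.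
by rewrite (le_trans (tnth_le_sum x i))// ltW// truncnS_gt.
Qed.

Lemma bigcup_cube : \bigcup_k cube k = setT.
Proof. by apply/seteqP; split=> // x _; have [k kx] := in_cube x; exists k. Qed.

Lemma setI_closed_boxes : setI_closed boxes.
Proof.
move=> _ _ [[a b] _ <-] [[a' b'] _ <-] /=.
exists ([tuple Num.max (tnth a i) (tnth a' i) | i < n],
        [tuple Num.min (tnth b i) (tnth b' i) | i < n]) => //=.
apply/seteqP; split => x /=.
  move=> h; split => i; have := h i; rewrite !tnth_mktuple ge_max le_min.
    by move=> /andP[/andP[-> _] /andP[-> _]].
  by move=> /andP[/andP[_ ->] /andP[_ ->]].
move=> [h h'] i; rewrite !tnth_mktuple ge_max le_min.
by have /andP[-> ->] := h i; have /andP[-> ->] := h' i.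
Qed.

(** The tuple sigma-algebra is generated by the half-spaces [r <= x_i], and each of them is a
    countable union of boxes: side [[r, k]] in coordinate [i], sides [[-k, k]] elsewhere. *)
Lemma measurable_tupleE : @measurable _ (n.-tuple R) = <<s boxes >>.
Proof.
apply/seteqP; split; last first.
  apply: smallest_sub; first exact: sigma_algebra_measurable.
  by move=> _ [[a b] _ <-]; exact: measurable_box.
apply: smallest_sub; first exact: smallest_sigma_algebra.
apply: (big_ind (fun G => G `<=` <<s boxes>>)) => //.
  by move=> A B sA sB x [/sA|/sB].
move=> i _ _ [A mA <-].
suff : measurable_fun [set: g_sigma_algebraType boxes]
    (fun x : g_sigma_algebraType boxes => tnth (x : n.-tuple R) i : R).
  by move=> /(_ measurableT A mA).
apply: (measurability _ (measurable_realfun.RGenCInfty.measurableE R)).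
move=> _ [_ [r ->] <-]; rewrite setTI.
pose ak (k : nat) := [tuple if j == i then r else - k%:R | j < n].
pose bk (k : nat) : n.-tuple R := [tuple k%:R | _ < n].
rewrite [X in measurable X](_ : _ = \bigcup_k box (ak k) (bk k)).
  apply: bigcupT_measurable => k.
  by apply: sub_sigma_algebra; exact: boxesP.
apply/seteqP; split => x /=.
  rewrite in_itv/= andbT => rx; have [k /cubeP kx] := in_cube x.
  exists k => // j; rewrite !tnth_mktuple.
  by have := kx j; rewrite ler_norml => /andP[? ->]; case: eqP => [->|]; rewrite andbT.
by move=> [k _ /(_ i)]; rewrite !tnth_mktuple eqxx in_itv/= andbT => /andP[].
Qed.

End boxes.

Section lebesgue_unique.
Context {R : realType} {n : nat}.
Implicit Types (m mu : {measure set (n.-tuple R) -> \bar R}) (A : set (n.-tuple R)).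

Lemma box_eq0 (a b : n.-tuple R) : ~ (forall i, tnth a i <= tnth b i) ->
  box a b = set0.
Proof.
move=> nab; apply/seteqP; split => // x abx; apply: nab => i.
by have /andP[/le_trans] := abx i; apply.
Qed.

Lemma lebesgue_box mu (a b : n.-tuple R) : is_lebesgue_measure mu ->
  (forall i, tnth a i <= tnth b i) ->
  mu (box a b) = (\prod_(i < n) (tnth b i - tnth a i))%:E.
Proof. by move=> + ab => /(_ _ _ ab). Qed.

Lemma lebesgue_cube_fin mu k : is_lebesgue_measure mu -> (mu (cube k) < +oo)%E.
Proof.
move=> lmu; rewrite lebesgue_box ?ltry// => i.
by rewrite !tnth_mktuple (@le_trans _ _ 0)// oppr_le0.
Qed.

(** Uniqueness of measures on a pi-system, with the cubes as an exhaustion of finite measure. The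
    changes of variables below come from it, by comparing a pushforward with [mu] on boxes. *)
Lemma lebesgue_measure_tuple_unique mu m A : is_lebesgue_measure mu ->
  (forall a b : n.-tuple R, (forall i, tnth a i <= tnth b i) ->
    m (box a b) = mu (box a b)) ->
  measurable A -> m A = mu A.
Proof.
move=> lmu mmu mA; apply/esym.
apply: (measure_unique boxes cube) => //=.
- exact: measurable_tupleE.
- exact: setI_closed_boxes.
- by move=> k; exact: boxesP.
- exact: bigcup_cube.
- move=> _ [[a b] _ <-] /=.
  have [ab|/box_eq0 ->] := pselect (forall i, tnth a i <= tnth b i).
    by rewrite mmu.
  by rewrite !measure0.
- by move=> k; exact: lebesgue_cube_fin.
Qed.

Lemma lebesgue_sigma_finite mu : is_lebesgue_measure mu -> sigma_finite setT mu.
Proof.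
move=> lmu; exists cube; first by rewrite bigcup_cube.
by move=> k; split; [exact: measurable_box|exact: lebesgue_cube_fin].
Qed.

End lebesgue_unique.

(** * Change of variables along a measurable map *)

Section pushforward_transfer.
Context {d1 d2} {T1 : measurableType d1} {T2 : measurableType d2} {R : realType}.

Definition pushm (mu : {measure set T1 -> \bar R}) (phi : T1 -> T2)
    (mphi : measurable_fun setT phi) : {measure set T2 -> \bar R} :=
  measure_function_pushforward__canonical__measure_function_Measure mu mphi.

Lemma ge0_integral_change (mu : {measure set T1 -> \bar R})
    (nu : {measure set T2 -> \bar R}) (phi : T1 -> T2) (f : T2 -> \bar R) :
  measurable_fun setT phi ->
  (forall A, measurable A -> nu A = mu (phi @^-1` A)) ->
  measurable_fun setT f -> (forall y, 0 <= f y)%E ->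
  (\int[nu]_y f y = \int[mu]_x f (phi x))%E.
Proof.
move=> mphi numu mf f0.
rewrite (eq_measure_integral (pushm mu mphi)) => [|A mA _]; last exact: numu.
by rewrite ge0_integral_pushforward.
Qed.

Lemma integral_change (mu : {measure set T1 -> \bar R})
    (nu : {measure set T2 -> \bar R}) (phi : T1 -> T2) (f : T2 -> \bar R) :
  measurable_fun setT phi ->
  (forall A, measurable A -> nu A = mu (phi @^-1` A)) ->
  measurable_fun setT f ->
  (\int[nu]_y f y = \int[mu]_x f (phi x))%E.
Proof.
move=> mphi numu mf; rewrite integralE [RHS]integralE.
rewrite (ge0_integral_change mphi numu (measurable_funepos mf))//.
rewrite (ge0_integral_change mphi numu (measurable_funeneg mf))//.
by rewrite -[fun x => f (phi x)]/(f \o phi) (funepos_comp f phi) (funeneg_comp f phi).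
Qed.

End pushforward_transfer.

Section sigma_finite_pack.
Context {d} {T : measurableType d} {R : realType}.
Variables (mu : {measure set T -> \bar R}) (smu : sigma_finite setT mu).

(* [sigma_finite_pack smu] is convertible to [mu], so that statements about it
   are statements about [mu]. *)
Definition sigma_finite_copy (_ : sigma_finite setT mu) : set T -> \bar R := mu.
HB.instance Definition _ := Measure.copy (sigma_finite_copy smu) mu.
HB.instance Definition _ :=
  Measure_isSigmaFinite.Build _ _ _ (sigma_finite_copy smu) smu.

Definition sigma_finite_pack : {sigma_finite_measure set T -> \bar R} :=
  sigma_finite_copy smu.

End sigma_finite_pack.

(** * Affine changes of variables *)

Section affine.
Context {R : realType} {n : nat}.
Implicit Types (mu : {measure set (n.-tuple R) -> \bar R}) (x h : n.-tuple R).

Definition taff (c : R) h x : n.-tuple R := [tuple c * tnth x i + tnth h i | i < n].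

Lemma tnth_taff c h x i : tnth (taff c h x) i = c * tnth x i + tnth h i.
Proof. by rewrite tnth_mktuple. Qed.

Lemma measurable_taff c h : measurable_fun setT (taff c h).
Proof.
apply/measurable_fun_tnthP => i.
rewrite (_ : _ \o _ = fun x => c * tnth x i + tnth h i); last first.
  by apply/funext => x; rewrite /= tnth_taff.
by apply: measurable_funD => //; apply: measurable_funM.
Qed.

(** The pushforward of [mu] under [taff c h], multiplied by [c ^+ n], gives every box its volume:
    the preimage of a box is the box with corners [(a - h) / c] and [(b - h) / c], in this order
    since [0 < c]. *)
Lemma lebesgue_affine mu c h A : is_lebesgue_measure mu -> 0 < c -> measurable A ->
  mu A = ((c ^+ n)%:E * mu (taff c h @^-1` A))%E.
Proof.
move=> lmu c0 mA; have cn0 : 0 <= c ^+ n by rewrite exprn_ge0// ltW.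
pose m : {measure set (n.-tuple R) -> \bar R} :=
  mscale (NngNum cn0) (pushm mu (measurable_taff c h)).
have <- // : m A = mu A.
apply: lebesgue_measure_tuple_unique => // a b ab.
rewrite /m /= /mscale/= /pushforward lebesgue_box//.
pose g (y : n.-tuple R) : n.-tuple R := [tuple (tnth y i - tnth h i) / c | i < n].
rewrite (_ : _ @^-1` _ = box (g a) (g b)); last first.
  apply/seteqP; split => x /= xab i; have := xab i;
    by rewrite !tnth_mktuple ler_pdivrMr// ler_pdivlMr// lerBlDr lerBrDr mulrC.
rewrite lebesgue_box//; last first.
  by move=> i; rewrite !tnth_mktuple ler_pM2r ?invr_gt0// lerB.
rewrite -EFinM; congr EFin.
rewrite (eq_bigr (fun i => c^-1 * (tnth b i - tnth a i))); last first.
  by move=> i _; rewrite !tnth_mktuple -mulrBl mulrC; congr (_ * _); ring.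
by rewrite big_split/= prodr_const card_ord mulrA -exprMn divff ?gt_eqF// expr1n mul1r.
Qed.

Lemma integral_affine mu c h (f : n.-tuple R -> \bar R) :
  is_lebesgue_measure mu -> 0 < c -> measurable_fun setT f -> (forall x, 0 <= f x)%E ->
  (\int[mu]_x f x = (c ^+ n)%:E * \int[mu]_x f (taff c h x))%E.
Proof.
move=> lmu c0 mf f0; have cn0 : 0 <= c ^+ n by rewrite exprn_ge0// ltW.
rewrite (eq_measure_integral (mscale (NngNum cn0) (pushm mu (measurable_taff c h)))).
  rewrite ge0_integral_mscale//=; congr (_ * _)%E.
  by rewrite ge0_integral_pushforward//; exact: measurable_taff.
by move=> A mA _; rewrite (lebesgue_affine h lmu c0 mA).
Qed.

End affine.

(** * Splitting off the first coordinate *)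

Section tcons.
Context {R : realType} {n : nat}.

Definition tconsp (p : R * n.-tuple R) : n.+1.-tuple R := [tuple of p.1 :: p.2].

Lemma measurable_tconsp : measurable_fun setT tconsp.
Proof. exact: measurable_cons. Qed.

Lemma tconsp0 p : tnth (tconsp p) ord0 = p.1.
Proof. by []. Qed.

Lemma tconspS p i : tnth (tconsp p) (lift ord0 i) = tnth p.2 i.
Proof. by rewrite tnthS. Qed.

Definition tbehead (x : n.+1.-tuple R) : n.-tuple R := [tuple of behead x].

Lemma measurable_tbehead : measurable_fun setT tbehead.
Proof. exact: measurable_behead. Qed.

Lemma tnth_tbehead x i : tnth (tbehead x) i = tnth x (lift ord0 i).
Proof. by rewrite [in RHS](tuple_eta x) tnthS. Qed.

Lemma tconspK x : tconsp (tnth x ord0, tbehead x) = x.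
Proof. by rewrite [RHS]tuple_eta. Qed.

Lemma box_tconsp (a b : R * n.-tuple R) :
  tconsp @^-1` box (tconsp a) (tconsp b) = `[a.1, b.1] `*` box a.2 b.2.
Proof.
apply/seteqP; split => -[r x] /= => [h|[]].
  split; first by have := h ord0; rewrite in_itv.
  by move=> i; have := h (lift ord0 i); rewrite !tconspS.
rewrite in_itv/= => h1 h2 i; case: (unliftP ord0 i) => [j ->|->]; last by [].
by rewrite !tconspS; exact: h2.
Qed.

(** The measure in dimension [n] is extracted from [mu] itself, as the mass of the slab [[0, 1] x
    A]: restrict [mu] to [0 <= x_0 <= 1] and project. Both sides of the product formula then agree
    on boxes. This feeds inductions on the dimension. *)
Lemma lebesgue_tcons (mu : {measure set (n.+1.-tuple R) -> \bar R}) :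
  is_lebesgue_measure mu ->
  exists2 nu : {sigma_finite_measure set (n.-tuple R) -> \bar R},
    is_lebesgue_measure nu &
    forall A, measurable A ->
      mu A = ((@lebesgue_measure R) \x nu)%E (tconsp @^-1` A).
Proof.
move=> lmu.
have mD : measurable [set x : n.+1.-tuple R | 0 <= tnth x ord0 <= 1].
  rewrite (_ : [set _ | _] =
    (fun x : n.+1.-tuple R => tnth x ord0) @^-1` `[0, 1]%classic); last first.
    by apply/seteqP; split => x; rewrite /= in_itv.
  by rewrite -[X in measurable X]setTI; exact: measurable_tnth_real.
pose nu0 := pushm (mrestr mu mD) measurable_tbehead.
have lnu0 : is_lebesgue_measure nu0.
  move=> a b ab; rewrite -/(box a b) /nu0 /= /pushforward /mrestr.
  rewrite (_ : _ `&` _ = box (tconsp (0, a)) (tconsp (1, b))).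
    rewrite lebesgue_box//.
      rewrite big_ord_recl !tconsp0 subr0 mul1r; congr EFin.
      by apply: eq_bigr => i _; rewrite !tconspS.
    move=> i; case: (unliftP ord0 i) => [j ->|->]; last by rewrite !tconsp0.
    by rewrite !tconspS.
  apply/seteqP; split => x /=.
    move=> [h1] h2 i; case: (unliftP ord0 i) => [j ->|->]; last by [].
    by rewrite !tconspS -tnth_tbehead; exact: h1.
  move=> h; split => [i|]; last exact: (h ord0).
  by have := h (lift ord0 i); rewrite !tconspS tnth_tbehead.
pose nu := sigma_finite_pack (lebesgue_sigma_finite lnu0).
exists nu => // A mA; apply/esym.
apply: (lebesgue_measure_tuple_unique
  (m := pushm ((@lebesgue_measure R) \x nu)%E measurable_tconsp)) => // a b ab.
rewrite -[LHS]/(((@lebesgue_measure R) \x nu)%E (tconsp @^-1` box a b)).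
rewrite -(tconspK a) -(tconspK b) box_tconsp product_measure1E//; last exact: measurable_box.
have L : (@lebesgue_measure R) `[tnth a ord0, tnth b ord0]%classic =
    (tnth b ord0 - tnth a ord0)%:E.
  rewrite lebesgue_measure_itv/= lte_fin.
  have := ab ord0; rewrite le_eqVlt => /predU1P[->|->]; last by rewrite EFinB.
  by rewrite ltxx subrr.
rewrite !tconspK.
transitivity ((tnth b ord0 - tnth a ord0)%:E * nu (box (tbehead a) (tbehead b)))%E.
  by congr (_ * _)%E; exact: L.
rewrite (lebesgue_box (mu := nu))// => [|i]; last by rewrite !tnth_tbehead.
rewrite lebesgue_box// big_ord_recl EFinM; congr (_ * _)%E.
by congr EFin; apply: eq_bigr => i _; rewrite !tnth_tbehead.
Qed.

End tcons.

(** * Gaussian integrals *)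

Section integral_exhaust.
Context {R : realType}.

Lemma integral_itv_exhaust (g : R -> R) :
  (@lebesgue_measure R).-integrable setT (EFin \o g) ->
  (\int[@lebesgue_measure R]_(x in `[- n%:R, n%:R]) g x)
    @[n --> \oo] --> \int[@lebesgue_measure R]_x g x.
Proof.
move=> ig; set mu := @lebesgue_measure R.
have mg : measurable_fun setT g by apply/measurable_EFinP; exact: measurable_int ig.
have gfin : (\int[mu]_x (EFin \o g) x \is a fin_num)%E by exact: integrable_fin_num.
pose D (n : nat) : set R := `[- n%:R, n%:R]%classic.
have mgn n : measurable_fun setT (EFin \o (g \_ (D n))).
  apply/measurable_EFinP; apply: (measurable_restrictT _ _).1.
    exact: measurable_itv.
  exact: measurable_funTS.
have H : (\int[mu]_x (EFin \o (g \_ (D n))) x)%E @[n --> \oo]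
    --> (\int[mu]_x (EFin \o g) x)%E.
  have [] := @dominated_convergence _ _ _ mu setT measurableT
    (fun n => EFin \o (g \_ (D n))) (EFin \o g) (abse \o (EFin \o g)) mgn _ _ _ _ => //.
  - exact: measurable_int ig.
  - apply: aeW => x _; apply: cvg_near_cst; near=> n => /=.
    rewrite patchE ifT// inE /D/= in_itv/= -ler_norml.
    by near: n; exact: nbhs_infty_ger.
  - exact: integrable_abse.
  - apply: aeW => x n _ /=; rewrite lee_fin patchE; case: ifPn => // _.
    by rewrite normr0.
under eq_fun do rewrite Rintegral_mkcond.
by rewrite -(fineK gfin) in H; exact: fine_cvg H.
Unshelve. all: by end_near. Qed.

End integral_exhaust.

(** * The Gaussian on the line *)

Section gauss1.
Context {R : realType}.
Let mu := @lebesgue_measure R.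

Lemma is_derive_gauss_fun (x : R) :
  is_derive x 1 gauss_fun (- (2 * x * gauss_fun x)).
Proof.
apply: (@is_derive_eq _ _ _ _ _ _ _ _ (is_derive1_comp (is_derive_expR _) (is_deriveN (is_deriveX 2 (is_derive_id x 1))))).
rewrite /GRing.scale/= /gauss_fun. ring.
Qed.

Lemma is_derive_sinM (b x : R) :
  is_derive x 1 (fun t => sin (b * t)) (b * cos (b * x)).
Proof.
apply: (@is_derive_eq _ _ _ _ _ _ _ _ (is_derive1_comp (is_derive_sin _) (is_deriveZ b (is_derive_id x 1)))).
rewrite /GRing.scale/=. ring.
Qed.

Lemma is_derive_cosM (b x : R) :
  is_derive x 1 (fun t => cos (t * b)) (- b * sin (x * b)).
Proof.
have -> : (fun t => cos (t * b)) = (cos \o (b *: id)).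
  by apply/funext => t /=; rewrite mulrC.
apply: (@is_derive_eq _ _ _ _ _ _ _ _ (is_derive1_comp (is_derive_cos _) (is_deriveZ b (is_derive_id x 1)))).
rewrite /GRing.scale/=. rewrite (mulrC x). ring.
Qed.

Let is_derive_g (b x : R) :
  is_derive x 1 (fun t => - (gauss_fun t * sin (b * t)))
   (2 * x * gauss_fun x * sin (b * x) - b * (gauss_fun x * cos (b * x))).
Proof.
apply: (@is_derive_eq _ _ _ _ _ _ _ _ (is_deriveN (is_deriveM (is_derive_gauss_fun x) (is_derive_sinM b x)))).
rewrite /GRing.scale/=. ring.
Qed.

(** By evenness it is enough to integrate over the half-line, where [- gauss_fun] is a primitive.
    The function serves as the dominating function when differentiating under the integral. *)
Lemma integrable_gauss_lin : mu.-integrable setT (fun x => (2 * `|x| * gauss_fun x)%:E).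
Proof.
apply/integrableP; split.
  apply/measurable_EFinP; apply: measurable_funM; last exact: measurable_gauss_fun.
  by apply: measurable_funM.
have c : continuous (fun x : R => 2 * `|x| * gauss_fun x).
  move=> x; apply: cvgM; last exact: continuous_gauss_fun.
  by apply: cvgM; [exact: cvg_cst|exact: norm_continuous].
under eq_integral do rewrite /= ger0_norm ?mulr_ge0// ?gauss_fun_ge0//.
rewrite ge0_symfun_integralT//; last 2 first.
  by move=> x; rewrite !mulr_ge0// gauss_fun_ge0.
  by move=> x /=; rewrite /gauss_fun normrN sqrrN.
rewrite lte_mul_pinfty//.
rewrite -set_itvcy (_ : integral _ _ _ =
    \int[mu]_(x in `[0%R, +oo[) (2 * x * gauss_fun x)%:E)%E; last first.
  apply: eq_integral.
  by move=> x; rewrite inE/= in_itv/= andbT => x0; rewrite ger0_norm.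
rewrite (@ge0_continuous_FTC2y _ _ (fun x => - gauss_fun x) _ 0)//.
- by rewrite /gauss_fun expr0n/= oppr0 expR0 -EFinB ltry.
- by move=> x x0; rewrite !mulr_ge0// gauss_fun_ge0.
- apply: continuous_subspaceT => x; apply: cvgM; last exact: continuous_gauss_fun.
  by apply: cvgM; [exact: cvg_cst|exact: cvg_id].
- by rewrite -oppr0; apply: cvgN; exact: cvg_gauss_fun.
- by apply: cvgN; apply: cvg_at_right_filter; exact: continuous_gauss_fun.
- move=> x _; rewrite derive1E.
  have [_ ->] := is_deriveN (is_derive_gauss_fun x).
  by rewrite opprK.
Qed.

Lemma integrable_gauss_bounded (h : R -> R) : measurable_fun setT h ->
  (forall x, `|h x| <= 1) -> mu.-integrable setT (fun x => (gauss_fun x * h x)%:E).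
Proof.
move=> mh h1; apply: le_integrable (integrableT_gauss) => //.
  by apply/measurable_EFinP; apply: measurable_funM => //; exact: measurable_gauss_fun.
move=> x _ /=; rewrite lee_fin normrM ler_piMr//.
Qed.

Lemma integrable_gauss_lin_bounded (h : R -> R) : measurable_fun setT h ->
  (forall x, `|h x| <= 1) -> mu.-integrable setT (fun x => (2 * x * gauss_fun x * h x)%:E).
Proof.
move=> mh h1; apply: le_integrable (integrable_gauss_lin) => //.
  apply/measurable_EFinP; apply: measurable_funM; last exact: mh.
  by apply: measurable_funM; [exact: measurable_funM|exact: measurable_gauss_fun].
move=> x _ /=; rewrite lee_fin 2!normrM [leRHS]normrM !normrM normr_id ler_piMr//.
Qed.

Lemma measurable_cosM (b : R) : measurable_fun setT (fun x : R => cos (b * x)).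
Proof.
apply: continuous_measurable_fun => x; apply: continuous_comp.
  by apply: cvgM; [exact: cvg_cst|exact: cvg_id].
exact: continuous_cos.
Qed.

Lemma measurable_sinM (b : R) : measurable_fun setT (fun x : R => sin (b * x)).
Proof.
apply: continuous_measurable_fun => x; apply: continuous_comp.
  by apply: cvgM; [exact: cvg_cst|exact: cvg_id].
exact: continuous_sin.
Qed.

(** The difference of the two integrands is the derivative of [- (gauss_fun t * sin (b * t))], whose
    values at [n] and [- n] tend to 0. *)
Lemma gauss_ibp (b : R) :
  \int[mu]_x (2 * x * gauss_fun x * sin (b * x)) =
  b * \int[mu]_x (gauss_fun x * cos (b * x)).
Proof.
have i1 := integrable_gauss_lin_bounded (measurable_sinM b) (fun x => sin_max (b * x)).
have i2 := integrable_gauss_bounded (measurable_cosM b) (fun x => cos_max (b * x)).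
have i3 : mu.-integrable setT (fun x => (b * (gauss_fun x * cos (b * x)))%:E).
  by under eq_fun do rewrite EFinM; exact: integrableZl.
pose g x := 2 * x * gauss_fun x * sin (b * x) - b * (gauss_fun x * cos (b * x)).
have ig : mu.-integrable setT (EFin \o g).
  by apply: eq_integrable (integrableB measurableT i1 i3).
rewrite -RintegralZl//; apply/eqP; rewrite -subr_eq0 -RintegralB//; apply/eqP.
apply/esym; apply: (cvg_unique _ _ (integral_itv_exhaust ig)) => //.
pose G t := - (gauss_fun t * sin (b * t)) : R.
have cG : continuous G.
  by move=> x; apply/differentiable_continuous/derivable1_diffP; have [] := is_derive_g b x.
have cg : continuous g.
  move=> x; apply: cvgB.
    apply: cvgM; last by have [+ _] := is_derive_sinM b x; move=> /derivable1_diffP/differentiable_continuous.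
    by apply: cvgM; [apply: cvgM; [exact: cvg_cst|exact: cvg_id]|exact: continuous_gauss_fun].
  apply: cvgM; first exact: cvg_cst.
  apply: cvgM; first exact: continuous_gauss_fun.
  apply: continuous_comp; first by apply: cvgM; [exact: cvg_cst|exact: cvg_id].
  exact: continuous_cos.
have E : {near \oo, (fun n : nat => G n%:R - G (- n%:R)) =1
    (fun n => \int[mu]_(x in `[(- n%:R), n%:R]) g x)}.
  near=> n.
  have n0 : - n%:R < n%:R :> R.
    by rewrite ltrNl -subr_gt0 opprK addr_gt0// ltr0n; near: n; exact: nbhs_infty_gt.
  rewrite /Rintegral (@continuous_FTC2 _ _ G)//.
  - exact: continuous_subspaceT.
  - split.
    + by move=> x _; have [] := is_derive_g b x.
    + by apply: cvg_at_right_filter; exact: cG.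
    + by apply: cvg_at_left_filter; exact: cG.
  - by move=> x _; rewrite derive1E; have [_ ->] := is_derive_g b x.
apply: (cvg_trans (near_eq_cvg E)).
have E2 n : G n%:R - G (- n%:R) = -2 * (gauss_fun n%:R * sin (b * n%:R)).
  rewrite /G /gauss_fun sqrrN mulrN sinN. ring.
have H0 : (gauss_fun n%:R * sin (b * n%:R)) @[n --> \oo] --> (0 : R).
  apply/norm_cvg0P.
  apply: (@squeeze_cvgr _ _ _ _ (fun=> 0) (fun n : nat => gauss_fun n%:R)).
  - near=> n; rewrite normr_ge0 normrM ger0_norm ?gauss_fun_ge0//.
    by rewrite ler_piMr ?gauss_fun_ge0// sin_max.
  - exact: cvg_cst.
  - by have := @cvg_gauss_fun R; move/cvg_pinftyP => /(_ _ cvgr_idn).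
rewrite (_ : (fun n => _) = (fun n : nat => -2 * (gauss_fun n%:R * sin (b * n%:R)))).
  have H1 : (fun n : nat => -2 * (gauss_fun n%:R * sin (b * n%:R))) @ \oo --> (-2 * 0 : R).
    by apply: cvgMl_tmp; exact: H0.
  by rewrite mulr0 in H1.
by apply/funext => n; exact: E2.
Unshelve. all: by end_near. Qed.

(** Differentiation under the integral followed by [gauss_ibp] yields the differential equation phi'
    = - (b/2) phi for the cosine transform of the Gaussian. *)
Lemma gauss_cos_derive (b : R) :
  is_derive b 1 (fun b => \int[mu]_x (gauss_fun x * cos (b * x)))
    (- (b / 2) * \int[mu]_x (gauss_fun x * cos (b * x))).
Proof.
have dcos (y x : R) : is_derive y 1 (fun b => gauss_fun x * cos (b * x))
    (- x * gauss_fun x * sin (y * x)).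
  apply: (@is_derive_eq _ _ _ _ _ _ _ _ (is_deriveZ (gauss_fun x) (is_derive_cosM x y))).
  rewrite /GRing.scale/=. ring.
have p1 (y x : R) : partial1of2 (fun b x => gauss_fun x * cos (b * x)) y x =
    - x * gauss_fun x * sin (y * x).
  by rewrite partial1of2E; have [] := dcos y x.
have bb : `]b - 1, b + 1[%classic b by rewrite /= in_itv/= ltrBlDr ltrDl ltr01 andbb.
have Hi y : `]b - 1, b + 1[%classic y ->
    mu.-integrable setT (EFin \o (fun x => gauss_fun x * cos (y * x))).
  by move=> _; exact: (integrable_gauss_bounded (measurable_cosM y) (fun x => cos_max (y * x))).
have Hd (y x : R) : `]b - 1, b + 1[%classic y -> setT x ->
    derivable (fun b : R => gauss_fun x * cos (b * x)) y 1 by move=> _ _; have [] := dcos y x.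
have HG0 (y : R) : 0 <= 2 * `|y| * gauss_fun y by rewrite !mulr_ge0// gauss_fun_ge0.
have Hb (y x : R) : `]b - 1, b + 1[%classic y -> setT x ->
    `|partial1of2 (fun b x => gauss_fun x * cos (b * x)) y x| <= 2 * `|x| * gauss_fun x.
  move=> _ _; rewrite p1 !normrM normrN (ger0_norm (gauss_fun_ge0 _)) -mulrA.
  rewrite (_ : 2 * `|x| * gauss_fun x = `|x| * (gauss_fun x * 2)); last by ring.
  rewrite ler_wpM2l// ler_wpM2l ?gauss_fun_ge0//.
  by rewrite (le_trans (sin_max _))// ler1n.
have D := derivable_under_integral measurableT bb Hi Hd HG0 integrable_gauss_lin Hb.
have D' := differentiation_under_integral measurableT bb Hi Hd HG0 integrable_gauss_lin Hb.
apply: DeriveDef; first exact: D.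
rewrite -derive1E D'.
transitivity (\int[mu]_x (- (2^-1) * (2 * x * gauss_fun x * sin (b * x)))).
  by apply: eq_Rintegral => x _; rewrite p1; field.
rewrite RintegralZl//; last exact: (integrable_gauss_lin_bounded (measurable_sinM b) (fun x => sin_max (b * x))).
rewrite gauss_ibp mulrA; congr (_ * _); by field.
Qed.

(** By the differential equation, the transform times [expR (b ^+ 2 / 4)] has zero derivative; its
    constant value is the Gaussian integral at [b = 0]. *)
Lemma gauss_cos (b : R) :
  \int[mu]_x (gauss_fun x * cos (b * x)) = Num.sqrt pi * expR (- (b ^+ 2 / 4)).
Proof.
pose phi (c : R) := \int[mu]_x (gauss_fun x * cos (c * x)).
pose psi c := phi c * expR (c ^+ 2 / 4).
have dpsi (c : R) : is_derive c 1 psi 0.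
  have de : is_derive c 1 (fun c => expR (c ^+ 2 / 4)) (c / 2 * expR (c ^+ 2 / 4)).
    have -> : (fun c : R => expR (c ^+ 2 / 4)) = expR \o (4^-1 *: (@GRing.exp R ^~ 2)).
      by apply/funext => t /=; rewrite mulrC.
    apply: (@is_derive_eq _ _ _ _ _ _ _ _ (is_derive1_comp (is_derive_expR _) (is_deriveZ (4^-1) (is_deriveX 2 (is_derive_id c 1))))).
    rewrite (_ : (4^-1 \*: id ^+ 2) c = c ^+ 2 / 4); last by rewrite /GRing.scale/= mulrC.
    by rewrite /GRing.scale/=; field.
  apply: (@is_derive_eq _ _ _ _ _ _ _ _ (is_deriveM (gauss_cos_derive c) de)).
  rewrite /GRing.scale/=. ring.
have := is_derive_0_is_cst b 0 dpsi.
rewrite /psi /phi expr0n/= mul0r expR0 mulr1 => /(congr1 (fun t => t * expR (- (b ^+ 2 / 4)))).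
rewrite -mulrA -expRD subrr expR0 mulr1 => ->; congr (_ * _).
under eq_Rintegral do rewrite mul0r cos0 mulr1.
by rewrite /Rintegral integralT_gauss.
Qed.

Lemma gauss_sin (b : R) : \int[mu]_x (gauss_fun x * sin (b * x)) = 0.
Proof.
have ig := integrable_gauss_bounded (measurable_sinM b) (fun x => sin_max (b * x)).
have : \int[mu]_x (gauss_fun x * sin (b * x)) = - \int[mu]_x (gauss_fun x * sin (b * x)).
  have mN : measurable_fun setT (-%R : R -> R) by [].
  have E A : measurable A -> mu A = mu ((-%R : R -> R) @^-1` A).
    by move=> mA; exact/esym/lebesgue_measureN.
  have := @integral_change _ _ _ _ R mu mu (-%R : R -> R) _ mN E (measurable_int _ ig).
  move=> H; rewrite [LHS]/Rintegral [X in fine X = _]H.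
  under eq_integral do rewrite mulrN sinN mulrN /gauss_fun sqrrN EFinN.
  rewrite integralN//; last exact: integrable_add_def.
  by rewrite fineN.
by move/eqP; rewrite -addr_eq0 -mulr2n mulrn_eq0/= => /eqP.
Qed.

End gauss1.

Section prodM.
Context {d1 d2} {T1 : measurableType d1} {T2 : measurableType d2} {R : realType}.
Variables (m1 : {sigma_finite_measure set T1 -> \bar R})
  (m2 : {sigma_finite_measure set T2 -> \bar R}).

Lemma integrable_prodM (p : T1 -> R) (q : T2 -> R) :
  m1.-integrable setT (EFin \o p) -> m2.-integrable setT (EFin \o q) ->
  (m1 \x m2)%E.-integrable setT (fun z => (p z.1 * q z.2)%:E).
Proof.
move=> ip iq.
have mp : measurable_fun setT p by apply/measurable_EFinP; exact: measurable_int ip.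
have mq : measurable_fun setT q by apply/measurable_EFinP; exact: measurable_int iq.
apply/integrable12ltyP.
  apply/measurable_EFinP; apply: measurable_funM; exact: measurableT_comp.
have Q x : (\int[m2]_y `|(p x * q y)%:E| = `|p x|%:E * \int[m2]_y `|(q y)%:E|)%E.
  rewrite -ge0_integralZl//; last by apply: measurableT_comp => //; exact/measurable_EFinP.
  by apply: eq_integral => y _; rewrite -EFinM /= normrM.
under eq_integral do rewrite Q.
have iqfin : (\int[m2]_y `|(q y)%:E| \is a fin_num)%E.
  by rewrite ge0_fin_numE ?integral_ge0//; have /integrableP[_] := iq.
rewrite ge0_integralZr//; last 2 first.
  by apply/measurable_EFinP; exact: measurableT_comp.
  by apply: integral_ge0.
rewrite lte_mul_pinfty//.
- by apply: integral_ge0.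
- by rewrite ge0_fin_numE ?integral_ge0//; have /integrableP[_] := ip.
- by rewrite -ge0_fin_numE ?integral_ge0.
Qed.

Lemma integral_prodM (p : T1 -> R) (q : T2 -> R) :
  m1.-integrable setT (EFin \o p) -> m2.-integrable setT (EFin \o q) ->
  \int[(m1 \x m2)%E]_z (p z.1 * q z.2) = (\int[m1]_x p x) * (\int[m2]_y q y).
Proof.
move=> ip iq.
rewrite /Rintegral -(integral12_prod_meas1 (integrable_prodM ip iq)) /fubini_F/=.
have Q x : (\int[m2]_y (p x * q y)%:E = (p x)%:E * \int[m2]_y (q y)%:E)%E.
  by rewrite -integralZl//; apply: eq_integral => y _; rewrite -EFinM.
under eq_integral do rewrite Q.
have fq : (\int[m2]_y (q y)%:E)%E \is a fin_num by exact: (integrable_fin_num measurableT iq).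
rewrite -(fineK fq) integralZr// fineM//.
exact: (integrable_fin_num measurableT ip).
Qed.

End prodM.

Section measurability.
Context {R : realType}.

Lemma measurable_dotp d (T : measurableType d) n (f g : T -> n.-tuple R) :
  measurable_fun setT f -> measurable_fun setT g ->
  measurable_fun setT (fun t => dotp (f t) (g t)).
Proof.
move=> /measurable_fun_tnthP mf /measurable_fun_tnthP mg.
rewrite /dotp; apply: measurable_sum => i.
by apply: measurable_funM; [exact: mf|exact: mg].
Qed.

Lemma measurable_cos_comp d (T : measurableType d) (f : T -> R) :
  measurable_fun setT f -> measurable_fun setT (fun t => cos (f t)).
Proof.
by apply: measurableT_comp; apply: continuous_measurable_fun; exact: continuous_cos.
Qed.

Lemma measurable_sin_comp d (T : measurableType d) (f : T -> R) :
  measurable_fun setT f -> measurable_fun setT (fun t => sin (f t)).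
Proof.
by apply: measurableT_comp; apply: continuous_measurable_fun; exact: continuous_sin.
Qed.

Lemma measurable_expR_comp d (T : measurableType d) (f : T -> R) :
  measurable_fun setT f -> measurable_fun setT (fun t => expR (f t)).
Proof. by apply: measurableT_comp. Qed.

End measurability.

(** * The Gaussian in several variables *)

Section gaussn.
Context {R : realType}.

Definition gaussn n (x : n.-tuple R) : R := expR (- dotp x x).

Lemma gaussn_ge0 n (x : n.-tuple R) : 0 <= gaussn x.
Proof. exact: expR_ge0. Qed.

Lemma measurable_gaussn n : measurable_fun setT (@gaussn n).
Proof.
by apply: measurable_expR_comp; apply: measurableT_comp => //; exact: measurable_dotp.
Qed.

Lemma dotp_tconsp n (p q : R * n.-tuple R) :
  dotp (tconsp p) (tconsp q) = p.1 * q.1 + dotp p.2 q.2.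
Proof.
rewrite /dotp big_ord_recl !tconsp0; congr (_ + _).
by apply: eq_bigr => i _; rewrite !tconspS.
Qed.

Lemma gaussn_tconsp n (p : R * n.-tuple R) :
  gaussn (tconsp p) = gauss_fun p.1 * gaussn p.2.
Proof. by rewrite /gaussn dotp_tconsp opprD expRD -expr2. Qed.

(** Induction on the dimension through [lebesgue_tcons]. The cosine and sine integrals are treated
    together because the addition formulas for [b.1 * p.1 + dotp b.2 p.2] mix them. *)
Lemma gaussn_fourier n (mu : {measure set (n.-tuple R) -> \bar R}) :
  is_lebesgue_measure mu ->
  mu.-integrable setT (EFin \o @gaussn n) /\
  forall b : n.-tuple R,
    \int[mu]_x (gaussn x * cos (dotp b x)) =
       Num.sqrt pi ^+ n * expR (- (dotp b b / 4)) /\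
    \int[mu]_x (gaussn x * sin (dotp b x)) = 0.
Proof.
elim: n mu => [|n IH] mu lmu.
  (* In dimension 0 the space is a single point, a box whose volume is the empty product. *)
  have m1 : mu setT = 1%E.
    rewrite (_ : setT = box [tuple] [tuple]); last first.
      by apply/seteqP; split => // x _ [].
    by rewrite lebesgue_box ?big_ord0// => -[].
  have d0 (x y : 0.-tuple R) : dotp x y = 0 by rewrite /dotp big_ord0.
  have g1 (x : 0.-tuple R) : gaussn x = 1 by rewrite /gaussn d0 oppr0 expR0.
  split.
    apply: (eq_integrable _ (EFin \o cst 1)) => //.
      by move=> x _; rewrite /= g1.
    apply/integrableP; split; first exact/measurable_EFinP.
    under eq_integral do rewrite /= normr1.
    by rewrite integral_cst// m1 mule1 ltry.
  move=> b; split.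
    under eq_Rintegral do rewrite g1 d0 cos0 mulr1.
    by rewrite Rintegral_cst// m1 d0 mul0r oppr0 expR0 expr0.
  under eq_Rintegral do rewrite g1 d0 sin0 mulr0.
  by rewrite Rintegral_cst// mul0r.
have [nu lnu mun] := lebesgue_tcons lmu.
have [inu Fnu] := IH nu lnu.
have icos (b : n.-tuple R) : nu.-integrable setT (EFin \o (fun x => gaussn x * cos (dotp b x))).
  apply: le_integrable inu => //.
    apply/measurable_EFinP; apply: measurable_funM; first exact: measurable_gaussn.
    by apply: measurable_cos_comp; apply: measurable_dotp.
  by move=> x _ /=; rewrite lee_fin normrM ler_piMr// cos_max.
have isin (b : n.-tuple R) : nu.-integrable setT (EFin \o (fun x => gaussn x * sin (dotp b x))).
  apply: le_integrable inu => //.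
    apply/measurable_EFinP; apply: measurable_funM; first exact: measurable_gaussn.
    by apply: measurable_sin_comp; apply: measurable_dotp.
  by move=> x _ /=; rewrite lee_fin normrM ler_piMr// sin_max.
have jcos (b : R) := integrable_gauss_bounded (measurable_cosM b) (fun x => cos_max (b * x)).
have jsin (b : R) := integrable_gauss_bounded (measurable_sinM b) (fun x => sin_max (b * x)).
split.
  apply/integrableP; split; first by apply/measurable_EFinP; exact: measurable_gaussn.
  rewrite (ge0_integral_change (mu := ((@lebesgue_measure R) \x nu)%E) measurable_tconsp mun)//; last first.
    by do 2 apply: measurableT_comp => //; exact: measurable_gaussn.
  have /integrableP[_] := integrable_prodM (@integrableT_gauss R) inu.
  apply: le_lt_trans; rewrite le_eqVlt; apply/orP; left; apply/eqP.
  by apply: eq_integral => p _; rewrite /= gaussn_tconsp.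
move=> b'; pose b := (tnth b' ord0, tbehead b'); rewrite -(tconspK b') -/b.
have change (h : R -> R) : measurable_fun setT h ->
    \int[mu]_x (gaussn x * h (dotp (tconsp b) x)) =
    \int[(lebesgue_measure \x nu)%E]_p (gauss_fun p.1 * gaussn p.2 * h (b.1 * p.1 + dotp b.2 p.2)).
  move=> mh; rewrite /Rintegral (integral_change (mu := ((@lebesgue_measure R) \x nu)%E) measurable_tconsp mun); last first.
    apply/measurable_EFinP; apply: measurable_funM; first exact: measurable_gaussn.
    by apply: measurableT_comp => //; exact: measurable_dotp.
  by congr fine; apply: eq_integral => p _; rewrite gaussn_tconsp dotp_tconsp.
pose cc := integral_prodM (jcos b.1) (icos b.2).
pose ss := integral_prodM (jsin b.1) (isin b.2).
pose cs := integral_prodM (jcos b.1) (isin b.2).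
pose sc := integral_prodM (jsin b.1) (icos b.2).
pose icc := integrable_prodM (jcos b.1) (icos b.2).
pose iss := integrable_prodM (jsin b.1) (isin b.2).
pose ics := integrable_prodM (jcos b.1) (isin b.2).
pose isc := integrable_prodM (jsin b.1) (icos b.2).
split.
  rewrite change; last by apply: continuous_measurable_fun; exact: continuous_cos.
  have := RintegralB measurableT icc iss; rewrite cc ss (Fnu b.2).2 mulr0 subr0.
  rewrite gauss_cos (Fnu b.2).1 => H; transitivity
   (Num.sqrt pi * expR (- (b.1 ^+ 2 / 4)) * (Num.sqrt pi ^+ n * expR (- (dotp b.2 b.2 / 4)))).
    rewrite -H; apply: eq_Rintegral => p _ /=; rewrite cosD; ring.
  rewrite dotp_tconsp mulrDl opprD expRD -expr2 [_ ^+ n.+1]exprS; ring.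
rewrite change; last by apply: continuous_measurable_fun; exact: continuous_sin.
have := RintegralD measurableT isc ics; rewrite sc cs (Fnu b.2).2 gauss_sin mul0r mulr0 addr0 => H.
rewrite -[RHS]H; apply: eq_Rintegral => p _ /=; rewrite sinD; ring.
Qed.

End gaussn.

Section affine_Rintegral.
Context {R : realType} {n : nat}.
Variable mu : {measure set (n.-tuple R) -> \bar R}.
Hypothesis lmu : is_lebesgue_measure mu.

Lemma integrable_affine (c : R) h (f : n.-tuple R -> R) : 0 < c ->
  mu.-integrable setT (EFin \o f) ->
  mu.-integrable setT (EFin \o (f \o taff c h)).
Proof.
move=> c0 /integrableP[mf ioo]; apply/integrableP; split.
  by apply: (measurableT_comp mf); exact: measurable_taff.
move: ioo; rewrite (integral_affine h lmu c0)//; last exact: measurableT_comp.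
have c1 : (c ^- n * c ^+ n = 1) by rewrite mulVf// expf_neq0// gt_eqF.
set I := (\int[mu]_x `|(EFin \o f) (taff c h x)|)%E => Ioo.
rewrite -[X in (X < +oo)%E]/I.
have -> : I = ((c ^- n)%:E * ((c ^+ n)%:E * I))%E by rewrite muleA -EFinM c1 mul1e.
by rewrite lte_mul_pinfty// lee_fin invr_ge0 exprn_ge0// ltW.
Qed.

Lemma Rintegral_affine (c : R) h (f : n.-tuple R -> R) : 0 < c ->
  mu.-integrable setT (EFin \o f) ->
  \int[mu]_x f x = c ^+ n * \int[mu]_x f (taff c h x).
Proof.
move=> c0 fi; have fi' := integrable_affine h c0 fi.
have mf := measurable_int _ fi.
have cn : (0%R <= (c ^+ n)%:E)%E by rewrite lee_fin exprn_ge0// ltW.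
rewrite /Rintegral -[X in X * _]/(fine (c ^+ n)%:E) -fineM//; last exact: (integrable_fin_num measurableT fi').
congr fine; rewrite integralE [X in _ = (_ * X)%E]integralE.
rewrite (integral_affine h lmu c0 (measurable_funepos mf))//.
rewrite (integral_affine h lmu c0 (measurable_funeneg mf))//.
rewrite -[fun x => (f (taff c h x))%:E]/((EFin \o f) \o taff c h).
rewrite (funepos_comp (EFin \o f) (taff c h)) (funeneg_comp (EFin \o f) (taff c h)).
have fp : (\int[mu]_x ((EFin \o f)^\+ \o taff c h)%E x \is a fin_num)%E.
  by rewrite -funepos_comp; exact: integrable_pos_fin_num.
have fn : (\int[mu]_x ((EFin \o f)^\- \o taff c h)%E x \is a fin_num)%E.
  by rewrite -funeneg_comp; exact: integrable_neg_fin_num.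
transitivity ((c ^+ n)%:E * \int[mu]_x ((EFin \o f)^\+ \o taff c h) x -
  (c ^+ n)%:E * \int[mu]_x ((EFin \o f)^\- \o taff c h) x)%E; first by [].
rewrite -(fineK fp) -(fineK fn); set a := fine _; set b := fine _.
by rewrite -[LHS]/((c ^+ n * a - c ^+ n * b)%:E) -mulrBr.
Qed.

End affine_Rintegral.

(** * The Gaussian damping factor and its transform *)

Section fourier_kernel.
Context {R : realType} {d : nat}.
Implicit Types (x z w h : d.-tuple R).

Definition tzero : d.-tuple R := [tuple 0 | _ < d].
Definition tscale (c : R) x : d.-tuple R := taff c tzero x.

Lemma tnth_tscale c x i : tnth (tscale c x) i = c * tnth x i.
Proof. by rewrite /tscale tnth_taff tnth_mktuple addr0. Qed.

Lemma dotp_tscalel c x z : dotp (tscale c x) z = c * dotp x z.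
Proof.
by rewrite /dotp mulr_sumr; apply: eq_bigr => i _; rewrite tnth_tscale mulrA.
Qed.

Lemma dotpC x z : dotp x z = dotp z x.
Proof. by apply: eq_bigr => i _; rewrite mulrC. Qed.

Lemma dotp_tscaler c x z : dotp x (tscale c z) = c * dotp x z.
Proof. by rewrite dotpC dotp_tscalel dotpC. Qed.

Lemma dotp_ge0 x : 0 <= dotp x x.
Proof. by apply: sumr_ge0 => i _; exact: sqr_ge0. Qed.

Lemma measurable_tscale c : measurable_fun setT (tscale c).
Proof. exact: measurable_taff. Qed.

(** This is exp(- |w|^2 / c^2), which tends to 1 as [c] grows. Its Fourier transform is the
    approximate identity [c ^+ d * fker (tscale c z)]. *)
Definition damp (c : R) w : R := gaussn (tscale c^-1 w).

(** The value of the transform of [gaussn] at [2 * pi * z], where |2 pi z|^2 / 4 = pi^2 |z|^2. *)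
Definition fker z : R := Num.sqrt pi ^+ d * expR (- (pi ^+ 2 * dotp z z)).

Lemma damp_ge0 c w : 0 <= damp c w. Proof. exact: expR_ge0. Qed.

Lemma fker_ge0 z : 0 <= fker z.
Proof. by rewrite mulr_ge0 ?expR_ge0// exprn_ge0// sqrtr_ge0. Qed.

Lemma measurable_damp c : measurable_fun setT (damp c).
Proof. by apply: measurableT_comp; [exact: measurable_gaussn|exact: measurable_tscale]. Qed.

Lemma measurable_fker : measurable_fun setT fker.
Proof.
apply: measurable_funM => //; apply: measurable_expR_comp; apply: measurableT_comp => //.
by apply: measurable_funM => //; exact: measurable_dotp.
Qed.

Variable mu : {measure set (d.-tuple R) -> \bar R}.
Hypothesis lmu : is_lebesgue_measure mu.

Lemma integrable_damp c : 0 < c -> mu.-integrable setT (EFin \o damp c).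
Proof.
move=> c0; apply: (integrable_affine lmu); first by rewrite invr_gt0.
by have [] := gaussn_fourier lmu.
Qed.

Lemma integrable_damp_bounded c (f : d.-tuple R -> R) : 0 < c ->
  measurable_fun setT f -> (forall x, `|f x| <= 1) ->
  mu.-integrable setT (fun x => (damp c x * f x)%:E).
Proof.
move=> c0 mf f1; apply: le_integrable (integrable_damp c0) => //.
  by apply/measurable_EFinP; apply: measurable_funM => //; exact: measurable_damp.
by move=> x _ /=; rewrite lee_fin normrM ler_piMr.
Qed.

Lemma damp_cos c z : 0 < c ->
  \int[mu]_w (damp c w * cos (2 * pi * dotp w z)) = c ^+ d * fker (tscale c z).
Proof.
move=> c0; have mz : measurable_fun setT (fun w => cos (2 * pi * dotp w z)).
  by apply: measurable_cos_comp; apply: measurable_funM => //; exact: measurable_dotp.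
have := integrable_damp_bounded c0 mz (fun x => cos_max _).
move=> /(Rintegral_affine lmu tzero c0) ->; congr (_ * _).
have [_ /(_ (tscale (c * 2 * pi) z))[+ _]] := gaussn_fourier lmu.
rewrite /fker => H; transitivity (\int[mu]_x (gaussn x * cos (dotp (tscale (c * 2 * pi) z) x))).
  apply: eq_Rintegral => x _; rewrite /damp; congr (gaussn _ * cos _).
    apply: eq_from_tnth => i; rewrite !tnth_tscale mulrA mulVf ?mul1r//.
    by rewrite gt_eqF.
  rewrite -/(tscale c x) !dotp_tscalel (dotpC x) !mulrA. ring.
rewrite H; congr (_ * expR (- _)).
by rewrite !dotp_tscalel !dotp_tscaler; field.
Qed.

Lemma damp_sin c z : 0 < c -> \int[mu]_w (damp c w * sin (2 * pi * dotp w z)) = 0.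
Proof.
move=> c0; have mz : measurable_fun setT (fun w => sin (2 * pi * dotp w z)).
  by apply: measurable_sin_comp; apply: measurable_funM => //; exact: measurable_dotp.
have := integrable_damp_bounded c0 mz (fun x => sin_max _).
move=> /(Rintegral_affine lmu tzero c0) ->; rewrite (_ : Rintegral _ _ _ = 0) ?mulr0//.
have [_ /(_ (tscale (c * 2 * pi) z))[_ H]] := gaussn_fourier lmu.
rewrite -[RHS]H; apply: eq_Rintegral => x _; rewrite /damp; congr (gaussn _ * sin _).
  apply: eq_from_tnth => i; rewrite !tnth_tscale mulrA mulVf ?mul1r//.
  by rewrite gt_eqF.
rewrite -/(tscale c x) !dotp_tscalel (dotpC x) !mulrA. ring.
Qed.

Lemma integral_gaussn : (\int[mu]_x (gaussn x)%:E = (Num.sqrt pi ^+ d)%:E)%E.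
Proof.
have [ig /(_ tzero)[+ _]] := gaussn_fourier lmu.
have d0 x : dotp tzero x = 0.
  by apply: big1 => i _; rewrite tnth_mktuple mul0r.
rewrite d0 mul0r oppr0 expR0 mulr1 => <-.
rewrite /Rintegral fineK.
  by apply: eq_integral => x _; rewrite d0 cos0 mulr1.
rewrite (_ : integral _ _ _ = \int[mu]_x (gaussn x)%:E)%E.
  exact: (integrable_fin_num measurableT ig).
by apply: eq_integral => x _; rewrite d0 cos0 mulr1.
Qed.

(** Scaling by [pi] turns the integral into sqrt(pi)^d times the Gaussian integral sqrt(pi)^d,
    divided by pi^d. *)
Lemma integral_fker : (\int[mu]_z (fker z)%:E = 1)%E.
Proof.
have E z : (fker z)%:E = ((Num.sqrt pi ^+ d)%:E * (gaussn (tscale pi z))%:E)%E.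
  rewrite -EFinM /fker /gaussn dotp_tscalel dotp_tscaler; congr (_ * expR (- _))%:E.
  by rewrite mulrA.
have mg : measurable_fun setT (fun z => (gaussn z)%:E).
  by apply/measurable_EFinP; exact: measurable_gaussn.
under eq_integral do rewrite E.
have mgs : measurable_fun setT (fun z => (gaussn (tscale pi z))%:E).
  by apply: (measurableT_comp (f := fun z => (gaussn z)%:E)) => //; exact: measurable_tscale.
have g0 : forall x, setT x -> (0 <= (gaussn (tscale pi x))%:E)%E.
  by move=> x _; rewrite lee_fin gaussn_ge0.
have p0 : (0 <= (Num.sqrt (pi : R) ^+ d)%:E)%E by rewrite lee_fin exprn_ge0// sqrtr_ge0.
rewrite ge0_integralZl//.
have := integral_affine tzero lmu (pi_gt0 R) mg (fun x => _).
rewrite integral_gaussn => /(_ (gaussn_ge0 (n:=d))) H.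
have fi : (\int[mu]_x (gaussn (tscale pi x))%:E)%E \is a fin_num.
  have ip := integrable_affine (n:=d) lmu tzero (pi_gt0 R) (gaussn_fourier lmu).1.
  exact: (integrable_fin_num measurableT ip).
move: H; rewrite -/(tscale pi) -(fineK fi) -!EFinM => -[] H; congr EFin.
apply: (@mulfI _ (pi ^+ d)); first by rewrite expf_neq0// gt_eqF// pi_gt0.
by rewrite mulrCA -H mulr1 -expr2 -exprM mulnC exprM sqr_sqrtr// pi_ge0.
Qed.

End fourier_kernel.

Section damped_parseval.
Context {R : realType} {d : nat} {dX} {X : measurableType dX}.
Variables (mu : {sigma_finite_measure set (d.-tuple R) -> \bar R})
  (m : {sigma_finite_measure set X -> \bar R}).
Hypothesis lmu : is_lebesgue_measure mu.

(** Fubini, then [damp_cos]; the sine part drops out by [damp_sin]. The abstract [X] and [zeta] are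
    meant for pairs (x, y) with frequency x - y, where the inner integral is |F(w)|^2. *)
Lemma damped_parseval (c : R) (zeta : X -> d.-tuple R) (g1 g2 : X -> R) : 0 < c ->
  measurable_fun setT zeta ->
  m.-integrable setT (EFin \o g1) -> m.-integrable setT (EFin \o g2) ->
  (\int[mu]_w (damp c w * \int[m]_p (g1 p * cos (2 * pi * dotp w (zeta p)) +
     g2 p * sin (2 * pi * dotp w (zeta p))))%:E =
   \int[m]_p (g1 p * (c ^+ d * fker (tscale c (zeta p))))%:E)%E.
Proof.
move=> c0 mz i1 i2.
have m1 : measurable_fun setT g1 by apply/measurable_EFinP; exact: measurable_int i1.
have m2 : measurable_fun setT g2 by apply/measurable_EFinP; exact: measurable_int i2.
pose th (q : d.-tuple R * X) := 2 * pi * dotp q.1 (zeta q.2).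
have mth : measurable_fun setT th.
  by apply: measurable_funM => //; apply: measurable_dotp => //; exact: measurableT_comp.
pose F (q : d.-tuple R * X) := damp c q.1 * (g1 q.2 * cos (th q) + g2 q.2 * sin (th q)).
have mF : measurable_fun setT (EFin \o F).
  apply/measurable_EFinP; apply: measurable_funM.
    by apply: measurableT_comp => //; exact: measurable_damp.
  apply: measurable_funD; apply: measurable_funM; try exact: measurableT_comp.
    exact: measurable_cos_comp.
  exact: measurable_sin_comp.
have ig : m.-integrable setT (EFin \o (fun p => `|g1 p| + `|g2 p|)).
  by apply: (integrableD measurableT (integrable_norm i1) (integrable_norm i2)).
have iF : (mu \x m)%E.-integrable setT (EFin \o F).
  apply: le_integrable (integrable_prodM (integrable_damp lmu c0) ig) => //.
  move=> q _ /=; rewrite lee_fin !normrM ler_wpM2l// [leRHS]ger0_norm ?addr_ge0//.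
  apply: (le_trans (ler_normD _ _)); rewrite !normrM.
  by rewrite lerD// ler_piMr// ?cos_max ?sin_max.
have iw w : m.-integrable setT (EFin \o (fun p => g1 p * cos (th (w, p)) + g2 p * sin (th (w, p)))).
  apply: le_integrable ig => //.
    apply/measurable_EFinP; apply: measurable_funD; apply: measurable_funM => //.
      by apply: measurable_cos_comp; exact: measurableT_comp mth (pair1_measurable w).
    by apply: measurable_sin_comp; exact: measurableT_comp mth (pair1_measurable w).
  move=> q _ /=; rewrite lee_fin [leRHS]ger0_norm ?addr_ge0//.
  apply: (le_trans (ler_normD _ _)); rewrite !normrM.
  by rewrite lerD// ler_piMr// ?cos_max ?sin_max.
transitivity (\int[mu]_w \int[m]_p (EFin \o F) (w, p))%E.
  apply: eq_integral => w _.
  rewrite EFinM /Rintegral fineK; last exact: (integrable_fin_num measurableT (iw w)).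
  have Z := integralZl measurableT (iw w) (damp c w).
  apply: (etrans (esym Z)).
  by apply: eq_integral => p _; rewrite -EFinM.
rewrite (Fubini iF); apply: eq_integral => p _.
have mc : measurable_fun setT (fun w => cos (2 * pi * dotp w (zeta p))).
  by apply: measurable_cos_comp; apply: measurable_funM => //; exact: measurable_dotp.
have ms : measurable_fun setT (fun w => sin (2 * pi * dotp w (zeta p))).
  by apply: measurable_sin_comp; apply: measurable_funM => //; exact: measurable_dotp.
have ic := integrable_damp_bounded lmu c0 mc (fun x => cos_max _).
have is_ := integrable_damp_bounded lmu c0 ms (fun x => sin_max _).
transitivity (\int[mu]_w ((g1 p)%:E * (damp c w * cos (2 * pi * dotp w (zeta p)))%:E +
   (g2 p)%:E * (damp c w * sin (2 * pi * dotp w (zeta p)))%:E))%E.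
  apply: eq_integral => w _; rewrite -!EFinM -EFinD /F /th /=; congr EFin. ring.
rewrite integralD//; [|exact: integrableZl..].
rewrite !integralZl//.
rewrite -(fineK (integrable_fin_num measurableT ic)) -(fineK (integrable_fin_num measurableT is_)).
have := damp_cos lmu (zeta p) c0; rewrite /Rintegral => ->.
have := damp_sin lmu (zeta p) c0; rewrite /Rintegral => ->.
by rewrite mule0 adde0 -EFinM.
Qed.

End damped_parseval.

(** * Plancherel's formula *)

Section vanishing.
Context {R : realType}.

(** A one-sided form of convergence to 0, whose comparison and addition rules carry no finiteness
    conditions. For nonnegative sequences it is the usual one, by [vanishes_cvg]. *)
Definition vanishes (t : nat -> \bar R) :=
  forall e : R, 0 < e -> \forall n \near \oo, (t n <= e%:E)%E.

Lemma vanishes_le (s t : nat -> \bar R) : (forall n, s n <= t n)%E ->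
  vanishes t -> vanishes s.
Proof.
move=> st vt e e0; have := vt e e0; apply: filterS => n; exact: le_trans.
Qed.

Lemma vanishesD (s t : nat -> \bar R) : vanishes s -> vanishes t ->
  vanishes (fun n => s n + t n)%E.
Proof.
move=> vs vt e e0; have e2 : 0 < e / 2 by rewrite divr_gt0.
near=> n; rewrite [e]splitr EFinD; apply: leeD; near: n; [exact: vs|exact: vt].
Unshelve. all: by end_near. Qed.

Lemma vanishesZ (c : R) (t : nat -> \bar R) : 0 <= c -> vanishes t ->
  vanishes (fun n => c%:E * t n)%E.
Proof.
move=> c0 vt e e0; have c1 : 0 < c + 1 by rewrite ltr_wpDl.
have e1 : 0 < e / (c + 1) by rewrite divr_gt0.
have := vt _ e1; apply: filterS => n tn.
apply: (le_trans (lee_wpmul2l _ tn)); first by rewrite lee_fin.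
rewrite -EFinM lee_fin mulrCA ger_pMr// ler_pdivrMr// mul1r lerDl//.
Qed.

Lemma vanishes_cvg (t : nat -> \bar R) : (forall n, 0 <= t n)%E ->
  vanishes t <-> t @ \oo --> 0%E.
Proof.
move=> t0; split => [vt|ct e e0].
  apply/fine_cvgP; split.
    have := vt 1 ltr01; apply: filterS => n tn.
    by rewrite ge0_fin_numE// (le_lt_trans tn)// ltry.
  apply/cvgrPdist_le => e e0; have := vt e e0; apply: filterS => n tn.
  have f : (t n \is a fin_num)%E by rewrite ge0_fin_numE// (le_lt_trans tn)// ltry.
  by rewrite /= sub0r normrN ger0_norm ?fine_ge0// -lee_fin fineK.
move/fine_cvgP : ct => [fin /cvgrPdist_le /(_ e e0) H]; near=> n.
have f : (t n \is a fin_num)%E by near: n; exact: fin.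
rewrite -(fineK f) lee_fin.
have : `|0 - fine (t n)| <= e by near: n.
by rewrite sub0r normrN ger0_norm ?fine_ge0.
Unshelve. all: by end_near. Qed.

End vanishing.

(** * Continuity of translations in L^2 *)

Section translation.
Context {R : realType} {d : nat}.
Variable mu : {measure set (d.-tuple R) -> \bar R}.
Hypothesis lmu : is_lebesgue_measure mu.
Implicit Types (u v : d.-tuple R -> R) (x z h : d.-tuple R).

Definition sqint u : \bar R := (\int[mu]_x (u x ^+ 2)%:E)%E.

Definition tshift h x := taff 1 h x.

Lemma measurable_tshift h : measurable_fun setT (tshift h).
Proof. exact: measurable_taff. Qed.

Lemma integral_shift h (f : d.-tuple R -> \bar R) : measurable_fun setT f ->
  (forall x, 0 <= f x)%E -> (\int[mu]_x f (tshift h x) = \int[mu]_x f x)%E.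
Proof.
move=> mf f0; rewrite [RHS](integral_affine h lmu (@ltr01 R))//.
by rewrite expr1n mul1e.
Qed.

Lemma measurable_sq u : measurable_fun setT u ->
  measurable_fun setT (fun x => (u x ^+ 2)%:E).
Proof. by move=> mu_; apply/measurable_EFinP; exact: measurable_funX. Qed.

Lemma sqint_ge0 u : (0 <= sqint u)%E.
Proof. by apply: integral_ge0 => x _; rewrite lee_fin sqr_ge0. Qed.

Lemma sqintD_le u v : measurable_fun setT u -> measurable_fun setT v ->
  (sqint (fun x => u x + v x)%R <= 2%:E * sqint u + 2%:E * sqint v)%E.
Proof.
move=> mu_ mv; have mu2 := measurable_sq mu_; have mv2 := measurable_sq mv.
have u0 : forall x : d.-tuple R, setT x -> (0 <= (u x ^+ 2)%:E)%E.
  by move=> x _; rewrite lee_fin sqr_ge0.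
have v0 : forall x : d.-tuple R, setT x -> (0 <= (v x ^+ 2)%:E)%E.
  by move=> x _; rewrite lee_fin sqr_ge0.
rewrite /sqint -!ge0_integralZl// -ge0_integralD//; last 4 first.
- by move=> x _; rewrite mule_ge0// u0.
- by apply: measurable_funeM.
- by move=> x _; rewrite mule_ge0// v0.
- by apply: measurable_funeM.
apply: ge0_le_integral => //.
- by move=> x _; rewrite lee_fin sqr_ge0.
- by apply: measurable_sq; exact: measurable_funD.
- by apply: emeasurable_funD; apply: measurable_funeM.
- move=> x _; rewrite -!EFinM -EFinD lee_fin -subr_ge0.
  rewrite (_ : _ - _ = (u x - v x) ^+ 2); last by ring.
  exact: sqr_ge0.
Qed.

Lemma sqintZ c u : measurable_fun setT u ->
  sqint (fun x => c * u x) = ((c ^+ 2)%:E * sqint u)%E.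
Proof.
move=> mu_; rewrite /sqint -ge0_integralZl//.
- by apply: eq_integral => x _; rewrite exprMn EFinM.
- exact: measurable_sq.
- by move=> x _; rewrite lee_fin sqr_ge0.
- by rewrite lee_fin sqr_ge0.
Qed.

Lemma sqintN u : sqint (fun x => - u x) = sqint u.
Proof. by apply: eq_integral => x _; rewrite sqrrN. Qed.

Lemma sqint_shift h u : measurable_fun setT u ->
  sqint (fun x => u (tshift h x)) = sqint u.
Proof.
move=> mu_; rewrite /sqint (integral_shift h (f := fun x => (u x ^+ 2)%:E))//.
  exact: measurable_sq.
by move=> x; rewrite lee_fin sqr_ge0.
Qed.

Definition tdiff h u x := u (tshift h x) - u x.

Lemma measurable_tdiff h u : measurable_fun setT u -> measurable_fun setT (tdiff h u).
Proof.
move=> mu_; apply: measurable_funB => //.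
by apply: measurableT_comp => //; exact: measurable_tshift.
Qed.

Lemma sqint_tdiff_le h u : measurable_fun setT u ->
  (sqint (tdiff h u) <= 4%:E * sqint u)%E.
Proof.
move=> mu_; have mus : measurable_fun setT (fun x => u (tshift h x)).
  by apply: measurableT_comp => //; exact: measurable_tshift.
apply: (le_trans (sqintD_le mus _)); first exact: measurableT_comp.
rewrite sqintN sqint_shift// -ge0_muleDl// -EFinD.
by rewrite (_ : 2 + 2 = 4 :> R) //; ring.
Qed.

Definition tstep z (n : nat) : d.-tuple R := tscale n.+1%:R^-1 z.

(** Continuity along the steps [z / (n + 1)] only: these are the shifts that the substitution in the
    heat kernel of scale [n + 1] produces. *)
Definition transl_cont u :=
  measurable_fun setT u /\ forall z, vanishes (fun n => sqint (tdiff (tstep z n) u)).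

Lemma transl_contD u v : transl_cont u -> transl_cont v ->
  transl_cont (fun x => u x + v x).
Proof.
move=> [mu_ cu] [mv cv]; split; first exact: measurable_funD.
move=> z; apply: (vanishes_le
  (t := fun n => 2%:E * sqint (tdiff (tstep z n) u) + 2%:E * sqint (tdiff (tstep z n) v))%E).
  move=> n; apply: le_trans (sqintD_le (measurable_tdiff _ mu_) (measurable_tdiff _ mv)).
  rewrite le_eqVlt; apply/orP; left; apply/eqP; apply: eq_integral => x _.
  by congr (_ ^+ 2)%:E; rewrite /tdiff; ring.
by apply: vanishesD; apply: vanishesZ.
Qed.

Lemma transl_contZ c u : transl_cont u -> transl_cont (fun x => c * u x).
Proof.
move=> [mu_ cu]; split; first exact: measurable_funM.
move=> z; apply: (vanishes_le (t := fun n => (c ^+ 2)%:E * sqint (tdiff (tstep z n) u))%E).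
  move=> n; rewrite -sqintZ; last exact: measurable_tdiff.
  rewrite le_eqVlt; apply/orP; left; apply/eqP; apply: eq_integral => x _.
  by congr (_ ^+ 2)%:E; rewrite /tdiff; ring.
by apply: vanishesZ => //; exact: sqr_ge0.
Qed.

Lemma transl_cont0 : transl_cont (fun=> 0).
Proof.
split => // z e e0; apply: nearW => n.
rewrite /sqint /tdiff; under eq_integral do rewrite subrr expr0n/=.
by rewrite integral0 lee_fin ltW.
Qed.

Lemma transl_cont_lim u : measurable_fun setT u ->
  (forall e : R, 0 < e -> exists2 v, transl_cont v & (sqint (fun x => u x - v x)%R <= e%:E)%E) ->
  transl_cont u.
Proof.
move=> mu_ approx; split=> // z e e0.
(* By [sqint_tdiff_le] the difference operator costs a factor 4 and by [sqintD_le] the sum costs a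
   factor 2: 2 * 4 * e/16 + 2 * e/4 = e. *)
have e16 : 0 < e / 16 by rewrite divr_gt0.
have [v [mv cv] uv] := approx _ e16.
have e4 : 0 < e / 4 by rewrite divr_gt0.
have := cv z _ e4; apply: filterS => n vn.
have muv : measurable_fun setT (fun x => u x - v x) by exact: measurable_funB.
have -> : sqint (tdiff (tstep z n) u) = sqint (fun x =>
    tdiff (tstep z n) (fun x => u x - v x) x + tdiff (tstep z n) v x).
  by apply: eq_integral => x _; congr (_ ^+ 2)%:E; rewrite /tdiff; ring.
apply: (le_trans (sqintD_le (measurable_tdiff _ muv) (measurable_tdiff _ mv))).
have p4 : (0%R <= 4%:E :> \bar R)%E by rewrite lee_fin.
have p2 : (0%R <= 2%:E :> \bar R)%E by rewrite lee_fin.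
have h1 := le_trans (sqint_tdiff_le (tstep z n) muv) (lee_wpmul2l p4 uv).
have h2 := lee_wpmul2l p2 h1.
have h3 := lee_wpmul2l p2 vn.
apply: (le_trans (leeD h2 h3)); rewrite -!EFinM -EFinD lee_fin.
by rewrite le_eqVlt; apply/orP; left; apply/eqP; field.
Qed.

(* By dominated convergence the indicators of such sets, when of finite measure,
   are translation-continuous in [L^2]; these sets form a pi-system that
   generates the sigma-algebra. *)
Definition stable_set (S : set (d.-tuple R)) := measurable S /\
  forall x z, S x -> \forall n \near \oo, S (tshift (tstep z n) x).

Lemma stable_setT : stable_set setT.
Proof. by split => // x z _; exact: nearW. Qed.

Lemma stable_setI : setI_closed stable_set.
Proof.
move=> A B [mA sA] [mB sB]; split; first exact: measurableI.
by move=> x z [Ax Bx]; near=> n; split; near: n; [exact: sA|exact: sB].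
Unshelve. all: by end_near. Qed.

(** Openness: the slack [s * tnth x i - r] absorbs [s * tnth z i / (n + 1)] once [n] is large. The
    factor [s] allows both orientations. *)
Lemma stable_halfspace (s r : R) i : stable_set [set x | r < s * tnth x i].
Proof.
split.
  rewrite (_ : [set _ | _] = (fun x : d.-tuple R => s * tnth x i) @^-1` `]r, +oo[%classic).
    rewrite -[X in measurable X]setTI.
    have m : measurable_fun setT (fun x : d.-tuple R => s * tnth x i).
      by apply: measurable_funM => //; exact: measurable_tnth_real.
    by apply: m => //; exact: measurable_itv.
  by apply/seteqP; split => x; rewrite /= in_itv/= andbT.
move=> x z /= rx; have e0 : 0 < s * tnth x i - r by rewrite subr_gt0.
near=> n; rewrite tnth_taff mul1r tnth_tscale mulrDr -ltrBlDl.
have n0 : 0 < n.+1%:R :> R by rewrite ltr0n.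
have h : - (s * tnth z i) / (s * tnth x i - r) < n.+1%:R.
  rewrite (@lt_trans _ _ n%:R)// ?ltr_nat//.
  by near: n; exact: nbhs_infty_gtr.
rewrite mulrCA (mulrC n.+1%:R^-1) ltr_pdivlMr//.
move: h; rewrite ltr_pdivrMr// => h; rewrite -subr_gt0.
rewrite (_ : _ - _ = n.+1%:R * (s * tnth x i - r) - - (s * tnth z i)); last by ring.
by rewrite subr_gt0.
Unshelve. all: by end_near. Qed.

(** Written as an intersection of half-spaces so that stability is inherited from [stable_halfspace]
    and [stable_setI]. *)
Definition ocube (k : nat) : set (d.-tuple R) := \big[setI/setT]_(i < d)
  ([set x | - k%:R < 1 * tnth x i] `&` [set x | - k%:R < -1 * tnth x i]).

Lemma stable_ocube k : stable_set (ocube k).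
Proof.
apply: big_ind; [exact: stable_setT|exact: stable_setI|].
by move=> i _; apply: stable_setI; exact: stable_halfspace.
Qed.

Lemma ocubeP k x : ocube k x <-> forall i, `|tnth x i| < k%:R.
Proof.
rewrite /ocube -bigcap_seq; split => [h i|h i _].
  have := h i; rewrite /= mem_index_enum => /(_ isT)[].
  by rewrite mul1r mulN1r ltrN2 ltr_norml => -> ->.
by have := h i; rewrite /= mul1r mulN1r ltrN2 ltr_norml => /andP[-> ->].
Qed.

Lemma ocube_cube k : ocube k `<=` cube k.
Proof. by move=> x /ocubeP h; apply/cubeP => i; exact: ltW. Qed.

Lemma ocube_fin k : (mu (ocube k) < +oo)%E.
Proof.
apply: le_lt_trans (lebesgue_cube_fin k lmu).
by apply: le_measure; [rewrite inE; exact: (stable_ocube k).1|rewrite inE; exact: measurable_box|exact: ocube_cube].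
Qed.

(** A closed box is a finite intersection of complements of open half-spaces, so the stable sets
    generate at least what the boxes do. *)
Lemma measurable_stableE : @measurable _ (d.-tuple R) = <<s stable_set >>.
Proof.
apply/seteqP; split; last first.
  by apply: smallest_sub; [exact: sigma_algebra_measurable|move=> S []].
rewrite measurable_tupleE; apply: smallest_sub; first exact: smallest_sigma_algebra.
move=> _ [[a b] _ <-] /=.
rewrite (_ : box a b = \big[setI/setT]_(i < d)
  (~` [set x | - tnth a i < -1 * tnth x i] `&` ~` [set x | tnth b i < 1 * tnth x i])).
  have mh (s r : R) (i : 'I_d) : <<s stable_set >> [set x : d.-tuple R | r < s * tnth x i].
    by apply: sub_sigma_algebra; exact: stable_halfspace.
  apply: (big_ind (fun S => <<s stable_set >> S)).
  - exact: (@measurableT _ (g_sigma_algebraType stable_set)).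
  - by move=> A B mA mB; exact: (@measurableI _ (g_sigma_algebraType stable_set)).
  - move=> i _; apply: (@measurableI _ (g_sigma_algebraType stable_set));
      by apply: (@measurableC _ (g_sigma_algebraType stable_set)); exact: mh.
rewrite -bigcap_seq; apply/seteqP; split => x /= h i.
  move=> _; have /andP[h1 h2] := h i; split; apply/negP; rewrite -leNgt.
    by rewrite mulN1r lerN2.
  by rewrite mul1r.
have := h i; rewrite /= mem_index_enum => /(_ isT)[/negP + /negP].
by rewrite -!leNgt mulN1r lerN2 mul1r => -> ->.
Qed.

Lemma indic_sq (S : set (d.-tuple R)) x : (\1_S x : R) ^+ 2 = \1_S x.
Proof. by rewrite indicE; case: (x \in S); rewrite ?expr1n ?expr0n. Qed.

Lemma indic01 (S : set (d.-tuple R)) x : 0 <= (\1_S x : R) <= 1.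
Proof. by rewrite indicE; case: (x \in S); rewrite ?lexx ?ler01. Qed.

Lemma integrable_indic_fin (S : set (d.-tuple R)) : measurable S -> (mu S < +oo)%E ->
  mu.-integrable setT (fun x => (\1_S x)%:E).
Proof.
move=> mS Soo; apply/integrableP; split; first exact/measurable_EFinP.
under eq_integral do rewrite gee0_abs ?lee_fin//.
by rewrite integral_indic// setIT.
Qed.

Lemma transl_cont_stable (S : set (d.-tuple R)) : stable_set S -> (mu S < +oo)%E ->
  transl_cont (\1_S).
Proof.
move=> [mS sS] Soo; split=> // z.
pose a n x : R := \1_S (tshift (tstep z n) x).
pose p n x : R := \1_S x * (1 - a n x).
have ma n : measurable_fun setT (a n).
  by apply: measurableT_comp => //; exact: measurable_tshift.
have mp n : measurable_fun setT (p n).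
  by apply: measurable_funM => //; exact: measurable_funB.
have p0 n x : 0 <= p n x.
  have /andP[i0 _] := indic01 S x; have /andP[_ i1] := indic01 S (tshift (tstep z n) x).
  by rewrite mulr_ge0// subr_ge0.
have a0 n x : 0 <= a n x by have /andP[] := indic01 S (tshift (tstep z n) x).
have b0 x : 0 <= (\1_S x : R) by have /andP[] := indic01 S x.
have Sf : mu S \is a fin_num by rewrite ge0_fin_numE.
(* The squared difference lives partly on the shifted set, so [\1_S] does not dominate it. Since the
   shift preserves the integral of [\1_S], the two halves of the symmetric difference have equal
   mass, and [p], which is one half, is dominated by [\1_S]. The finite [mu S] is added to both
   sides to avoid subtraction. *)
have E n : sqint (tdiff (tstep z n) (\1_S)) = (2%:E * \int[mu]_x (p n x)%:E)%E.
  suff H : (sqint (tdiff (tstep z n) (\1_S)) + mu S =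
      2%:E * \int[mu]_x (p n x)%:E + mu S)%E.
    by apply/eqP; rewrite eq_le; apply/andP; split; rewrite -(@leeD2rE _ (mu S))// H lexx.
  have muS : mu S = (\int[mu]_x (\1_S x)%:E)%E by rewrite integral_indic// setIT.
  rewrite [in LHS]muS.
  have mq := measurable_sq (measurable_tdiff (tstep z n) (measurable_indic mS)).
  have mS' : measurable_fun setT (fun x => (\1_S x : R)%:E) by exact/measurable_EFinP.
  have ma' : measurable_fun setT (fun x => (a n x)%:E) by exact/measurable_EFinP.
  have mp' : measurable_fun setT (fun x => (p n x)%:E) by exact/measurable_EFinP.
  have mp2 : measurable_fun setT (fun x => 2%:E * (p n x)%:E)%E by exact: measurable_funeM.
  have q0 x : setT x -> (0 <= (tdiff (tstep z n) (\1_S) x ^+ 2)%:E)%E.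
    by move=> _; rewrite lee_fin sqr_ge0.
  have b0' x : setT x -> (0 <= (\1_S x : R)%:E)%E by move=> _; rewrite lee_fin.
  have a0' x : setT x -> (0 <= (a n x)%:E)%E by move=> _; rewrite lee_fin.
  have p0' x : setT x -> (0 <= (p n x)%:E)%E by move=> _; rewrite lee_fin.
  have p20 x : setT x -> (0 <= 2%:E * (p n x)%:E)%E by move=> _; rewrite mule_ge0// lee_fin.
  transitivity (\int[mu]_x (2%:E * (p n x)%:E + (a n x)%:E))%E.
    rewrite /sqint -ge0_integralD//.
    apply: eq_integral => x _; rewrite -EFinM -!EFinD; congr EFin.
    have := indic_sq S (tshift (tstep z n) x); have := indic_sq S x.
    rewrite /p /a /tdiff; set A := \1_S (tshift _ _); set B := \1_S x => B2 A2.
    rewrite sqrrB A2 B2; ring.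
  rewrite ge0_integralD//; congr (_ + _)%E; first by rewrite ge0_integralZl.
  by rewrite (integral_shift (tstep z n) (f := fun x => (\1_S x)%:E)) ?muS.
have v : vanishes (fun n => \int[mu]_x (p n x)%:E)%E.
  apply/vanishes_cvg; first by move=> n; apply: integral_ge0 => x _; rewrite lee_fin.
  have [] := @dominated_convergence _ _ _ mu setT measurableT
    (fun n x => (p n x)%:E) (cst 0%E) (fun x => (\1_S x)%:E).
  - by move=> n; exact/measurable_EFinP.
  - exact: measurable_cst.
  - apply: aeW => x _; apply: cvg_near_cst.
    have [Sx|nSx] := pselect (S x).
      have := sS x z Sx; apply: filterS => n Sn.
      by rewrite /p /a [X in _ * (1 - X)]indicE mem_set// subrr mulr0.
    by apply: nearW => n; rewrite /p indicE memNset// mul0r.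
  - exact: integrable_indic_fin.
  - apply: aeW => x n _; rewrite gee0_abs ?lee_fin// /p ler_piMr//.
    by rewrite lerBlDr lerDl.
  by rewrite integral0.
move=> e e0; have := vanishesZ (ler0n R 2) v e0.
by apply: filterS => n; rewrite E.
Qed.

(** Cutting with a cube keeps every set of finite measure, so that the property can pass to
    complements. *)
Definition local_cont k (A : set (d.-tuple R)) :=
  transl_cont (fun x => \1_A x * \1_(ocube k) x).

Lemma local_contE k A : (fun x => \1_A x * \1_(ocube k) x : R) = \1_(A `&` ocube k).
Proof. by apply/funext => x; rewrite indicI. Qed.

Lemma local_cont_setU k A B : A `&` B = set0 -> local_cont k A -> local_cont k B ->
  local_cont k (A `|` B).
Proof.
move=> AB0 cA cB; have := transl_contD cA cB; congr transl_cont.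
apply/funext => x; rewrite -mulrDl; congr (_ * _).
rewrite !indicE in_setU; case: (boolP (x \in A)) => xA; case: (boolP (x \in B)) => xB //=.
- by have : (A `&` B) x; [split; exact: set_mem|rewrite AB0].
- by rewrite addr0.
- by rewrite add0r.
- by rewrite addr0.
Qed.

(** Dynkin's theorem from the stable sets. A complement is subtracted from the cube; a countable
    disjoint union is an L^2-limit of finite ones, dominated by the indicator of the cube. *)
Lemma local_cont_measurable k A : measurable A -> local_cont k A.
Proof.
have sQ := stable_ocube k; have mQ := sQ.1.
rewrite measurable_stableE => mA.
apply: (dynkin_induction (G := stable_set) (P := local_cont k)) mA.
- exact: measurable_stableE.
- exact: stable_setI.
- rewrite /local_cont local_contE setTI; apply: transl_cont_stable => //; exact: ocube_fin.
- move=> S sS; rewrite /local_cont local_contE; apply: transl_cont_stable.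
    exact: stable_setI.
  apply: le_lt_trans (ocube_fin k).
  by apply: le_measure; [rewrite inE; exact: (stable_setI sS sQ).1|rewrite inE|exact: subIsetr].
- move=> S mS cS.
  have := transl_contD (transl_cont_stable sQ (ocube_fin k)) (transl_contZ (-1) cS).
  congr transl_cont; apply/funext => x.
  rewrite !indicE in_setC; case: (x \in S); rewrite ?mul1r ?mul0r ?mulr0 ?addr0//.
  by rewrite mulN1r subrr.
- move=> F mF tF cF; pose G n := \big[setU/set0]_(i < n) F i.
  have mG n : measurable (G n) by apply: bigsetU_measurable.
  have mUF : measurable (\bigcup_k F k) by exact: bigcupT_measurable.
  have cG n : local_cont k (G n).
    elim: n => [|n IH]; rewrite /G ?big_ord0 ?big_ord_recr/=.
      have := transl_cont0; congr transl_cont; apply/funext => x.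
      by rewrite indic0 mul0r.
    apply: local_cont_setU => //.
    rewrite big_distrl/=; apply: big1 => i _.
    move/trivIsetP : tF => /(_ i n Logic.I Logic.I) -> //.
    by rewrite ltn_eqF.
  have mI (B : set (d.-tuple R)) : measurable B -> measurable_fun setT (\1_B : _ -> R).
    by move=> mB; exact: measurable_indic.
  have GU n : G n `<=` \bigcup_k F k by exact: bigsetU_bigcup.
  apply: transl_cont_lim.
    by apply: measurable_funM; exact: mI.
  suff v : vanishes (fun n => sqint (fun x => \1_(\bigcup_k F k) x * \1_(ocube k) x -
      \1_(G n) x * \1_(ocube k) x)%R).
    move=> e e0; have [N _ /(_ N (leqnn N)) vN] := v e e0.
    by exists (fun x => \1_(G N) x * \1_(ocube k) x); [exact: cG|exact: vN].
  have mq n : measurable_fun setT (fun x => ((\1_(\bigcup_k F k) x * \1_(ocube k) x -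
      \1_(G n) x * \1_(ocube k) x : R) ^+ 2)%:E).
    by apply: measurable_sq; apply: measurable_funB; apply: measurable_funM; exact: mI.
  apply/vanishes_cvg; first by move=> n; exact: sqint_ge0.
  have [] := @dominated_convergence _ _ _ mu setT measurableT
    (fun n x => ((\1_(\bigcup_k F k) x * \1_(ocube k) x -
      \1_(G n) x * \1_(ocube k) x : R) ^+ 2)%:E) (cst 0%E) (fun x => (\1_(ocube k) x)%:E).
  + exact: mq.
  + exact: measurable_cst.
  + apply: aeW => x _; apply: cvg_near_cst.
    have [[j _ Fjx]|nx] := pselect ((\bigcup_k F k) x).
      near=> n; have Gx : G n x.
        rewrite /G -bigcup_mkord; exists j => //=.
        by near: n; exact: nbhs_infty_gt.
      have Ux : (\bigcup_k F k) x by exists j.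
      by rewrite (indicE R (\bigcup_k0 F k0) x) (indicE R (G n) x) (mem_set Ux) (mem_set Gx) subrr expr0n.
    apply: nearW => n; have nG : ~ G n x by move=> /GU.
    by rewrite (indicE R (\bigcup_k0 F k0) x) (indicE R (G n) x) (memNset nx) (memNset nG) !mul0r subrr expr0n.
  + by apply: integrable_indic_fin => //; exact: ocube_fin.
  + apply: aeW => x n _; rewrite gee0_abs ?lee_fin ?sqr_ge0//.
    rewrite !indicE; case: (x \in ocube k); last by rewrite !mulr0 subrr expr0n.
    by case: (x \in _); case: (x \in _);
      rewrite ?mul1r ?mul0r ?subrr ?subr0 ?sub0r ?sqrrN ?expr1n ?expr0n//= ?ler01.
  by rewrite integral0.
Unshelve. all: by end_near. Qed.

Import HBNNSimple.

Lemma transl_cont_nnsfun k (g : {nnsfun (d.-tuple R) >-> R}) :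
  transl_cont (fun x => g x * \1_(ocube k) x).
Proof.
have [s gs] : exists s : seq R, forall x, g x = \sum_(y <- s) (y * \1_(g @^-1` [set y]) x).
  by exists (finmap.enum_fset (fset_set (range g))) => x; rewrite fimfunE fsbig_finite.
have -> : (fun x => g x * \1_(ocube k) x) = (fun x =>
    \sum_(y <- s) (y * (\1_(g @^-1` [set y]) x * \1_(ocube k) x))).
  apply/funext => x; rewrite gs mulr_suml.
  by apply: eq_bigr => y _; rewrite mulrA.
elim: s {gs} => [|y s IH].
  have := transl_cont0; congr transl_cont; apply/funext => x.
  by rewrite big_nil.
have mg : measurable (g @^-1` [set y]) by exact: measurable_sfunP.
have := transl_contD (transl_contZ y (local_cont_measurable k mg)) IH.
by congr transl_cont; apply/funext => x; rewrite big_cons.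
Qed.

(** Simple functions below [u], cut to growing cubes, approximate [u] in L^2 with the squared error
    dominated by [u ^+ 2]. *)
Lemma transl_cont_ge0 u : measurable_fun setT u -> (forall x, 0 <= u x) ->
  (sqint u < +oo)%E -> transl_cont u.
Proof.
move=> mu_ u0 uoo; apply: transl_cont_lim => //.
have mEu : measurable_fun setT (EFin \o u) by exact/measurable_EFinP.
pose g := nnsfun_approx measurableT mEu.
have gu n x : 0 <= g n x <= u x.
  apply/andP; split; first exact: fun_ge0.
  by rewrite -lee_fin /g nnsfun_approxE; apply: le_approx => // y _; rewrite lee_fin.
have mv n : measurable_fun setT (fun x => u x - g n x * \1_(ocube n) x).
  apply: measurable_funB => //; apply: measurable_funM; first exact: measurable_funP.
  by apply: measurable_indic; exact: (stable_ocube n).1.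
suff v : vanishes (fun n => sqint (fun x => u x - g n x * \1_(ocube n) x)%R).
  move=> e e0; have [N _ /(_ N (leqnn N)) vN] := v e e0.
  by exists (fun x => g N x * \1_(ocube N) x) => //; exact: transl_cont_nnsfun.
apply/vanishes_cvg; first by move=> n; exact: sqint_ge0.
have [] := @dominated_convergence _ _ _ mu setT measurableT
  (fun n x => ((u x - g n x * \1_(ocube n) x) ^+ 2)%:E) (cst 0%E) (fun x => (u x ^+ 2)%:E).
- by move=> n; exact: measurable_sq.
- exact: measurable_cst.
- apply: aeW => x _; apply: cvg_EFin; first exact: nearW.
  have gx : (g n x) @[n --> \oo] --> u x.
    by have := cvg_nnsfun_approx measurableT mEu (fun x _ => u0 x) (x := x) I; move=> /fine_cvgP[].
  have c : ((u x - g n x) ^+ 2) @[n --> \oo] --> (0 : R).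
    rewrite (_ : 0 = (u x - u x) ^+ 2 :> R); last by rewrite subrr expr0n.
    have h : (u x - g n x) @[n --> \oo] --> u x - u x by apply: cvgB => //; exact: cvg_cst.
    exact: (cvgM h h).
  apply: cvg_trans c; apply: near_eq_cvg; near=> n.
  have xn : ocube n x.
    apply/ocubeP => i; apply: (le_lt_trans (tnth_le_sum x i)).
    by near: n; exact: nbhs_infty_gtr.
  by rewrite /= indicE mem_set// mulr1.
- apply/integrableP; split; first exact: measurable_sq.
  by under eq_integral do rewrite gee0_abs ?lee_fin ?sqr_ge0//.
- apply: aeW => x n _; rewrite gee0_abs ?lee_fin ?sqr_ge0//.
  have /andP[g0 g1] := gu n x; have /andP[i0 i1] := indic01 (ocube n) x.
  rewrite ler_sqr ?nnegrE ?subr_ge0//.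
    by rewrite gerBl// mulr_ge0.
  by apply: le_trans g1; rewrite ler_piMr.
by rewrite integral0.
Unshelve. all: by end_near. Qed.

Lemma transl_cont_L2 u : measurable_fun setT u -> (sqint u < +oo)%E -> transl_cont u.
Proof.
move=> mu_ uoo.
have h (s : R) : s ^+ 2 = 1 -> transl_cont (fun x => Num.max (s * u x) 0).
  move=> s2; have m : measurable_fun setT (fun x => Num.max (s * u x) 0).
    by apply: measurable_maxr => //; exact: measurable_funM.
  apply: transl_cont_ge0 => //.
    by move=> x; rewrite le_max lexx orbT.
  apply: le_lt_trans uoo; apply: ge0_le_integral => //.
  - by move=> x _; rewrite lee_fin sqr_ge0.
  - exact: measurable_sq.
  - exact: measurable_sq.
  - move=> x _; rewrite lee_fin; have [_|_] := leP (s * u x) 0.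
      by rewrite expr0n/= sqr_ge0.
    by rewrite exprMn s2 mul1r.
have h1 : (1 : R) ^+ 2 = 1 by rewrite expr1n.
have h2 : (-1 : R) ^+ 2 = 1 by rewrite sqrrN expr1n.
have := transl_contD (h _ h1) (transl_contZ (-1) (h _ h2)).
congr transl_cont; apply/funext => x; rewrite mul1r !mulN1r.
have [u0|u0] := leP (u x) 0.
  by rewrite max_l ?oppr_ge0// sub0r opprK.
by rewrite max_r ?oppr_le0 ?(ltW u0)// subr0.
Qed.

End translation.

(** * Damping and heat kernels *)

Section plancherel.
Context {R : realType} {d : nat}.
Variable mu : {sigma_finite_measure set (d.-tuple R) -> \bar R}.
Hypothesis lmu : is_lebesgue_measure mu.
Implicit Types (u v : d.-tuple R -> R) (x y z w h : d.-tuple R).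

(** [ftre] and [ftim] are the real and imaginary parts of the Fourier integral of [u + i v], and
    [ftsq] is its squared modulus. *)
Definition ftre u v w :=
  \int[mu]_x (u x * cos (2 * pi * dotp x w) + v x * sin (2 * pi * dotp x w)).
Definition ftim u v w :=
  \int[mu]_x (v x * cos (2 * pi * dotp x w) - u x * sin (2 * pi * dotp x w)).

Definition ftsq u v w := ftre u v w ^+ 2 + ftim u v w ^+ 2.

Lemma measurable_phase w : measurable_fun setT (fun x => 2 * pi * dotp x w).
Proof. by apply: measurable_funM => //; exact: measurable_dotp. Qed.

Lemma integrable_bounded_mul u (b : d.-tuple R -> R) :
  mu.-integrable setT (EFin \o u) -> measurable_fun setT b ->
  (forall x, `|b x| <= 1) -> mu.-integrable setT (fun x => (u x * b x)%:E).
Proof.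
move=> iu mb b1; apply: le_integrable (iu) => //.
  apply/measurable_EFinP; apply: measurable_funM => //.
  by apply/measurable_EFinP; exact: measurable_int iu.
by move=> x _ /=; rewrite lee_fin normrM ler_piMr.
Qed.

Lemma integrable_cos_phase u w : mu.-integrable setT (EFin \o u) ->
  mu.-integrable setT (fun x => (u x * cos (2 * pi * dotp x w))%:E).
Proof.
move=> iu; apply: integrable_bounded_mul => // [|x]; last exact: cos_max.
by apply: measurable_cos_comp; exact: measurable_phase.
Qed.

Lemma integrable_sin_phase u w : mu.-integrable setT (EFin \o u) ->
  mu.-integrable setT (fun x => (u x * sin (2 * pi * dotp x w))%:E).
Proof.
move=> iu; apply: integrable_bounded_mul => // [|x]; last exact: sin_max.
by apply: measurable_sin_comp; exact: measurable_phase.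
Qed.

Lemma integrable_ftre u v w : mu.-integrable setT (EFin \o u) ->
  mu.-integrable setT (EFin \o v) ->
  mu.-integrable setT (EFin \o (fun x =>
    u x * cos (2 * pi * dotp x w) + v x * sin (2 * pi * dotp x w))).
Proof.
move=> iu iv.
have := integrableD measurableT (integrable_cos_phase w iu) (integrable_sin_phase w iv).
exact: eq_integrable.
Qed.

Lemma integrable_ftim u v w : mu.-integrable setT (EFin \o u) ->
  mu.-integrable setT (EFin \o v) ->
  mu.-integrable setT (EFin \o (fun x =>
    v x * cos (2 * pi * dotp x w) - u x * sin (2 * pi * dotp x w))).
Proof.
move=> iu iv.
have := integrableB measurableT (integrable_cos_phase w iv) (integrable_sin_phase w iu).
exact: eq_integrable.
Qed.

Lemma dotp_tsub w x y : dotp w (tsub x y) = dotp x w - dotp y w.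
Proof.
rewrite /dotp -sumrB; apply: eq_bigr => i _.
by rewrite tnth_mktuple; ring.
Qed.

(** With f = u + i v, [acorr] and [acorr'] are the real and imaginary parts of f(x) conj (f(y)). *)
Definition acorr u v (p : d.-tuple R * d.-tuple R) := u p.1 * u p.2 + v p.1 * v p.2.
Definition acorr' u v (p : d.-tuple R * d.-tuple R) := v p.1 * u p.2 - u p.1 * v p.2.

Lemma integrable_acorr u v : mu.-integrable setT (EFin \o u) ->
  mu.-integrable setT (EFin \o v) -> (mu \x mu)%E.-integrable setT (EFin \o acorr u v).
Proof.
move=> iu iv; have := integrableD measurableT (integrable_prodM iu iu) (integrable_prodM iv iv).
exact: eq_integrable.
Qed.

Lemma integrable_acorr' u v : mu.-integrable setT (EFin \o u) ->
  mu.-integrable setT (EFin \o v) -> (mu \x mu)%E.-integrable setT (EFin \o acorr' u v).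
Proof.
move=> iu iv; have := integrableB measurableT (integrable_prodM iv iu) (integrable_prodM iu iv).
exact: eq_integrable.
Qed.

(** |F(w)|^2 is the double integral of f(x) conj (f(y)) e^(-2 pi i w.(x - y)); its real part has the
    shape that [damped_parseval] expects. *)
Lemma ftsqE u v w : mu.-integrable setT (EFin \o u) -> mu.-integrable setT (EFin \o v) ->
  ftsq u v w = \int[(mu \x mu)%E]_p (acorr u v p * cos (2 * pi * dotp w (tsub p.1 p.2)) +
    acorr' u v p * sin (2 * pi * dotp w (tsub p.1 p.2))).
Proof.
move=> iu iv; have ip := integrable_ftre w iu iv; have iq := integrable_ftim w iu iv.
rewrite /ftsq !expr2 -(integral_prodM ip ip) -(integral_prodM iq iq).
rewrite -(RintegralD measurableT (integrable_prodM ip ip) (integrable_prodM iq iq)).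
apply: eq_Rintegral => -[x y] _ /=; rewrite dotp_tsub (mulrBr (2 * pi)) cosB sinB /acorr /acorr' /=.
ring.
Qed.

Lemma measurable_tsub : measurable_fun setT (fun p : d.-tuple R * d.-tuple R => tsub p.1 p.2).
Proof.
apply/measurable_fun_tnthP => i.
rewrite (_ : _ \o _ = fun p : d.-tuple R * d.-tuple R => tnth p.1 i - tnth p.2 i); last first.
  by apply/funext => p /=; rewrite tnth_mktuple.
have mt := @measurable_tnth_real R d i.
by apply: measurable_funB; apply: (measurableT_comp mt).
Qed.

Definition heat (c : R) (p : d.-tuple R * d.-tuple R) : R :=
  c ^+ d * fker (tscale c (tsub p.1 p.2)).

Lemma heat_ge0 c p : 0 <= c -> 0 <= heat c p.
Proof. by move=> c0; rewrite mulr_ge0 ?exprn_ge0// fker_ge0. Qed.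

Lemma measurable_heat c : measurable_fun setT (heat c).
Proof.
apply: measurable_funM => //; apply: measurableT_comp; first exact: measurable_fker.
by apply: measurableT_comp; [exact: measurable_tscale|exact: measurable_tsub].
Qed.

Lemma heat_bounded c p : 0 <= c -> heat c p <= c ^+ d * Num.sqrt pi ^+ d.
Proof.
move=> c0; rewrite ler_wpM2l ?exprn_ge0// ler_piMr ?exprn_ge0// ?sqrtr_ge0//.
by rewrite -expR0 ler_expR oppr_le0 mulr_ge0 ?sqr_ge0// dotp_ge0.
Qed.

Lemma measurable_shift_step n :
  measurable_fun setT (fun p : d.-tuple R * d.-tuple R => tshift (tstep p.2 n) p.1).
Proof.
apply/measurable_fun_tnthP => i.
rewrite (_ : _ \o _ = fun p : d.-tuple R * d.-tuple R => tnth p.1 i + n.+1%:R^-1 * tnth p.2 i).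
  have mt := @measurable_tnth_real R d i.
  apply: measurable_funD; first exact: (measurableT_comp mt).
  by apply: measurable_funM => //; exact: (measurableT_comp mt).
by apply/funext => p /=; rewrite tnth_taff mul1r tnth_tscale.
Qed.

(** Substituting y = x + z / (n + 1) turns the kernel into the weight [fker z], which has mass 1 and
    no longer depends on [n]; only the shift does. *)
Lemma integral_heat n (F : d.-tuple R * d.-tuple R -> R) :
  measurable_fun setT F -> (forall p, 0 <= F p) ->
  (\int[mu \x mu]_p (F p * heat n.+1%:R p)%:E =
   \int[mu]_z ((fker z)%:E * \int[mu]_x (F (x, tshift (tstep z n) x))%:E))%E.
Proof.
move=> mF F0; set c : R := n.+1%:R; have c0 : 0 < c by rewrite ltr0n.
have ci0 : 0 < c^-1 by rewrite invr_gt0.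
have mG : measurable_fun setT (fun p => (F p * heat c p)%:E).
  by apply/measurable_EFinP; apply: measurable_funM => //; exact: measurable_heat.
have G0 p : (0 <= (F p * heat c p)%:E)%E by rewrite lee_fin mulr_ge0// heat_ge0// ltW.
rewrite fubini_tonelli1//.
pose H (p : d.-tuple R * d.-tuple R) := (F (p.1, tshift (tstep p.2 n) p.1) * fker p.2)%:E.
have mH0 : measurable_fun setT (fun p : d.-tuple R * d.-tuple R => F (p.1, tshift (tstep p.2 n) p.1)).
  apply: (measurableT_comp mF); apply/measurable_fun_pairP; split.
    exact: measurable_fst.
  exact: measurable_shift_step.
have mH : measurable_fun setT H.
  apply/measurable_EFinP; apply: measurable_funM => //.
  by apply: (measurableT_comp measurable_fker).
have H0 p : (0 <= H p)%E by rewrite lee_fin mulr_ge0// fker_ge0.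
transitivity (\int[mu]_x \int[mu]_z H (x, z))%E.
  apply: eq_integral => x _; rewrite /fubini_F.
  rewrite (integral_affine x lmu ci0)//; last first.
    by apply: (measurableT_comp mG); exact: pair1_measurable.
  rewrite -ge0_integralZl//; last 2 first.
    by apply: (measurableT_comp (measurableT_comp mG (pair1_measurable x))); exact: measurable_taff.
    by rewrite lee_fin exprn_ge0// ltW.
  apply: eq_integral => z _; rewrite -EFinM /H /heat /=; congr EFin.
  have -> : taff c^-1 x z = tshift (tstep z n) x.
    apply: eq_from_tnth => i; by rewrite tnth_taff [RHS]tnth_taff mul1r tnth_tscale addrC.
  have -> : fker (tscale c (tsub x (tshift (tstep z n) x))) = fker z.
    rewrite /fker; congr (_ * expR (- (_ * _))).
    apply: eq_bigr => i _; rewrite !tnth_tscale tnth_mktuple tnth_taff mul1r tnth_tscale.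
    by rewrite -/c; field; rewrite gt_eqF.
  rewrite mulrCA [X in _ * X](_ : _ = fker z)//.
  by rewrite mulrA -exprMn mulVf ?expr1n ?mul1r// gt_eqF.
rewrite fubini_tonelli//; apply: eq_integral => z _.
rewrite -ge0_integralZl//.
- by apply: eq_integral => x _; rewrite /H /= EFinM muleC.
- by apply/measurable_EFinP; exact: (measurableT_comp mH0 (pair2_measurable z)).
- by move=> x _; rewrite lee_fin.
- by rewrite lee_fin fker_ge0.
Qed.

Definition sqint2 u v := (sqint mu u + sqint mu v)%E.

Lemma sqint2E u v : measurable_fun setT u -> measurable_fun setT v ->
  sqint2 u v = (\int[mu]_x (u x ^+ 2 + v x ^+ 2)%:E)%E.
Proof.
move=> mu_ mv; rewrite /sqint2 /sqint -ge0_integralD//.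
- by move=> x _; rewrite lee_fin sqr_ge0.
- exact: measurable_sq.
- by move=> x _; rewrite lee_fin sqr_ge0.
- exact: measurable_sq.
Qed.

Lemma integral_fkerZ (A : \bar R) : (0 <= A)%E ->
  (\int[mu]_z ((fker z)%:E * A) = A)%E.
Proof.
move=> A0; rewrite ge0_integralZr//.
- by rewrite (integral_fker lmu) mul1e.
- by apply/measurable_EFinP; exact: measurable_fker.
- by move=> x _; rewrite lee_fin fker_ge0.
Qed.

Definition heat_defect u v n : \bar R :=
  (\int[mu]_z ((fker z)%:E * sqint2 (tdiff (tstep z n) u) (tdiff (tstep z n) v)))%E.

Lemma sigma_finite_prod : sigma_finite setT (mu \x mu)%E.
Proof.
exists (fun k => cube k `*` cube k).
  apply/seteqP; split => // -[x y] _ /=.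
  have [j jx] := in_cube x; have [k ky] := in_cube y; exists (maxn j k) => //=.
  split; apply/cubeP => i.
    by have /cubeP/(_ i)/le_trans := jx; apply; rewrite ler_nat leq_maxl.
  by have /cubeP/(_ i)/le_trans := ky; apply; rewrite ler_nat leq_maxr.
move=> k; split; first by apply: measurableX; exact: measurable_box.
have mc : measurable (cube k : set (d.-tuple R)) by exact: measurable_box.
rewrite product_measure1E// lte_mul_pinfty//.
  by rewrite ge0_fin_numE//; exact: lebesgue_cube_fin.
exact: lebesgue_cube_fin.
Qed.

(* From [2 Re (f(x) conj (f(y))) = |f(x)|^2 + |f(y)|^2 - |f(x) - f(y)|^2], integrated
   against the heat kernel in [x - y]; this keeps all limits monotone or dominated. *)
Lemma damped_plancherel u v n :
  mu.-integrable setT (EFin \o u) -> mu.-integrable setT (EFin \o v) ->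
  (sqint2 u v < +oo)%E ->
  (2%:E * \int[mu]_w (damp n.+1%:R w * ftsq u v w)%:E + heat_defect u v n =
   2%:E * sqint2 u v)%E.
Proof.
move=> iu iv uvoo; set c : R := n.+1%:R; have c0 : 0 < c by rewrite ltr0n.
have mu_ : measurable_fun setT u by apply/measurable_EFinP; exact: measurable_int iu.
have mv : measurable_fun setT v by apply/measurable_EFinP; exact: measurable_int iv.
have m1 (f : d.-tuple R -> R) : measurable_fun setT f ->
    measurable_fun setT (fun p : d.-tuple R * d.-tuple R => f p.1).
  by move=> mf; exact: (measurableT_comp mf).
have m2 (f : d.-tuple R -> R) : measurable_fun setT f ->
    measurable_fun setT (fun p : d.-tuple R * d.-tuple R => f p.2).
  by move=> mf; exact: (measurableT_comp mf).
pose N1 (p : d.-tuple R * d.-tuple R) := u p.1 ^+ 2 + v p.1 ^+ 2.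
pose N2 (p : d.-tuple R * d.-tuple R) := u p.2 ^+ 2 + v p.2 ^+ 2.
pose D (p : d.-tuple R * d.-tuple R) := (u p.2 - u p.1) ^+ 2 + (v p.2 - v p.1) ^+ 2.
have mN1 : measurable_fun setT N1.
  by apply: measurable_funD; apply: measurable_funX; exact: m1.
have mN2 : measurable_fun setT N2.
  by apply: measurable_funD; apply: measurable_funX; exact: m2.
have mD : measurable_fun setT D.
  by apply: measurable_funD; apply: measurable_funX; apply: measurable_funB; (exact: m1 || exact: m2).
have N10 p : 0 <= N1 p by rewrite addr_ge0 ?sqr_ge0.
have N20 p : 0 <= N2 p by rewrite addr_ge0 ?sqr_ge0.
have D0 p : 0 <= D p by rewrite addr_ge0 ?sqr_ge0.
have uv0 : (0 <= sqint2 u v)%E by rewrite adde_ge0// sqint_ge0.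
have I1 : (\int[mu \x mu]_p (N1 p * heat c p)%:E = sqint2 u v)%E.
  rewrite integral_heat//; rewrite -[RHS]integral_fkerZ//.
  by apply: eq_integral => z _; rewrite sqint2E.
have I2 : (\int[mu \x mu]_p (N2 p * heat c p)%:E = sqint2 u v)%E.
  rewrite integral_heat//; rewrite -[RHS]integral_fkerZ//.
  apply: eq_integral => z _; congr (_ * _)%E.
  rewrite sqint2E// /N2 /=.
  rewrite (integral_shift lmu (tstep z n) (f := fun x => (u x ^+ 2 + v x ^+ 2)%:E))//.
    by apply/measurable_EFinP; apply: measurable_funD; exact: measurable_funX.
  by move=> x; rewrite lee_fin addr_ge0 ?sqr_ge0.
have ID : (\int[mu \x mu]_p (D p * heat c p)%:E = heat_defect u v n)%E.
  rewrite integral_heat//; apply: eq_integral => z _; congr (_ * _)%E.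
  by rewrite sqint2E//; exact: measurable_tdiff.
have iac := integrable_acorr iu iv.
have iac' := integrable_acorr' iu iv.
have mh := measurable_heat c.
have hh p : 0 <= heat c p by exact: heat_ge0 (ltW c0).
have mac : measurable_fun setT (acorr u v).
  by apply/measurable_EFinP; exact: measurable_int iac.
have iach : (mu \x mu)%E.-integrable setT (EFin \o (fun p => acorr u v p * heat c p)).
  apply: le_integrable (integrableZl measurableT (c ^+ d * Num.sqrt pi ^+ d) iac) => //.
    by apply/measurable_EFinP; exact: measurable_funM.
  move=> p _ /=; rewrite lee_fin normrM [leRHS]normrM mulrC ler_wpM2r//.
  rewrite (ger0_norm (heat_ge0 _ (ltW c0))).
  by apply: le_trans (heat_bounded _ (ltW c0)) (ler_norm _).
have dp := damped_parseval (m := sigma_finite_pack sigma_finite_prod) lmu c0 measurable_tsub iac iac'.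
have -> : (\int[mu]_w (damp c w * ftsq u v w)%:E =
    \int[mu \x mu]_p (acorr u v p * heat c p)%:E)%E.
  by rewrite -[RHS]dp; apply: eq_integral => w _; rewrite ftsqE.
have sumN : (\int[mu \x mu]_p ((N1 p + N2 p) * heat c p)%:E = 2%:E * sqint2 u v)%E.
  rewrite (_ : 2%:E = 1%:E + 1%:E :> \bar R)%E; last by rewrite -EFinD.
  rewrite ge0_muleDl// mul1e -{1}I1 -I2 -ge0_integralD//.
  - by apply: eq_integral => p _; rewrite -EFinD mulrDl.
  - by move=> p _; rewrite lee_fin mulr_ge0// heat_ge0// ltW.
  - by apply/measurable_EFinP; exact: measurable_funM.
  - by move=> p _; rewrite lee_fin mulr_ge0// heat_ge0// ltW.
  - by apply/measurable_EFinP; exact: measurable_funM.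
have iDh : (mu \x mu)%E.-integrable setT (EFin \o (fun p => D p * heat c p)).
  apply/integrableP; split; first by apply/measurable_EFinP; exact: measurable_funM.
  apply: (@le_lt_trans _ _ (\int[mu \x mu]_p (2 * ((N1 p + N2 p) * heat c p))%:E)%E).
    apply: ge0_le_integral => //.
    - by apply/measurable_EFinP; apply: measurableT_comp => //; exact: measurable_funM.
    - apply/measurable_EFinP; apply: measurable_funM => //; apply: measurable_funM => //.
      exact: measurable_funD.
    - move=> p _ /=; rewrite lee_fin ger0_norm; last by apply: mulr_ge0.
      rewrite mulrA; apply: ler_wpM2r => //; rewrite -subr_ge0.
      rewrite (_ : _ - _ = (u p.2 + u p.1) ^+ 2 + (v p.2 + v p.1) ^+ 2).
        by rewrite addr_ge0 ?sqr_ge0.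
      by rewrite /N1 /N2 /D; ring.
  under eq_integral do rewrite EFinM.
  rewrite ge0_integralZl//; last 2 first.
  - apply/measurable_EFinP; apply: measurable_funM => //; exact: measurable_funD.
  - by move=> p _; rewrite lee_fin; apply: mulr_ge0 => //; exact: addr_ge0.
  rewrite sumN !lte_mul_pinfty ?mule_ge0//.
rewrite -sumN -ID -integralZl// -integralD//; last exact: integrableZl.
apply: eq_integral => p _; rewrite -EFinM -EFinD /D /N1 /N2 /acorr; congr EFin; ring.
Qed.

Lemma measurable_sqint2_step u v n : measurable_fun setT u -> measurable_fun setT v ->
  measurable_fun setT (fun z => sqint2 (tdiff (tstep z n) u) (tdiff (tstep z n) v)).
Proof.
move=> mu_ mv.
have h f : measurable_fun setT f -> measurable_fun setT (fun z => sqint mu (tdiff (tstep z n) f)).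
  move=> mf; apply: (measurable_fun_fubini_tonelli_G (m1 := mu)
    (fun p : d.-tuple R * d.-tuple R => ((tdiff (tstep p.2 n) f p.1) ^+ 2)%:E)) => //.
    apply/measurable_EFinP; apply: measurable_funX; apply: measurable_funB.
      exact: (measurableT_comp mf (measurable_shift_step n)).
    exact: (measurableT_comp mf).
  by move=> p; rewrite lee_fin sqr_ge0.
by apply: emeasurable_funD; exact: h.
Qed.

(** Dominated convergence in [z]: [transl_cont_L2] gives the pointwise limit, and [fker z] times
    [4 * sqint2 u v] dominates. *)
Lemma heat_defect_vanishes u v : measurable_fun setT u -> measurable_fun setT v ->
  (sqint2 u v < +oo)%E -> heat_defect u v @ \oo --> 0%E.
Proof.
move=> mu_ mv uvoo.
have [u0 v0] : (0 <= sqint mu u)%E /\ (0 <= sqint mu v)%E by split; exact: sqint_ge0.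
have uoo : (sqint mu u < +oo)%E by apply: le_lt_trans uvoo; rewrite leeDl.
have voo : (sqint mu v < +oo)%E by apply: le_lt_trans uvoo; rewrite leeDr.
have uv0 : (0 <= sqint2 u v)%E by rewrite adde_ge0.
have [_ cu] := transl_cont_L2 lmu mu_ uoo.
have [_ cv] := transl_cont_L2 lmu mv voo.
have t0 n z : (0 <= sqint2 (tdiff (tstep z n) u) (tdiff (tstep z n) v))%E.
  by rewrite adde_ge0// sqint_ge0.
have k0 z : (0 <= (fker z)%:E :> \bar R)%E by rewrite lee_fin fker_ge0.
have mk : measurable_fun setT (fun z : d.-tuple R => (fker z)%:E).
  by apply/measurable_EFinP; exact: measurable_fker.
have [] := @dominated_convergence _ _ _ mu setT measurableT
  (fun n z => (fker z)%:E * sqint2 (tdiff (tstep z n) u) (tdiff (tstep z n) v))%E (cst 0%E)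
  (fun z => (fker z)%:E * (4%:E * sqint2 u v))%E.
- by move=> n; apply: emeasurable_funM => //; exact: measurable_sqint2_step.
- exact: measurable_cst.
- apply: aeW => z _; apply/vanishes_cvg; first by move=> n; rewrite mule_ge0.
  by apply: vanishesZ; [exact: fker_ge0|apply: vanishesD; [exact: cu|exact: cv]].
- apply/integrableP; split; first by apply: emeasurable_funM.
  under eq_integral do rewrite gee0_abs ?mule_ge0//.
  rewrite integral_fkerZ ?mule_ge0// lte_mul_pinfty//.
- apply: aeW => z n _; rewrite gee0_abs ?mule_ge0// lee_wpmul2l//.
  by rewrite ge0_muleDr//; apply: leeD; exact: sqint_tdiff_le.
by rewrite integral0.
Qed.

Lemma damp_nondecreasing w : {homo (fun n : nat => damp n.+1%:R w) : m n / (m <= n)%N >-> m <= n}.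
Proof.
move=> m n mn; rewrite /damp ler_expR lerN2 !dotp_tscalel !dotp_tscaler !mulrA.
rewrite ler_wpM2r ?dotp_ge0// ler_pM ?invr_ge0// ler_pV2 ?inE ?unitfE ?pnatr_eq0//.
- by rewrite ler_nat.
- by rewrite ltr0n.
- by rewrite ltr0n.
- by rewrite ler_nat.
- by rewrite ltr0n.
- by rewrite ltr0n.
Qed.

Lemma damp_cvg w : (fun n : nat => damp n.+1%:R w) @ \oo --> (1 : R).
Proof.
have inv : (fun n : nat => n.+1%:R^-1) @ \oo --> (0 : R) by exact: cvg_harmonic.
have h : (fun n : nat => - (n.+1%:R^-1 * n.+1%:R^-1 * dotp w w)) @ \oo --> (- (0 * 0 * dotp w w) : R).
  by apply: cvgN; apply: cvgMr_tmp; exact: cvgM.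
rewrite mulr0 mul0r oppr0 in h.
rewrite -[X in _ --> X](@expR0 R) (_ : (fun n => _) =
  (fun n : nat => expR (- (n.+1%:R^-1 * n.+1%:R^-1 * dotp w w)))).
  by apply: continuous_cvg; [exact: continuous_expR|exact: h].
apply/funext => n; rewrite /damp /gaussn dotp_tscalel dotp_tscaler.
by rewrite !mulrA.
Qed.

(** [F] is not assumed integrable: the positive and negative parts are handled separately by
    Tonelli. *)
Lemma measurable_param (F : d.-tuple R * d.-tuple R -> R) : measurable_fun setT F ->
  measurable_fun setT (fun w => \int[mu]_x F (x, w)).
Proof.
move=> mF; have mE : measurable_fun setT (EFin \o F) by exact/measurable_EFinP.
rewrite /Rintegral; apply: (measurableT_comp (f := fine)) => //.
rewrite [X in measurable_fun _ X](_ : _ = (fun w => \int[mu]_x (EFin \o F)^\+ (x, w) -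
   \int[mu]_x (EFin \o F)^\- (x, w))%E).
  apply: emeasurable_funB.
    by apply: (measurable_fun_fubini_tonelli_G (m1 := mu) (EFin \o F)^\+%E) => //;
      exact: measurable_funepos.
  by apply: (measurable_fun_fubini_tonelli_G (m1 := mu) (EFin \o F)^\-%E) => //;
      exact: measurable_funeneg.
apply/funext => w; rewrite integralE.
rewrite -[fun x => (F (x, w))%:E]/((EFin \o F) \o (fun x => (x, w))).
by rewrite (funepos_comp (EFin \o F)) (funeneg_comp (EFin \o F)).
Qed.

Lemma measurable_phase2 : measurable_fun setT
  (fun p : d.-tuple R * d.-tuple R => 2 * pi * dotp p.1 p.2).
Proof. by apply: measurable_funM => //; apply: measurable_dotp. Qed.

Lemma measurable_ftre u v : measurable_fun setT u -> measurable_fun setT v ->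
  measurable_fun setT (ftre u v).
Proof.
move=> mu_ mv; apply: (measurable_param (F := fun p =>
  u p.1 * cos (2 * pi * dotp p.1 p.2) + v p.1 * sin (2 * pi * dotp p.1 p.2))).
by apply: measurable_funD; apply: measurable_funM;
  [exact: measurableT_comp|apply: measurable_cos_comp; exact: measurable_phase2
  |exact: measurableT_comp|apply: measurable_sin_comp; exact: measurable_phase2].
Qed.

Lemma measurable_ftim u v : measurable_fun setT u -> measurable_fun setT v ->
  measurable_fun setT (ftim u v).
Proof.
move=> mu_ mv; apply: (measurable_param (F := fun p =>
  v p.1 * cos (2 * pi * dotp p.1 p.2) - u p.1 * sin (2 * pi * dotp p.1 p.2))).
by apply: measurable_funB; apply: measurable_funM;
  [exact: measurableT_comp|apply: measurable_cos_comp; exact: measurable_phase2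
  |exact: measurableT_comp|apply: measurable_sin_comp; exact: measurable_phase2].
Qed.

Lemma measurable_ftsq u v : measurable_fun setT u -> measurable_fun setT v ->
  measurable_fun setT (ftsq u v).
Proof.
move=> mu_ mv; apply: measurable_funD; apply: measurable_funX.
  exact: measurable_ftre.
exact: measurable_ftim.
Qed.

Lemma ftsq_ge0 u v w : 0 <= ftsq u v w.
Proof. by rewrite addr_ge0 ?sqr_ge0. Qed.

(** Let [n] grow in [damped_plancherel]. The damped integrals converge monotonically, before their
    limit is known to be finite, and the defect vanishes. *)
Theorem plancherel u v :
  mu.-integrable setT (EFin \o u) -> mu.-integrable setT (EFin \o v) ->
  (sqint2 u v < +oo)%E ->
  (\int[mu]_w (ftsq u v w)%:E = sqint2 u v)%E.
Proof.
move=> iu iv uvoo.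
have mu_ : measurable_fun setT u by apply/measurable_EFinP; exact: measurable_int iu.
have mv : measurable_fun setT v by apply/measurable_EFinP; exact: measurable_int iv.
have mft := measurable_ftsq mu_ mv.
have c1 : (fun n : nat => \int[mu]_w (damp n.+1%:R w * ftsq u v w)%:E)%E @ \oo -->
    (\int[mu]_w (ftsq u v w)%:E)%E.
  rewrite (_ : (\int[mu]_w (ftsq u v w)%:E)%E = (\int[mu]_w
      (limn (fun n : nat => (damp n.+1%:R w * ftsq u v w)%:E)))%E).
    apply: cvg_monotone_convergence => //.
    - move=> n; apply/measurable_EFinP; apply: measurable_funM => //.
      exact: measurable_damp.
    - by move=> n w _; rewrite lee_fin mulr_ge0 ?damp_ge0 ?ftsq_ge0.
    - move=> w _ m n mn; rewrite lee_fin ler_wpM2r ?ftsq_ge0//.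
      exact: damp_nondecreasing.
  apply: eq_integral => w _; apply/esym/cvg_lim => //.
  apply: cvg_EFin; first exact: nearW.
  rewrite -[X in _ --> X]mul1r; apply: cvgMr_tmp; exact: damp_cvg.
have c2 := heat_defect_vanishes mu_ mv uvoo.
have c3 : (fun n : nat => 2%:E * \int[mu]_w (damp n.+1%:R w * ftsq u v w)%:E +
    heat_defect u v n)%E @ \oo --> (2%:E * \int[mu]_w (ftsq u v w)%:E + 0)%E.
  apply: cvgeD => //; first by rewrite fin_num_adde_defl.
  by apply: cvgeZl.
have c4 : (fun n : nat => 2%:E * \int[mu]_w (damp n.+1%:R w * ftsq u v w)%:E +
    heat_defect u v n)%E @ \oo --> (2%:E * sqint2 u v)%E.
  rewrite (_ : (fun n => _) = cst (2%:E * sqint2 u v)%E); first exact: cvg_cst.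
  by apply/funext => n; rewrite damped_plancherel.
have := cvg_unique _ c3 c4; rewrite adde0 => /(_ (@ereal_hausdorff _)) E.
have : (2^-1%:E * (2%:E * \int[mu]_w (ftsq u v w)%:E) = 2^-1%:E * (2%:E * sqint2 u v))%E.
  by rewrite E.
by rewrite !muleA -EFinM mulVf// !mul1e.
Qed.

End plancherel.

(** * The L^2 Fourier transform *)

Section fourier_L2.
Context {R : realType} {d : nat}.
Variable mu : {sigma_finite_measure set (d.-tuple R) -> \bar R}.
Hypothesis lmu : is_lebesgue_measure mu.
Implicit Types (u v : d.-tuple R -> R) (x y z w h : d.-tuple R).

Definition eball (N : nat) : set (d.-tuple R) := [set x | enorm x <= N%:R].

Lemma measurable_enorm : measurable_fun setT (@enorm R d).
Proof.
rewrite (_ : @enorm R d = Num.sqrt \o (fun x => dotp x x))//.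
apply: measurableT_comp; last exact: measurable_dotp.
by apply: continuous_measurable_fun; exact: sqrt_continuous.
Qed.

Lemma measurable_eball N : measurable (eball N).
Proof.
rewrite (_ : eball N = @enorm R d @^-1` `]-oo, N%:R]%classic).
  by rewrite -[X in measurable X]setTI; apply: measurable_enorm.
by apply/seteqP; split => x; rewrite /= in_itv.
Qed.

Lemma tnth_le_enorm x i : `|tnth x i| <= enorm x.
Proof.
rewrite -sqrtr_sqr ler_sqrt ?dotp_ge0// /dotp (bigD1 i)//= -expr2 lerDl.
by apply: sumr_ge0 => j _; exact: sqr_ge0.
Qed.

Lemma eball_fin N : (mu (eball N) < +oo)%E.
Proof.
apply: le_lt_trans (lebesgue_cube_fin N lmu); apply: le_measure.
- by rewrite inE; exact: measurable_eball.
- by rewrite inE; exact: measurable_box.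
- by move=> x xN; apply/cubeP => i; exact: le_trans (tnth_le_enorm x i) xN.
Qed.

Lemma measurable_patch_eball u N : measurable_fun setT u ->
  measurable_fun setT (u \_ (eball N)).
Proof.
move=> mu_; apply: (measurable_restrictT _ _).1; first exact: measurable_eball.
exact: measurable_funTS.
Qed.

Lemma patch_normr_le u N x : `|(u \_ (eball N)) x| <= `|u x|.
Proof. by rewrite patchE; case: ifPn => // _; rewrite normr0. Qed.

(** On a ball, which has finite measure, [|u| <= 1 + u ^+ 2] bounds the truncation by an integrable
    function. Thus the truncated Fourier integrals of an L^2 function are genuine ones. *)
Lemma integrable_patch_eball u N : measurable_fun setT u -> (sqint mu u < +oo)%E ->
  mu.-integrable setT (EFin \o (u \_ (eball N))).
Proof.
move=> mu_ uoo.
have iB := integrable_indic_fin (measurable_eball N) (eball_fin N).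
have iu : mu.-integrable setT (fun x => (u x ^+ 2)%:E).
  apply/integrableP; split; first exact: measurable_sq.
  by under eq_integral do rewrite gee0_abs ?lee_fin ?sqr_ge0//.
apply: le_integrable (integrableD measurableT iB iu) => //.
  by apply/measurable_EFinP; exact: measurable_patch_eball.
move=> x _ /=; rewrite lee_fin patchE indicE; case: ifPn => xB; last by rewrite normr0.
rewrite /= [leRHS]ger0_norm ?addr_ge0 ?sqr_ge0//.
rewrite -real_normK ?num_real// -subr_ge0.
rewrite (_ : _ - _ = (`|u x| - 2^-1) ^+ 2 + 3 / 4); last by field.
by rewrite addr_ge0 ?sqr_ge0// divr_ge0.
Qed.

Lemma sqint_patch_le u N : measurable_fun setT u ->
  (sqint mu (u \_ (eball N)) <= sqint mu u)%E.
Proof.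
move=> mu_; apply: ge0_le_integral => //.
- by move=> x _; rewrite lee_fin sqr_ge0.
- by apply: measurable_sq; exact: measurable_patch_eball.
- exact: measurable_sq.
- by move=> x _; rewrite lee_fin patchE; case: ifPn => // _; rewrite expr0n sqr_ge0.
Qed.

Lemma patch_eball_cvg u x : (fun N => (u \_ (eball N)) x) @ \oo --> u x.
Proof.
apply: cvg_near_cst; near=> N; rewrite patchE ifT// inE /eball/=.
by near: N; exact: nbhs_infty_ger.
Unshelve. all: by end_near. Qed.

Lemma sqint_patch_cvg u : measurable_fun setT u ->
  (sqint mu u < +oo)%E -> (fun N => sqint mu (u \_ (eball N))) @ \oo --> sqint mu u.
Proof.
move=> mu_ uoo.
have [] := @dominated_convergence _ _ _ mu setT measurableT
  (fun N x => ((u \_ (eball N)) x ^+ 2)%:E) (fun x => (u x ^+ 2)%:E) (fun x => (u x ^+ 2)%:E).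
- by move=> N; apply: measurable_sq; exact: measurable_patch_eball.
- exact: measurable_sq.
- apply: aeW => x _; apply: cvg_EFin; first exact: nearW.
  exact: (cvgM (@patch_eball_cvg u x) (@patch_eball_cvg u x)).
- apply/integrableP; split; first exact: measurable_sq.
  by under eq_integral do rewrite gee0_abs ?lee_fin ?sqr_ge0//.
- apply: aeW => x N _; rewrite gee0_abs ?lee_fin ?sqr_ge0//.
  by rewrite patchE; case: ifPn => // _; rewrite expr0n sqr_ge0.
by [].
Qed.

Lemma Rintegral_dominated_cvg (F : nat -> d.-tuple R -> R) (f g : d.-tuple R -> R) :
  (forall n, measurable_fun setT (F n)) -> measurable_fun setT f ->
  (forall x, F ^~ x @ \oo --> f x) -> mu.-integrable setT (EFin \o g) ->
  (forall n x, `|F n x| <= g x) ->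
  (fun n => \int[mu]_x F n x) @ \oo --> \int[mu]_x f x.
Proof.
move=> mF mf Ff ig Fg.
have [] := @dominated_convergence _ _ _ mu setT measurableT
  (fun N => EFin \o F N) (EFin \o f) (EFin \o g).
- by move=> n; exact/measurable_EFinP.
- exact/measurable_EFinP.
- by apply: aeW => x _; apply: cvg_EFin; [exact: nearW|exact: Ff].
- exact: ig.
- by apply: aeW => x n _; rewrite lee_fin.
move=> fi _ c; apply: fine_cvg; rewrite fineK; first exact: c.
exact: (integrable_fin_num measurableT fi).
Qed.

Lemma ftre_patch_cvg u v w : mu.-integrable setT (EFin \o u) ->
  mu.-integrable setT (EFin \o v) ->
  (fun N => ftre mu (u \_ (eball N)) (v \_ (eball N)) w) @ \oo --> ftre mu u v w.
Proof.
move=> iu iv.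
have mu_ : measurable_fun setT u by apply/measurable_EFinP; exact: measurable_int iu.
have mv : measurable_fun setT v by apply/measurable_EFinP; exact: measurable_int iv.
have mc : measurable_fun setT (fun x => cos (2 * pi * dotp x w)).
  by apply: measurable_cos_comp; exact: measurable_phase.
have ms : measurable_fun setT (fun x => sin (2 * pi * dotp x w)).
  by apply: measurable_sin_comp; exact: measurable_phase.
apply: (@Rintegral_dominated_cvg _ _ (fun x => `|u x| + `|v x|)).
- by move=> N; apply: measurable_funD; apply: measurable_funM => //; exact: measurable_patch_eball.
- by apply: measurable_funD; exact: measurable_funM.
- by move=> x; apply: cvgD; apply: cvgMr_tmp; exact: patch_eball_cvg.
- exact: (integrableD measurableT (integrable_norm iu) (integrable_norm iv)).
- move=> N x; apply: le_trans (ler_normD _ _) _; rewrite !normrM; apply: lerD.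
    by apply: le_trans (patch_normr_le u N x); rewrite ler_piMr// cos_max.
  by apply: le_trans (patch_normr_le v N x); rewrite ler_piMr// sin_max.
Qed.

(** Im F = Re (- i F), and - i (u + i v) = v - i u; statements about [ftre] thereby transfer to
    [ftim]. *)
Lemma ftim_ftre u v w : ftim mu u v w = ftre mu v (fun x => - u x) w.
Proof. by apply: eq_Rintegral => x _; rewrite mulNr. Qed.

Lemma ftim_patch_cvg u v w : mu.-integrable setT (EFin \o u) ->
  mu.-integrable setT (EFin \o v) ->
  (fun N => ftim mu (u \_ (eball N)) (v \_ (eball N)) w) @ \oo --> ftim mu u v w.
Proof.
move=> iu iv; rewrite ftim_ftre.
have iNu : mu.-integrable setT (EFin \o (fun x => - u x)).
  by have := integrableN iu; apply: eq_integrable.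
rewrite (_ : (fun N => _) = (fun N => ftre mu (v \_ (eball N)) ((fun x => - u x) \_ (eball N)) w)).
  exact: ftre_patch_cvg.
apply/funext => N; rewrite ftim_ftre; apply: eq_Rintegral => x _.
by rewrite !patchE; case: ifPn => // _; rewrite oppr0.
Qed.

Variables (f fhat : d.-tuple R -> R[i]).
Let u x := complex.Re (f x).
Let v x := complex.Im (f x).
Let U x := complex.Re (fhat x).
Let V x := complex.Im (fhat x).

Lemma trunc_fourierE N w : trunc_fourier mu f N w =
  Complex (ftre mu (u \_ (eball N)) (v \_ (eball N)) w)
          (ftim mu (u \_ (eball N)) (v \_ (eball N)) w).
Proof.
rewrite /trunc_fourier -/(eball N); congr Complex.
  rewrite Rintegral_mkcond; apply: eq_Rintegral => x _; rewrite !patchE /u /v.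
  by case: ifPn => // _; rewrite !mul0r addr0.
rewrite Rintegral_mkcond; apply: eq_Rintegral => x _; rewrite !patchE /u /v.
by case: ifPn => // _; rewrite !mul0r subr0.
Qed.

Lemma cmod2B_truncE N w : cmod2 (fhat w - trunc_fourier mu f N w) =
  (U w - ftre mu (u \_ (eball N)) (v \_ (eball N)) w) ^+ 2 +
  (V w - ftim mu (u \_ (eball N)) (v \_ (eball N)) w) ^+ 2.
Proof. by rewrite trunc_fourierE /cmod2 /U /V; case: (fhat w). Qed.

Hypothesis fL2 : in_L2 mu f.
Hypothesis ffhat : is_fourier_L2 mu f fhat.

Let mu_ : measurable_fun setT u. Proof. by case: fL2 => -[]. Qed.
Let mv_ : measurable_fun setT v. Proof. by case: fL2 => -[]. Qed.
Let mU_ : measurable_fun setT U. Proof. by case: ffhat => -[]. Qed.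
Let mV_ : measurable_fun setT V. Proof. by case: ffhat => -[]. Qed.

Lemma sqint2_L2 : (sqint2 mu u v < +oo)%E.
Proof. by rewrite sqint2E//; case: fL2. Qed.

Let uoo : (sqint mu u < +oo)%E.
Proof. by apply: le_lt_trans sqint2_L2; rewrite leeDl// sqint_ge0. Qed.
Let voo : (sqint mu v < +oo)%E.
Proof. by apply: le_lt_trans sqint2_L2; rewrite leeDr// sqint_ge0. Qed.

(** The truncated transforms converge pointwise to F by dominated convergence and in L^2 to [fhat]
    by hypothesis. Fatou's lemma identifies the two limits. *)
Lemma fourier_L2_ae : mu.-integrable setT (EFin \o u) -> mu.-integrable setT (EFin \o v) ->
  {ae mu, forall w, U w = ftre mu u v w /\ V w = ftim mu u v w}.
Proof.
move=> iu iv.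
pose D N w := (U w - ftre mu (u \_ (eball N)) (v \_ (eball N)) w) ^+ 2 +
  (V w - ftim mu (u \_ (eball N)) (v \_ (eball N)) w) ^+ 2.
pose D0 w := (U w - ftre mu u v w) ^+ 2 + (V w - ftim mu u v w) ^+ 2.
have mD N : measurable_fun setT (fun w => (D N w)%:E).
  apply/measurable_EFinP; apply: measurable_funD; apply: measurable_funX;
    apply: measurable_funB => //.
    by apply: measurable_ftre; exact: measurable_patch_eball.
  by apply: measurable_ftim; exact: measurable_patch_eball.
have mD0 : measurable_fun setT (fun w => (D0 w)%:E).
  apply/measurable_EFinP; apply: measurable_funD; apply: measurable_funX;
    apply: measurable_funB => //.
    exact: measurable_ftre.
  exact: measurable_ftim.
have D00 w : 0 <= D0 w by rewrite addr_ge0 ?sqr_ge0.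
have DD0 w : (fun N => (D N w)%:E) @ \oo --> (D0 w)%:E.
  apply: cvg_EFin; first exact: nearW.
  have h1 : (fun N => U w - ftre mu (u \_ (eball N)) (v \_ (eball N)) w) @ \oo -->
      U w - ftre mu u v w by apply: cvgB; [exact: cvg_cst|exact: ftre_patch_cvg].
  have h2 : (fun N => V w - ftim mu (u \_ (eball N)) (v \_ (eball N)) w) @ \oo -->
      V w - ftim mu u v w by apply: cvgB; [exact: cvg_cst|exact: ftim_patch_cvg].
  exact: (cvgD (cvgM h1 h1) (cvgM h2 h2)).
have I0 : (\int[mu]_w (D0 w)%:E = 0)%E.
  apply/eqP; rewrite eq_le; apply/andP; split; last first.
    by apply: integral_ge0 => w _; rewrite lee_fin.
  have F0 N w : setT w -> (0 <= (D N w)%:E)%E by rewrite lee_fin addr_ge0 ?sqr_ge0.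
  have := fatou mu measurableT mD F0.
  rewrite (_ : limn_einf (fun N => \int[mu]_w (D N w)%:E)%E = 0%E); last first.
    have [_ c] := ffhat.
    rewrite (_ : (fun N => \int[mu]_w (D N w)%:E)%E =
      (fun N => \int[mu]_w (cmod2 (fhat w - trunc_fourier mu f N w))%:E)%E).
      by rewrite (cvg_limn_einf_sup c).1.
    by apply/funext => N; apply: eq_integral => w _; rewrite cmod2B_truncE.
  have -> : (\int[mu]_w limn_einf (fun N => (D N w)%:E) = \int[mu]_w (D0 w)%:E)%E.
    by apply: eq_integral => w _; rewrite (cvg_limn_einf_sup (DD0 w)).1.
  exact.
have := (ae_eq_integral_abs mu measurableT mD0).1.
have -> : (\int[mu]_w `|(D0 w)%:E| = 0)%E.
  by rewrite -[RHS]I0; apply: eq_integral => w _; rewrite gee0_abs// lee_fin.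
move=> /(_ erefl); apply: filterS => w /(_ I) /= [] /eqP.
rewrite /D0 paddr_eq0 ?sqr_ge0// !sqrf_eq0 !subr_eq0.
by move=> /andP[/eqP -> /eqP ->].
Qed.

(** Injectivity for f merely in L^2. If [fhat] vanishes, the error at stage [N] is the energy of the
    truncated transform, hence by Plancherel that of the truncation of f; it tends both to 0 and to
    the energy of f. *)
Lemma fourier_L2_eq0 : {ae mu, forall w, U w = 0 /\ V w = 0} -> sqint2 mu u v = 0%E.
Proof.
move=> UV0; have [_ c] := ffhat.
have E N : (\int[mu]_w (cmod2 (fhat w - trunc_fourier mu f N w))%:E =
    sqint2 mu (u \_ (eball N)) (v \_ (eball N)))%E.
  have iu := integrable_patch_eball N mu_ uoo.
  have iv := integrable_patch_eball N mv_ voo.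
  have mu1 := measurable_patch_eball N mu_; have mv1 := measurable_patch_eball N mv_.
  have lt : (sqint2 mu (u \_ (eball N)) (v \_ (eball N)) < +oo)%E.
    apply: le_lt_trans sqint2_L2; apply: leeD; exact: sqint_patch_le.
  rewrite -(plancherel lmu iu iv lt); apply: ge0_ae_eq_integral => //.
  - apply/measurable_EFinP; under eq_fun do rewrite cmod2B_truncE.
    apply: measurable_funD; apply: measurable_funX; apply: measurable_funB => //.
      exact: measurable_ftre.
    exact: measurable_ftim.
  - by apply/measurable_EFinP; exact: measurable_ftsq.
  - by move=> w _; rewrite lee_fin cmod2B_truncE addr_ge0 ?sqr_ge0.
  - by move=> w _; rewrite lee_fin ftsq_ge0.
  - apply: filterS UV0 => w [U0 V0] _.
    by rewrite cmod2B_truncE U0 V0 !sub0r !sqrrN.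
have c' : (fun N => sqint2 mu (u \_ (eball N)) (v \_ (eball N))) @ \oo --> 0%E.
  rewrite (_ : (fun N => _) =
    (fun N => \int[mu]_w (cmod2 (fhat w - trunc_fourier mu f N w))%:E)%E) //.
  by apply/funext => N; rewrite E.
have c2 : (fun N => sqint2 mu (u \_ (eball N)) (v \_ (eball N))) @ \oo --> sqint2 mu u v.
  apply: cvgeD; last 2 first.
  - exact: sqint_patch_cvg.
  - exact: sqint_patch_cvg.
  - by rewrite ge0_adde_def// inE sqint_ge0.
exact: (cvg_unique (@ereal_hausdorff _) c2 c').
Qed.

End fourier_L2.

(** * The strict energy bound *)

Section strict_hausdorff_young.
Context {R : realType} {d : nat}.
Variable mu : {sigma_finite_measure set (d.-tuple R) -> \bar R}.
Hypothesis lmu : is_lebesgue_measure mu.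
Implicit Types (x y z w h : d.-tuple R).
Variables u v : d.-tuple R -> R.
Hypothesis iu : mu.-integrable setT (EFin \o u).
Hypothesis iv : mu.-integrable setT (EFin \o v).

Let mu_ : measurable_fun setT u.
Proof. by apply/measurable_EFinP; exact: measurable_int iu. Qed.
Let mv_ : measurable_fun setT v.
Proof. by apply/measurable_EFinP; exact: measurable_int iv. Qed.

Definition modulus (a b : R) : R := Num.sqrt (a ^+ 2 + b ^+ 2).

Lemma modulus_sq a b : modulus a b ^+ 2 = a ^+ 2 + b ^+ 2.
Proof. by rewrite sqr_sqrtr// addr_ge0 ?sqr_ge0. Qed.

Lemma modulus_ge0 a b : 0 <= modulus a b.
Proof. exact: sqrtr_ge0. Qed.

Lemma measurable_modulus dT (T : measurableType dT) (a b : T -> R) :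
  measurable_fun setT a -> measurable_fun setT b ->
  measurable_fun setT (fun x : T => modulus (a x) (b x)).
Proof.
move=> ma mb; rewrite (_ : (fun x : T => modulus (a x) (b x)) = Num.sqrt \o (fun x : T => a x ^+ 2 + b x ^+ 2))//.
apply: measurableT_comp; first by apply: continuous_measurable_fun; exact: sqrt_continuous.
by apply: measurable_funD; exact: measurable_funX.
Qed.

Lemma modulus_le_add a b : modulus a b <= `|a| + `|b|.
Proof.
rewrite -(@ler_pXn2r _ 2)// ?nnegrE ?modulus_ge0 ?addr_ge0// modulus_sq sqrrD.
by rewrite !real_normK ?num_real// -addrA lerD2l lerDr mulrn_wge0// mulr_ge0.
Qed.

Let r x := modulus (u x) (v x).
Let M := \int[mu]_x r x.
Let C w := ftre mu u v w.
Let S w := ftim mu u v w.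
Let m w := modulus (C w) (S w).

Lemma integrable_modulus : mu.-integrable setT (EFin \o r).
Proof.
apply: le_integrable (integrableD measurableT (integrable_norm iu) (integrable_norm iv)) => //.
  by apply/measurable_EFinP; exact: measurable_modulus.
move=> x _ /=; rewrite lee_fin ger0_norm ?modulus_ge0// ger0_norm ?addr_ge0//.
exact: modulus_le_add.
Qed.

Let th w x := 2 * pi * dotp x w.
Let P w x := u x * cos (th w x) + v x * sin (th w x).
Let Q w x := v x * cos (th w x) - u x * sin (th w x).

Let iP w : mu.-integrable setT (EFin \o P w). Proof. exact: integrable_ftre. Qed.
Let iQ w : mu.-integrable setT (EFin \o Q w). Proof. exact: integrable_ftim. Qed.

Let PQr w x : P w x ^+ 2 + Q w x ^+ 2 = r x ^+ 2.
Proof.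
rewrite modulus_sq /P /Q.
transitivity ((u x ^+ 2 + v x ^+ 2) * (cos (th w x) ^+ 2 + sin (th w x) ^+ 2)).
  ring.
by rewrite cos2Dsin2 mulr1.
Qed.

Lemma Rintegral_lin p q w :
  \int[mu]_x (p * P w x + q * Q w x) = p * C w + q * S w.
Proof.
have ip : mu.-integrable setT (fun x => (p * P w x)%:E).
  by have := integrableZl measurableT p (iP w); apply: eq_integrable.
have iq : mu.-integrable setT (fun x => (q * Q w x)%:E).
  by have := integrableZl measurableT q (iQ w); apply: eq_integrable.
by rewrite RintegralD// !RintegralZl.
Qed.

Lemma lin_le_modulus (p q a b : R) : p ^+ 2 + q ^+ 2 = 1 -> p * a + q * b <= modulus a b.
Proof.
move=> pq; have := sqr_ge0 (p * b - q * a); have := modulus_sq a b.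
have := modulus_ge0 a b; set n := modulus a b => n0 n2 h.
have [h0|h0] := leP (p * a + q * b) 0; first exact: le_trans h0 n0.
rewrite -(@ler_pXn2r _ 2)// ?nnegrE// ?(ltW h0)// n2 -subr_ge0.
rewrite (_ : _ - _ = (p * b - q * a) ^+ 2 + (1 - (p ^+ 2 + q ^+ 2)) * (a ^+ 2 + b ^+ 2)); last by ring.
by rewrite pq subrr mul0r addr0.
Qed.

(** With (p, q) the unit vector in the direction of F(w), |F(w)| is the integral of
    [p * P w x + q * Q w x], which is at most [r x] pointwise. This form of the triangle inequality
    exposes its equality case. *)
Lemma ft_modulus_le w : m w <= M.
Proof.
have [m0|m0] := eqVneq (m w) 0.
  by rewrite m0; apply: Rintegral_ge0 => x _; exact: modulus_ge0.
have pq : (C w / m w) ^+ 2 + (S w / m w) ^+ 2 = 1.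
  by rewrite !exprMn -mulrDl -modulus_sq -exprMn mulfV// expr1n.
have -> : m w = C w / m w * C w + S w / m w * S w.
  rewrite mulrAC [X in _ = _ + X]mulrAC -mulrDl -!expr2 -modulus_sq expr2.
  by rewrite mulfK.
rewrite -Rintegral_lin; apply: le_Rintegral => //.
- have := integrableD measurableT (integrableZl measurableT (C w / m w) (iP w))
    (integrableZl measurableT (S w / m w) (iQ w)).
  exact: eq_integrable.
- exact: integrable_modulus.
- by move=> x _; rewrite -[r x]/(modulus (u x) (v x)) /modulus -modulus_sq -[modulus _ _]/(r x) -(PQr w x); exact: lin_le_modulus.
Qed.

(** The condition f(x) e^(-2 pi i x.w) = (p + i q) |f(x)| for almost every x. *)
Definition phase_aligned w (p q : R) := p ^+ 2 + q ^+ 2 = 1 /\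
  {ae mu, forall x, P w x = p * r x /\ Q w x = q * r x}.

Lemma phase_aligned_modulus w p q : phase_aligned w p q -> m w = M.
Proof.
move=> [pq ae]; have M0 : 0 <= M by apply: Rintegral_ge0 => x _; exact: modulus_ge0.
have ir := integrable_modulus.
have HC : C w = p * M.
  rewrite /C /M -RintegralZl//; congr fine; apply: ae_eq_integral => //.
  - exact: measurable_int (iP w).
  - by apply/measurable_EFinP; apply: measurable_funM => //; exact: measurable_modulus.
  - by apply: filterS ae => x [<- _] _.
have HS : S w = q * M.
  rewrite /S /M -RintegralZl//; congr fine; apply: ae_eq_integral => //.
  - exact: measurable_int (iQ w).
  - by apply/measurable_EFinP; apply: measurable_funM => //; exact: measurable_modulus.
  - by apply: filterS ae => x [_ <-] _.
by rewrite /m /modulus HC HS !exprMn -mulrDl pq mul1r sqrtr_sqr ger0_norm.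
Qed.

(** The nonnegative [r - (p * P + q * Q)] has integral 0, so it vanishes almost everywhere; with P^2
    + Q^2 = r^2 this is the equality case of Cauchy-Schwarz in the plane, and forces (P, Q) = r (p,
    q). *)
Lemma modulus_phase_aligned w : 0 < M -> m w = M ->
  phase_aligned w (C w / M) (S w / M).
Proof.
move=> M0 mM; set p := C w / M; set q := S w / M.
have pq : p ^+ 2 + q ^+ 2 = 1.
  by rewrite !exprMn -mulrDl -modulus_sq -/(m w) mM -exprMn mulfV ?gt_eqF// expr1n.
split=> //; pose D x := r x - (p * P w x + q * Q w x).
have iL : mu.-integrable setT (EFin \o (fun x => p * P w x + q * Q w x)).
  have := integrableD measurableT (integrableZl measurableT p (iP w))
    (integrableZl measurableT q (iQ w)).
  exact: eq_integrable.
have ir := integrable_modulus.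
have iD : mu.-integrable setT (EFin \o D).
  by have := integrableB measurableT ir iL; apply: eq_integrable.
have D0 x : 0 <= D x.
  rewrite subr_ge0 -[r x]/(modulus (u x) (v x)) /modulus -modulus_sq -[modulus _ _]/(r x) -(PQr w x).
  exact: lin_le_modulus.
have ID : \int[mu]_x D x = 0.
  rewrite RintegralB// Rintegral_lin -/M /p /q.
  rewrite mulrAC [X in _ - (_ + X)]mulrAC -mulrDl -!expr2 -modulus_sq -/(m w) mM expr2.
  by rewrite mulfK ?subrr ?gt_eqF.
have IDe : (\int[mu]_x (D x)%:E = 0)%E.
  by rewrite -(fineK (integrable_fin_num measurableT iD)); congr EFin; exact: ID.
have := (ae_eq_integral_abs mu measurableT (measurable_int _ iD)).1.
have -> : (\int[mu]_x `|(D x)%:E| = 0)%E.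
  by rewrite -[RHS]IDe; apply: eq_integral => x _; rewrite gee0_abs// lee_fin.
move=> /(_ erefl); apply: filterS => x /(_ I) /= [] /eqP.
rewrite /D subr_eq0 => /eqP E.
have := PQr w x; set A := P w x; set B := Q w x => AB.
have : (A - p * r x) ^+ 2 + (B - q * r x) ^+ 2 = 0.
  transitivity ((A ^+ 2 + B ^+ 2) - 2 * r x * (p * A + q * B) + (p ^+ 2 + q ^+ 2) * r x ^+ 2).
    ring.
  by rewrite AB pq -E; ring.
move/eqP; rewrite paddr_eq0 ?sqr_ge0// !sqrf_eq0 !subr_eq0.
by move=> /andP[/eqP -> /eqP ->].
Qed.

Lemma dotp_reflect x w0 w1 : dotp x (taff 2 (tscale (-1) w0) w1) = 2 * dotp x w1 - dotp x w0.
Proof.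
rewrite /dotp mulr_sumr -sumrB; apply: eq_bigr => i _.
by rewrite tnth_taff tnth_tscale; ring.
Qed.

(** With e_w = e^(-2 pi i x.w), |f|^2 f e_(2 w1 - w0) = (f e_w1)^2 conj (f e_w0). Alignment at [w0]
    and [w1] thus passes to [2 w1 - w0]. *)
Lemma phase_reflect w0 w1 : 0 < M -> m w0 = M -> m w1 = M ->
  m (taff 2 (tscale (-1) w0) w1) = M.
Proof.
move=> M0 m0 m1.
have [pq0 ae0] := modulus_phase_aligned M0 m0.
have [pq1 ae1] := modulus_phase_aligned M0 m1.
move: pq0 ae0 pq1 ae1.
set p0 := C w0 / M; set q0 := S w0 / M; set p1 := C w1 / M; set q1 := S w1 / M.
move=> pq0 ae0 pq1 ae1.
(* (p2 + i q2) = (p1 + i q1)^2 * conj (p0 + i q0) *)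
pose p2 := (p1 ^+ 2 - q1 ^+ 2) * p0 + 2 * p1 * q1 * q0.
pose q2 := 2 * p1 * q1 * p0 - (p1 ^+ 2 - q1 ^+ 2) * q0.
apply: (@phase_aligned_modulus _ p2 q2); split.
  transitivity ((p1 ^+ 2 + q1 ^+ 2) ^+ 2 * (p0 ^+ 2 + q0 ^+ 2)).
    by rewrite /p2 /q2; ring.
  by rewrite pq0 pq1 expr1n mulr1.
apply: filterS2 ae0 ae1 => x [P0 Q0] [P1 Q1].
(* The identity carries a factor |f|^2, to be cancelled where f does not vanish; elsewhere both
   sides are 0. *)
have [r0|r0] := eqVneq (r x) 0.
  have := PQr (taff 2 (tscale (-1) w0) w1) x.
  rewrite r0 expr0n/= => /eqP; rewrite paddr_eq0 ?sqr_ge0// !sqrf_eq0.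
  by move=> /andP[/eqP -> /eqP ->]; rewrite !mulr0.
have thE : th (taff 2 (tscale (-1) w0) w1) x = th w1 x + th w1 x - th w0 x.
  by rewrite /th dotp_reflect; ring.
have ruv : u x ^+ 2 + v x ^+ 2 = r x ^+ 2 by rewrite -modulus_sq.
move: P0 Q0 P1 Q1; rewrite /P /Q thE cosB sinB cosD sinD.
set c0 := cos (th w0 x); set s0 := sin (th w0 x).
set c1 := cos (th w1 x); set s1 := sin (th w1 x).
move=> P0 Q0 P1 Q1.
have r2 : r x ^+ 2 != 0 by rewrite expf_neq0.
have E (X Y : R) : (u x ^+ 2 + v x ^+ 2) * X = r x ^+ 2 * Y -> X = Y.
  by rewrite ruv => /(mulfI r2).
split; apply: E.
  transitivity (((u x * c1 + v x * s1) ^+ 2 - (v x * c1 - u x * s1) ^+ 2) * (u x * c0 + v x * s0) +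
     2 * (u x * c1 + v x * s1) * (v x * c1 - u x * s1) * (v x * c0 - u x * s0)).
    ring.
  by rewrite P0 Q0 P1 Q1 /p2; ring.
transitivity (2 * (u x * c1 + v x * s1) * (v x * c1 - u x * s1) * (u x * c0 + v x * s0) -
  ((u x * c1 + v x * s1) ^+ 2 - (v x * c1 - u x * s1) ^+ 2) * (v x * c0 - u x * s0)).
  ring.
by rewrite P0 Q0 P1 Q1 /q2; ring.
Qed.

Lemma peak_set_null : (0 < d)%N -> 0 < M ->
  (mu [set w | m w = M] < +oo)%E -> mu [set w | m w = M] = 0%E.
Proof.
move=> d0 M0 Eoo; set E := [set w | m w = M].
have [->|/eqP/set0P[w0 Ew0]] := pselect (E = set0); first by rewrite measure0.
have mE : measurable E.
  rewrite (_ : E = m @^-1` [set M])//.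
  rewrite -[X in measurable X]setTI; apply: measurable_modulus => //.
    exact: measurable_ftre.
  exact: measurable_ftim.
have h := lebesgue_affine (tscale (-1) w0) lmu (ltr0n R 2) mE.
have le : (mu E <= mu (taff 2 (tscale (-1) w0) @^-1` E))%E.
  apply: le_measure; rewrite ?inE//.
    rewrite -[X in measurable X]setTI; exact: measurable_taff.
  by move=> w1 Ew1; exact: phase_reflect.
have Ef : mu E \is a fin_num by rewrite ge0_fin_numE.
have : ((2 ^+ d)%:E * mu E <= mu E)%E.
  by rewrite [leRHS]h lee_wpmul2l// lee_fin exprn_ge0.
rewrite -(fineK Ef) -EFinM lee_fin => le2; congr EFin.
have fE0 : 0 <= fine (mu E) by rewrite fine_ge0.
apply/eqP; rewrite eq_le fE0 andbT.
rewrite -(@pmulr_rle0 _ (2 ^+ d - 1)); first by rewrite mulrBl mul1r subr_le0.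
by rewrite subr_gt0 exprn_egt1 ?ltr1n// -lt0n.
Qed.

Lemma strict_energy_bound : (0 < d)%N -> (sqint2 mu u v < +oo)%E -> (0 < sqint2 mu u v)%E ->
  (sqint2 mu u v < M%:E * \int[mu]_w (m w)%:E)%E.
Proof.
move=> d0 Aoo A0; set A := sqint2 mu u v in Aoo A0 *.
have mm : measurable_fun setT m.
  by apply: measurable_modulus; [exact: measurable_ftre|exact: measurable_ftim].
have m0 w : 0 <= m w by exact: modulus_ge0.
have Mge0 : 0 <= M by apply: Rintegral_ge0 => x _; exact: modulus_ge0.
have AE : A = (\int[mu]_w (m w ^+ 2)%:E)%E.
  rewrite /A -(plancherel lmu iu iv Aoo); apply: eq_integral => w _.
  by rewrite /m modulus_sq.
(* If M were 0, then |F| <= M would make F vanish and Plancherel would give zero energy. *)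
have M0 : 0 < M.
  rewrite lt_neqAle Mge0 andbT; apply/eqP => ME; move: A0; rewrite AE.
  under eq_integral => w _.
    rewrite (_ : m w = 0); last by apply/eqP; rewrite eq_le m0 andbT ME ft_modulus_le.
    rewrite expr0n/=.
    over.
  by rewrite integral0 ltxx.
rewrite ltNge; apply/negP => leA.
(* Under the reverse inequality the nonnegative [D = m (M - m)] has integral 0, so that [m] takes
   only the values 0 and [M] almost everywhere. *)
pose D w := M * m w - m w ^+ 2.
have D0 w : 0 <= D w by rewrite /D expr2 -mulrBl mulr_ge0// subr_ge0 ft_modulus_le.
have mD : measurable_fun setT (EFin \o D).
  apply/measurable_EFinP; apply: measurable_funB; first exact: measurable_funM.
  exact: measurable_funX.
have mm2 : measurable_fun setT (fun w => (m w ^+ 2)%:E) by exact: measurable_sq.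
have Af : A \is a fin_num by rewrite ge0_fin_numE// ltW.
have ID : (\int[mu]_w (D w)%:E = 0)%E.
  apply/eqP; rewrite eq_le; apply/andP; split; last by apply: integral_ge0 => w _; rewrite lee_fin.
  rewrite -(leeD2rE _ _ Af) add0e; apply: le_trans leA.
  have D0' w : setT w -> (0 <= (D w)%:E)%E by rewrite lee_fin.
  have m0' w : setT w -> (0 <= (m w)%:E)%E by rewrite lee_fin.
  have mm' : measurable_fun setT (fun w => (m w)%:E) by exact/measurable_EFinP.
  have m20' w : setT w -> (0 <= (m w ^+ 2)%:E)%E by rewrite lee_fin sqr_ge0.
  have M0' : (0 <= M%:E)%E by rewrite lee_fin.
  rewrite [in leLHS]AE -ge0_integralD// -ge0_integralZl//.
  rewrite le_eqVlt; apply/orP; left; apply/eqP; apply: eq_integral => w _.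
  by rewrite -EFinD -EFinM /D subrK.
have ae : {ae mu, forall w, setT w -> m w ^+ 2 = M ^+ 2 * \1_[set w | m w = M] w}.
  have := (ae_eq_integral_abs mu measurableT mD).1.
  have -> : (\int[mu]_x `|(D x)%:E| = 0)%E.
    by rewrite -[RHS]ID; apply: eq_integral => x _; rewrite gee0_abs// lee_fin.
  move=> /(_ erefl); apply: filterS => w /(_ I) /= [] /eqP Dw _.
  rewrite indicE; case: (boolP (w \in _)) => [/set_mem/= ->|]; first by rewrite mulr1.
  rewrite notin_setE/= => mM; move: Dw; rewrite /D expr2 -mulrBl mulf_eq0 subr_eq0.
  by move=> /orP[/eqP/esym//|/eqP ->]; rewrite mul0r mulr0.
have mE : measurable [set w | m w = M].
  rewrite (_ : [set _ | _] = m @^-1` [set M])//.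
  by rewrite -[X in measurable X]setTI; apply: mm.
have AM : A = ((M ^+ 2)%:E * mu [set w | m w = M])%E.
  have mi : measurable_fun setT (fun w => (\1_[set w | m w = M] w : R)%:E) by exact/measurable_EFinP.
  have i0 w : setT w -> (0 <= (\1_[set w | m w = M] w : R)%:E)%E by rewrite lee_fin.
  have M20 : (0 <= (M ^+ 2)%:E)%E by rewrite lee_fin sqr_ge0.
  rewrite AE -[X in (_ * mu X)%E]setIT -integral_indic// -ge0_integralZl//.
  apply: ge0_ae_eq_integral => //.
  - by apply: measurable_funeM; exact/measurable_EFinP.
  - by move=> w _; rewrite lee_fin sqr_ge0.
  - by move=> w _; rewrite -EFinM lee_fin mulr_ge0 ?sqr_ge0.
  - by apply: filterS ae => w h _; rewrite h// EFinM.
(* The energy [M ^+ 2] times the mass of the peak set is finite, which supplies the finiteness that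
   [peak_set_null] asks for. *)
have Eoo : (mu [set w | m w = M] < +oo)%E.
  rewrite ltey; apply/eqP => Einf; move: Aoo; rewrite AM Einf gt0_muley ?ltxx//.
  by rewrite lte_fin exprn_gt0.
by move: A0; rewrite AM (peak_set_null d0 M0 Eoo) mule0 ltxx.
Qed.

End strict_hausdorff_young.

(** * Gamma function and radial integrals *)

Section exponential_integrals.
Context {R : realType}.
Let lam := @lebesgue_measure R.

Lemma measurable_expRN c : measurable_fun setT (fun t : R => expR (- (c * t))).
Proof.
apply: measurable_expR_comp; apply: measurableT_comp => //; exact: measurable_funM.
Qed.

Lemma derive_expRN (c x : R) : is_derive x 1 (fun t : R => - expR (- (c * t))) (c * expR (- (c * x))).
Proof.
have h : is_derive x 1 (fun t : R => - (c * t)) (- c).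
  apply: (@is_derive_eq _ _ _ _ _ _ _ _ (is_deriveN (is_deriveZ c (is_derive_id x 1)))).
  by rewrite /GRing.scale/= mulr1.
apply: (@is_derive_eq _ _ _ _ _ _ _ _ (is_deriveN (is_derive1_comp (is_derive_expR _) h))).
by rewrite /GRing.scale/= mulrN opprK mulrC.
Qed.

Lemma integral_exp_tail (c z : R) : 0 < c ->
  (\int[lam]_(t in `]z, +oo[) (c * expR (- (c * t)))%:E = (expR (- (c * z)))%:E)%E.
Proof.
move=> c0; rewrite integral_itv_obnd_cbnd; last first.
  apply: measurable_funTS; apply/measurable_EFinP; apply: measurable_funM => //.
  exact: measurable_expRN.
have dF (x : R) : derivable (fun t : R => - expR (- (c * t))) x 1.
  by have [] := derive_expRN c x.
have cF : continuous (fun t : R => - expR (- (c * t))).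
  by move=> x; apply: differentiable_continuous; apply/derivable1_diffP.
have cf : continuous (fun t : R => c * expR (- (c * t))).
  move=> x; apply: (@cvgM _ _ _ _ (fun=> c)); first exact: cvg_cst.
  apply: (@cvg_comp _ _ _ (fun t : R => - (c * t)) (@expR R)); last exact: continuous_expR.
  by apply: cvgN; exact: mulrl_continuous.
rewrite (@ge0_continuous_FTC2y _ _ (fun t : R => - expR (- (c * t))) z 0)//.
- by rewrite sub0e EFinN oppeK.
- by move=> x _; rewrite mulr_ge0 ?expR_ge0// ltW.
- exact: continuous_subspaceT.
- rewrite -oppr0; apply: cvgN.
  rewrite (_ : (fun x : R => expR (- (c * x))) =
               (fun z => expR (- z)) \o (fun z : R => c * z))//.
  apply: (@cvg_comp _ _ _ _ _ _ (pinfty_nbhs R)); last exact: cvgr_expR.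
  exact: gt0_cvgMry.
- by apply: cvg_at_right_filter; exact: cF.
- by move=> x _; rewrite derive1E; have [_ ->] := derive_expRN c x.
Qed.

Lemma integral_powR (s y : R) : 0 < s -> 0 < y ->
  (\int[lam]_(t in `]0%R, y[) (s * t `^ (s - 1))%:E = (y `^ s)%:E)%E.
Proof.
move=> s0 y0.
have mf D : measurable_fun D (fun t : R => (s * t `^ (s - 1))%:E).
  apply: measurable_funTS; apply/measurable_EFinP; apply: measurable_funM => //.
rewrite integral_itv_bndo_bndc//.
(* For [s < 1] the integrand is unbounded at 0, so the fundamental theorem is applied away from 0.
   The divisor [n.+2] keeps the lower endpoint strictly below [y] for every [n]. *)
pose F (n : nat) : set R := `[y / n.+2%:R, y]%classic.
have n0 n : 0 < y / n.+2%:R by rewrite divr_gt0.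
have ny n : y / n.+2%:R < y by rewrite ltr_pdivrMr// ltr_pMr// ltr1n.
have FU : \bigcup_n F n = `]0, y]%classic.
  apply/seteqP; split => t; rewrite /= in_itv/=.
    by move=> [n _]; rewrite /F/= in_itv/= => /andP[nt ->]; rewrite andbT (lt_le_trans (n0 n)).
  move=> /andP[t0 ty]; exists (Num.truncn (y / t)) => //; rewrite /F/= in_itv/= ty andbT.
  rewrite ler_pdivrMr// mulrC -ler_pdivrMr//.
  by apply/ltW/(lt_trans (truncnS_gt _)); rewrite ltr_nat.
have c1 : (\int[lam]_(t in F n) (s * t `^ (s - 1))%:E)%E @[n --> \oo] -->
    (\int[lam]_(t in `]0%R, y]) (s * t `^ (s - 1))%:E)%E.
  rewrite -FU; apply: ge0_nondecreasing_set_cvg_integral => //.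
  - move=> n m nm; apply/subsetPset => t; rewrite /F/= !in_itv/= => /andP[nt ->]; rewrite andbT.
    by apply: le_trans nt; rewrite ler_pM2l// lef_pV2 ?posrE// ler_nat.
  - by move=> n; exact: measurable_itv.
  - by move=> n; exact: mf.
  - by move=> n t _; rewrite lee_fin mulr_ge0 ?powR_ge0// ltW.
apply/esym; apply: cvg_unique c1 => //.
have itvp x n : x \in `[y / n.+2%:R, y] -> 0 < x.
  by rewrite in_itv/= => /andP[/(lt_le_trans (n0 n))].
have dp (r x : R) : 0 < x -> derivable (fun t : R => t `^ r) x 1.
  by move=> x0; apply: derivable_powR; rewrite in_itv/= x0.
have cp (r x : R) : 0 < x -> {for x, continuous (fun t : R => t `^ r)}.
  by move=> x0; apply: differentiable_continuous; apply/derivable1_diffP; exact: dp.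
have E n : (\int[lam]_(t in F n) (s * t `^ (s - 1))%:E = (y `^ s)%:E - ((y / n.+2%:R) `^ s)%:E)%E.
  apply: (@continuous_FTC2 _ _ (fun t : R => t `^ s)); first exact: ny.
  - apply: derivable_within_continuous => x /itvp x0.
    by apply: derivableM => //; exact: dp.
  - split.
    + by move=> x /subset_itv_oo_cc/itvp; exact: dp.
    + by apply: cvg_at_right_filter; exact: cp.
    + by apply: cvg_at_left_filter; exact: cp.
  - by move=> x /subset_itv_oo_cc/itvp x0; rewrite powR_derive1// in_itv/= x0.
have c2 : (fun n : nat => (y / n.+2%:R) `^ s) @ \oo --> 0.
  apply: ((cvg_at_rightP (fun t : R => t `^ s) 0 0).1 (powR_cvg0 s0)).
  split; first by move=> n; exact: n0.
  rewrite -(mulr0 y); apply: (@cvgM _ _ _ _ (fun=> y)); first exact: cvg_cst.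
  by have := @cvg_harmonic R; rewrite -cvg_shiftS.
have c3 : ((y `^ s - (y / n.+2%:R) `^ s)%:E @[n --> \oo] --> (y `^ s)%:E)%E.
  apply: cvg_EFin; first by apply: nearW.
  rewrite -[X in _ --> X]subr0; apply: cvgB c2; exact: cvg_cst.
by rewrite /= (funext E); exact: c3.
Qed.

End exponential_integrals.

Section layer_cake.
Context {R : realType} {dT} {T : measurableType dT}.
Variable m : {sigma_finite_measure set T -> \bar R}.
Let lam := @lebesgue_measure R.

(** Tonelli on the region [phi x < t]. With [w t = expR (- t)] the inner integral on the left is
    [expR (- phi x)], while the right side weighs sublevel sets of [phi]. *)
Lemma layer_cake (psi phi : T -> R) (w : R -> R) :
  measurable_fun setT psi -> measurable_fun setT phi -> measurable_fun setT w ->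
  (forall x, 0 <= psi x) -> (forall t, 0 <= w t) ->
  (\int[m]_x ((psi x)%:E * \int[lam]_(t in `]phi x, +oo[) (w t)%:E) =
   \int[lam]_t ((w t)%:E * \int[m]_(x in [set x | phi x < t]%R) (psi x)%:E))%E.
Proof.
move=> mpsi mphi mw psi0 w0.
pose h (p : T * R) : \bar R := (psi p.1 * w p.2 * (phi p.1 < p.2)%R%:R)%:E.
have mlt (p : T * R -> bool) : measurable_fun setT p -> measurable_fun setT (fun z => (p z)%:R : R).
  move=> mp; rewrite (_ : (fun z => _) = (fun z => if p z then 1 else 0 : R)).
    exact: measurable_fun_ifT.
  by apply/funext => z; case: (p z).
have mh : measurable_fun setT h.
  apply/measurable_EFinP; apply: measurable_funM.
    by apply: measurable_funM; exact: measurableT_comp.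
  by apply: mlt; apply: measurable_fun_ltr => //; exact: measurableT_comp.
have h0 p : (0 <= h p)%E by rewrite lee_fin !mulr_ge0.
transitivity (\int[m]_x \int[lam]_t h (x, t))%E.
  apply: eq_integral => x _.
  have mx : measurable_fun `]phi x, +oo[ (fun t => (w t)%:E).
    by apply: measurable_funTS; exact/measurable_EFinP.
  have w0' t : `]phi x, +oo[%classic t -> (0 <= (w t)%:E)%E by rewrite lee_fin.
  rewrite -ge0_integralZl//; last by rewrite lee_fin.
  rewrite integral_mkcond; apply: eq_integral => t _.
  rewrite patchE /h/= mem_setE in_itv/= andbT; case: ifPn => /= _; first by rewrite mulr1.
  by rewrite mulr0.
rewrite (@fubini_tonelli _ _ _ _ _ m lam)//; apply: eq_integral => t _.
have mS : measurable [set x | phi x < t].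
  rewrite (_ : [set x | phi x < t] = phi @^-1` `]-oo, t[%classic).
    by rewrite -[X in measurable X]setTI; apply: mphi.
  by apply/seteqP; split => x; rewrite /= in_itv.
have mx : measurable_fun [set x | phi x < t] (fun x => (psi x)%:E).
  by apply: measurable_funTS; exact/measurable_EFinP.
have wt0 : (0 <= (w t)%:E)%E by rewrite lee_fin.
have w0' x : [set x | phi x < t] x -> (0 <= (psi x)%:E)%E by rewrite lee_fin.
rewrite -ge0_integralZl//.
rewrite [RHS]integral_mkcond; apply: eq_integral => x _.
rewrite patchE /h/= (_ : (x \in [set x | phi x < t]) = (phi x < t)); last first.
  by apply/idP/idP; rewrite inE.
case: ifPn => /= _; last by rewrite mulr0.
by rewrite mulr1 mulrC.
Qed.

End layer_cake.

(** * The Gamma function with extended real values *)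

Section gamma_function.
Context {R : realType}.
Let lam := @lebesgue_measure R.

(* [Gamma] is the real part [fine] of this integral: [0] if it were infinite. *)
Definition egamma (s : R) : \bar R :=
  (\int[lam]_(t in `]0%R, +oo[) (t `^ (s - 1) * expR (- t))%:E)%E.

Lemma GammaE (s : R) : Gamma s = fine (egamma s). Proof. by []. Qed.

Lemma measurable_expRN1 : measurable_fun setT (fun t : R => expR (- t)).
Proof. by under eq_fun do rewrite -[X in - X]mul1r; exact: measurable_expRN. Qed.

Lemma measurable_gamma_kernel s D : measurable_fun D (fun t : R => (t `^ (s - 1) * expR (- t))%:E).
Proof.
apply: measurable_funTS; apply/measurable_EFinP; apply: measurable_funM => //.
exact: measurable_expRN1.
Qed.

Lemma egamma_ge0 s : (0 <= egamma s)%E.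
Proof. by apply: integral_ge0 => t _; rewrite lee_fin mulr_ge0 ?powR_ge0 ?expR_ge0. Qed.

Lemma Gamma_ge0 (s : R) : 0 <= Gamma s.
Proof. by rewrite GammaE fine_ge0// egamma_ge0. Qed.

(** Integration by parts in the form of Tonelli: [expR (- x)] is the tail integral of itself, and
    [s * x]^ (s - 1)[integrates to]t [^ s] over []0, t[]. The identity holds even for infinite
    values, so it can be used to prove finiteness. *)
Lemma egammaS s : 0 < s -> (s%:E * egamma s = egamma (s + 1))%E.
Proof.
move=> s0.
pose psi (x : R) := (if 0 < x then s * x `^ (s - 1) else 0).
have psi0 x : 0 <= psi x by rewrite /psi; case: ifP => // _; rewrite mulr_ge0 ?powR_ge0 ?ltW.
have mpsi : measurable_fun setT psi.
  apply: measurable_fun_ifT => //; first exact: measurable_fun_ltr.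
  exact: measurable_funM.
have := @layer_cake _ _ _ lam psi id _ mpsi (@measurable_id _ _ setT) measurable_expRN1 psi0 (fun t => expR_ge0 _).
set L := (LHS in LHS = _ -> _); set Q := (RHS in _ = RHS -> _) => LQ.
have tail (x : R) : (\int[lam]_(t in `]x, +oo[) (expR (- t))%:E = (expR (- x))%:E)%E.
  have := @integral_exp_tail _ 1 x ltr01; rewrite mul1r => <-.
  by apply: eq_integral => t _; rewrite !mul1r.
transitivity L.
  rewrite /egamma -ge0_integralZl//; last 3 first.
  - exact: measurable_gamma_kernel.
  - by move=> t _; rewrite lee_fin mulr_ge0 ?powR_ge0 ?expR_ge0.
  - by rewrite lee_fin ltW.
  rewrite integral_mkcond; apply: eq_integral => t _.
  rewrite patchE mem_setE in_itv/= andbT tail /psi.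
  by case: ifP => _; rewrite -EFinM ?mul0r// mulrA.
rewrite LQ /egamma integral_mkcond; apply: eq_integral => t _.
rewrite patchE mem_setE in_itv/= andbT addrK.
case: ifPn => t0.
  have -> : (\int[lam]_(x in [set x | (id x < t)%R]) (psi x)%:E =
     \int[lam]_(x in `]0%R, t[) (s * x `^ (s - 1))%:E)%E.
    rewrite integral_mkcond [RHS]integral_mkcond; apply: eq_integral => x _.
    rewrite [LHS]patchE [RHS]patchE.
    have -> : (x \in [set x | id x < t]) = (x < t) by apply/idP/idP; rewrite inE.
    have -> : (x \in `]0, t[%classic) = (0 < x < t) by apply/idP/idP; rewrite inE/= in_itv.
    rewrite /psi.
    by case: (0 < x); case: (x < t).
  by rewrite integral_powR// -EFinM mulrC.
rewrite integral0_eq ?mule0// => x/= xt; rewrite /psi ifF//.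
by apply/negbTE; rewrite -leNgt (le_trans (ltW xt))// leNgt.
Qed.

Lemma egamma1 : egamma 1 = 1%E.
Proof.
have := @integral_exp_tail R 1 0 ltr01; rewrite mulr0 oppr0 expR0 => <-.
by apply: eq_integral => t _; rewrite subrr powRr0 !mul1r.
Qed.

(** For [0 < s < 1] one has t^s <= 1 + t, hence [egamma (s + 1)] is at most
    [egamma 1 + egamma 2 = 2]; the recurrence carries finiteness back to [s]. *)
Lemma egamma_fin01 s : 0 < s -> s < 1 -> (egamma s < +oo)%E.
Proof.
move=> s0 s1.
have e2 : egamma (1 + 1) = 1%E by rewrite -egammaS// egamma1 mule1.
have h : (egamma (s + 1) <= 1 + 1)%E.
  rewrite -[X in (_ <= X + _)%E]egamma1 -[X in (_ <= _ + X)%E]e2 /egamma -ge0_integralD//.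
  - apply: ge0_le_integral => //.
    + by move=> t _; rewrite lee_fin mulr_ge0 ?powR_ge0 ?expR_ge0.
    + exact: measurable_gamma_kernel.
    + by apply: emeasurable_funD; exact: measurable_gamma_kernel.
    + move=> t; rewrite /= in_itv/= andbT => t0; rewrite -EFinD lee_fin -mulrDl.
      rewrite ler_wpM2r ?expR_ge0// !addrK subrr powRr0 powRr1 ?(ltW t0)//.
      have [t1|t1] := leP t 1.
        apply: (@le_trans _ _ 1); last by rewrite lerDl (ltW t0).
        have -> : 1 = 1 `^ s :> R by rewrite powR1.
        by apply: ge0_ler_powR; rewrite ?nnegrE ?(ltW t0) ?(ltW s0).
      by rewrite (le_trans (ler1_powR (ltW t1) (ltW s1)))// lerDr.
  - by move=> t _; rewrite lee_fin mulr_ge0 ?powR_ge0 ?expR_ge0.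
  - exact: measurable_gamma_kernel.
  - by move=> t _; rewrite lee_fin mulr_ge0 ?powR_ge0 ?expR_ge0.
  - exact: measurable_gamma_kernel.
rewrite ltey; apply/eqP => soo; move: h; rewrite -egammaS// soo gt0_muley ?lte_fin//.
Qed.

End gamma_function.

(** * Ball volume and radial integrals *)

Section radial.
Context {R : realType} {d : nat}.
Variable mu : {sigma_finite_measure set (d.-tuple R) -> \bar R}.
Hypothesis lmu : is_lebesgue_measure mu.
Hypothesis d0 : (0 < d)%N.
Implicit Types x : d.-tuple R.

Definition rdist (xbar x : d.-tuple R) : R := enorm (tsub x xbar).

Lemma rdist_ge0 xbar x : 0 <= rdist xbar x. Proof. exact: sqrtr_ge0. Qed.

Lemma measurable_rdist xbar : measurable_fun setT (rdist xbar).
Proof.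
rewrite /rdist; apply: measurableT_comp; first exact: measurable_enorm.
rewrite (_ : (fun x => tsub x xbar) = taff 1 [tuple - tnth xbar i | i < d]).
  exact: measurable_taff.
by apply/funext => x; apply: eq_from_tnth => i; rewrite tnth_taff !tnth_mktuple mul1r.
Qed.

Lemma measurable_rdist_powR xbar p : measurable_fun setT (fun x => rdist xbar x `^ p).
Proof. exact: (measurableT_comp (measurable_powR p) (measurable_rdist xbar)). Qed.

Definition ball_volume : R := fine (mu [set x | enorm x < 1]).

Lemma measurable_enorm_lt r : measurable [set x : d.-tuple R | enorm x < r].
Proof.
rewrite (_ : [set x | _] = @enorm R d @^-1` `]-oo, r[%classic).
  by rewrite -[X in measurable X]setTI; apply: measurable_enorm.
by apply/seteqP; split => x; rewrite /= in_itv.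
Qed.

Lemma measurable_rdist_lt xbar r : measurable [set x | rdist xbar x < r].
Proof.
rewrite (_ : [set x | _] = rdist xbar @^-1` `]-oo, r[%classic).
  by rewrite -[X in measurable X]setTI; apply: measurable_rdist.
by apply/seteqP; split => x; rewrite /= in_itv.
Qed.

Lemma ball_volumeE : mu [set x | enorm x < 1] = ball_volume%:E.
Proof.
rewrite /ball_volume fineK// ge0_fin_numE//.
apply: le_lt_trans (eball_fin lmu 1); apply: le_measure.
- by rewrite inE; exact: measurable_enorm_lt.
- by rewrite inE; exact: measurable_eball.
- by move=> x /= /ltW.
Qed.

Lemma ball_volume_ge0 : 0 <= ball_volume.
Proof. by rewrite fine_ge0. Qed.

Lemma lebesgue_ball xbar r : 0 < r ->
  mu [set x | rdist xbar x < r] = (r ^+ d * ball_volume)%:E.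
Proof.
move=> r0; rewrite (lebesgue_affine xbar lmu r0); last exact: measurable_rdist_lt.
rewrite EFinM -ball_volumeE; congr (_ * mu _)%E.
apply/seteqP; split => x; rewrite /preimage/= /rdist /enorm.
all: have -> : dotp (tsub (taff r xbar x) xbar) (tsub (taff r xbar x) xbar) = r ^+ 2 * dotp x x.
  1,3: by rewrite /dotp mulr_sumr; apply: eq_bigr => i _; rewrite !tnth_mktuple addrK; ring.
all: by rewrite sqrtrM ?sqr_ge0// sqrtr_sqr gtr0_norm// -ltr_pdivlMl// mulVf ?gt_eqF.
Qed.

Lemma rdist_powR_ball xbar p c t : 0 < p -> 0 < c -> 0 < t ->
  mu [set x | c * rdist xbar x `^ p < t] =
  (t `^ (d%:R / p) * c `^ (- (d%:R / p)) * ball_volume)%:E.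
Proof.
move=> p0 c0 t0; have tc0 : 0 < t / c by rewrite divr_gt0.
have -> : [set x | c * rdist xbar x `^ p < t] = [set x | rdist xbar x < (t / c) `^ p^-1].
  apply/seteqP; split => x /=; have e0 := rdist_ge0 xbar x.
    move=> h; have : (rdist xbar x `^ p) `^ p^-1 < (t / c) `^ p^-1.
      by apply: gt0_ltr_powR; rewrite ?invr_gt0// ?nnegrE ?powR_ge0 ?(ltW tc0)// ltr_pdivlMr// mulrC.
    by rewrite -powRrM divff ?gt_eqF// powRr1.
  move=> h; have : rdist xbar x `^ p < ((t / c) `^ p^-1) `^ p.
    by apply: gt0_ltr_powR => //; rewrite ?nnegrE ?powR_ge0.
  by rewrite -powRrM mulVf ?gt_eqF// powRr1 ?(ltW tc0)// ltr_pdivlMr// mulrC.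
rewrite lebesgue_ball ?powR_gt0//; congr (_ * _)%:E.
rewrite -powR_mulrn ?powR_ge0// -powRrM [p^-1 * _]mulrC powRM ?(ltW t0) ?invr_ge0 ?(ltW c0)//.
by rewrite -(powR_inv1 (ltW c0)) -powRrM mulN1r.
Qed.

(** By [layer_cake] only the volumes of balls enter: the sublevel set at height [t] has mass
    proportional to t^(d/p), which leaves a Gamma integral. *)
Lemma integral_expR_rdist xbar p c : 0 < p -> 0 < c ->
  (\int[mu]_x (expR (- (c * rdist xbar x `^ p)))%:E =
   (c `^ (- (d%:R / p)) * ball_volume)%:E * egamma (d%:R / p + 1))%E.
Proof.
move=> p0 c0; pose phi x := c * rdist xbar x `^ p.
have mphi : measurable_fun setT phi by apply: measurable_funM => //; exact: measurable_rdist_powR.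
have phi0 x : 0 <= phi x by rewrite mulr_ge0 ?powR_ge0// ltW.
have := @layer_cake _ _ _ mu (fun=> 1) phi _ (measurable_cst _) mphi measurable_expRN1
  (fun=> ler01) (fun t => expR_ge0 _).
under eq_integral => x _.
  rewrite (_ : (\int[_]_(t in _) _)%E = (expR (- phi x))%:E); last first.
    have := @integral_exp_tail _ 1 (phi x) ltr01; rewrite mul1r => <-.
    by apply: eq_integral => t _; rewrite !mul1r.
  rewrite mul1e.
  over.
move=> ->; rewrite /egamma -ge0_integralZl//; last 3 first.
- exact: measurable_gamma_kernel.
- by move=> t _; rewrite lee_fin mulr_ge0 ?powR_ge0 ?expR_ge0.
- by rewrite lee_fin mulr_ge0 ?powR_ge0 ?ball_volume_ge0.
rewrite [RHS]integral_mkcond; apply: eq_integral => t _.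
rewrite integral_cst; last first.
  rewrite (_ : [set x | phi x < t] = phi @^-1` `]-oo, t[%classic).
    by rewrite -[X in measurable X]setTI; apply: mphi.
  by apply/seteqP; split => x; rewrite /= in_itv.
rewrite patchE (_ : (t \in `]0%R, +oo[%classic) = (0 < t)); last first.
  by apply/idP/idP; rewrite inE/= in_itv/= andbT.
rewrite mul1e; case: ifPn => t0.
  by rewrite [X in (_ * X)%E](rdist_powR_ball xbar p0 c0 t0) -!EFinM addrK; congr EFin; ring.
rewrite (_ : [set x | phi x < t] = set0) ?measure0 ?mule0//.
apply/seteqP; split => x //= xt; move: t0; rewrite -leNgt => t0.
by have := le_lt_trans (phi0 x) (lt_le_trans xt t0); rewrite ltxx.
Qed.

Lemma ball_volume_gamma :
  ((ball_volume)%:E * egamma (d%:R / 2 + 1) = (pi `^ (d%:R / 2))%:E)%E.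
Proof.
have := @integral_expR_rdist (tzero : d.-tuple R) 2 1 (ltr0Sn _ _) ltr01.
rewrite powR1 mul1r => <-.
transitivity (\int[mu]_x (gaussn x)%:E)%E.
  apply: eq_integral => x _; rewrite /gaussn mul1r powR_mulrn ?rdist_ge0// sqr_sqrtr ?dotp_ge0//.
  congr (expR (- _))%:E; apply: eq_bigr => i _; rewrite !tnth_mktuple subr0//.
rewrite (integral_gaussn lmu) mulrC powRrM powR12_sqrt ?pi_ge0// powR_mulrn//.
Qed.

(** The range of [egamma_fin01] reaches only [d = 1]. In general finiteness is read off
    [ball_volume_gamma]: its right side is nonzero, so the ball has positive volume, and finite, so
    the other factor is finite. *)
Lemma egamma_half_fin : (egamma (d%:R / 2 : R) < +oo)%E.
Proof.
have d20 : 0 < d%:R / 2 :> R by rewrite divr_gt0// ltr0n.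
have v0 : 0 < ball_volume.
  rewrite lt_neqAle ball_volume_ge0 andbT; apply/eqP => v0.
  move: ball_volume_gamma; rewrite -v0 mul0e => /esym [] /eqP; rewrite gt_eqF// powR_gt0//.
  exact: pi_gt0.
rewrite ltey; apply/eqP => goo; move: ball_volume_gamma.
by rewrite -egammaS// goo gt0_muley ?lte_fin// gt0_muley ?lte_fin.
Qed.

Lemma ball_volume_Gamma : ball_volume * (d%:R / 2) * Gamma (d%:R / 2 : R) = pi `^ (d%:R / 2).
Proof.
have d20 : 0 < d%:R / 2 :> R by rewrite divr_gt0// ltr0n.
have g : egamma (d%:R / 2 : R) \is a fin_num by rewrite ge0_fin_numE ?egamma_ge0 ?egamma_half_fin.
by apply: EFin_inj; rewrite -ball_volume_gamma -egammaS// GammaE 2!EFinM (fineK g) muleA.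
Qed.

Lemma Gamma_half_gt0 : 0 < Gamma (d%:R / 2 : R).
Proof.
rewrite lt_neqAle Gamma_ge0 andbT; apply/eqP => g0.
have := ball_volume_Gamma; rewrite -g0 mulr0 => /esym/eqP; rewrite gt_eqF// powR_gt0//.
exact: pi_gt0.
Qed.

(** The share of [Kconst] due to the integral of the inverse weight; the two remaining factors arise
    from the choice of [u] in [carlson]. *)
Definition carlson_const (a : R) : R :=
  pi `^ (d%:R / 2) / a * (Gamma (d%:R / 2))^-1
  * Gamma (d%:R / (2 * a)) * Gamma (1 - d%:R / (2 * a)).

Lemma integral_weight xbar a u : d%:R / 2 < a -> 0 < u ->
  (\int[mu]_x ((1 + u * rdist xbar x `^ (2 * a))^-1)%:E =
   (u `^ (- (d%:R / (2 * a))) * carlson_const a)%:E)%E.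
Proof.
move=> da u0; have d20 : 0 < d%:R / 2 :> R by rewrite divr_gt0// ltr0n.
have a0 : 0 < a by exact: lt_trans da.
set s := d%:R / (2 * a).
have s0 : 0 < s by rewrite divr_gt0 ?ltr0n// mulr_gt0.
have s1 : s < 1 by rewrite ltr_pdivrMr ?mulr_gt0// mul1r -ltr_pdivrMl// mulrC.
have s1' : 0 < 1 - s by rewrite subr_gt0.
have p0 : 0 < 2 * a by rewrite mulr_gt0.
pose W x := 1 + u * rdist xbar x `^ (2 * a).
have W0 x : 0 < W x by rewrite ltr_wpDr// mulr_ge0 ?powR_ge0// ltW.
have mW : measurable_fun setT W.
  by apply: measurable_funD => //; apply: measurable_funM => //; exact: measurable_rdist_powR.
pose h (z : d.-tuple R * R) : \bar R := (expR (- (W z.1 * z.2)) * (0 < z.2)%R%:R)%:E.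
have mh : measurable_fun setT h.
  apply/measurable_EFinP; apply: measurable_funM.
    apply: measurable_expR_comp; apply: measurableT_comp => //.
    by apply: measurable_funM => //; exact: measurableT_comp.
  rewrite (_ : (fun z => _) = (fun z : d.-tuple R * R => if 0 < z.2 then 1 else 0 : R)).
    by apply: measurable_fun_ifT => //; apply: measurable_fun_ltr.
  by apply/funext => z; case: (0 < z.2).
have h0 z : (0 <= h z)%E by rewrite lee_fin mulr_ge0 ?expR_ge0.
transitivity (\int[mu]_x \int[@lebesgue_measure R]_t h (x, t))%E.
  apply: eq_integral => x _; rewrite -/(W x).
  have -> : ((W x)^-1%:E = (W x)^-1%:E * \int[@lebesgue_measure R]_(t in `]0%R, +oo[) (W x * expR (- (W x * t)))%:E)%E.
    by rewrite integral_exp_tail// mulr0 oppr0 expR0 mule1.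
  rewrite -ge0_integralZl//; last 3 first.
  - by apply: measurable_funTS; apply/measurable_EFinP; apply: measurable_funM => //; exact: measurable_expRN.
  - by move=> t _; rewrite lee_fin mulr_ge0 ?expR_ge0// ltW.
  - by rewrite lee_fin invr_ge0 ltW.
  rewrite integral_mkcond; apply: eq_integral => t _.
  rewrite patchE (_ : (t \in `]0%R, +oo[%classic) = (0 < t)); last first.
    by apply/idP/idP; rewrite inE/= in_itv/= andbT.
  rewrite /h/=; case: ifP => _; last by rewrite mulr0.
  by rewrite mulr1 -EFinM mulrA mulVf ?gt_eqF// mul1r.
rewrite (@fubini_tonelli _ _ _ _ _ mu (@lebesgue_measure R))//.
have gs : egamma s \is a fin_num by rewrite ge0_fin_numE ?egamma_ge0// egamma_fin01.
(* For fixed [t] the exponential splits off e^(-t), and the integral over x contributes (t u)^(-s);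
   reading t^(-s) as t^((1 - s) - 1) leaves the integral of [egamma (1 - s)], finite because
   [s < 1]. *)
transitivity ((u `^ (- s) * ball_volume)%:E * egamma (s + 1) * egamma (1 - s))%E.
  have C0 : (0 <= (u `^ (- s) * ball_volume)%:E * egamma (s + 1))%E.
    by rewrite mule_ge0 ?egamma_ge0// lee_fin mulr_ge0 ?powR_ge0 ?ball_volume_ge0.
  rewrite {2}/egamma -ge0_integralZl//; last 2 first.
  - exact: measurable_gamma_kernel.
  - by move=> t _; rewrite lee_fin mulr_ge0 ?powR_ge0 ?expR_ge0.
  rewrite [RHS]integral_mkcond; apply: eq_integral => t _.
  rewrite patchE (_ : (t \in `]0%R, +oo[%classic) = (0 < t)); last first.
    by apply/idP/idP; rewrite inE/= in_itv/= andbT.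
  rewrite /h/=; case: ifPn => t0; last first.
    by rewrite integral0_eq// => x _; rewrite mulr0.
  transitivity (\int[mu]_x ((expR (- t))%:E * (expR (- (t * u * rdist xbar x `^ (2 * a))))%:E))%E.
    by apply: eq_integral => x _; rewrite mulr1 -EFinM -expRD; congr (expR _)%:E; rewrite /W; ring.
  have me : measurable_fun setT (fun x => (expR (- (t * u * rdist xbar x `^ (2 * a))))%:E).
    apply/measurable_EFinP; apply: measurable_expR_comp; apply: measurableT_comp => //.
    by apply: measurable_funM => //; exact: measurable_rdist_powR.
  have e0 x : setT x -> (0 <= (expR (- (t * u * rdist xbar x `^ (2 * a))))%:E)%E.
    by rewrite lee_fin expR_ge0.
  have t0' : (0 <= (expR (- t))%:E)%E by rewrite lee_fin expR_ge0.
  rewrite ge0_integralZl//.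
  rewrite integral_expR_rdist ?mulr_gt0// -/s powRM ?(ltW t0) ?(ltW u0)//.
  by rewrite addrAC subrr add0r -egammaS// -(fineK gs) -!EFinM; congr EFin; ring.
have gs1 : egamma (1 - s) \is a fin_num.
  by rewrite ge0_fin_numE ?egamma_ge0// egamma_fin01// gtrBl.
rewrite -egammaS// -(fineK gs) -(fineK gs1) -!GammaE -!EFinM; congr EFin.
(* The factor [s] from [egammaS] against this [d / 2] leaves the [1 / a] of the constant. *)
have -> : ball_volume = pi `^ (d%:R / 2) / (d%:R / 2 * Gamma (d%:R / 2 : R)).
  apply: (canRL (mulfK _)); last by rewrite mulrA ball_volume_Gamma.
  by rewrite mulf_neq0 ?gt_eqF ?Gamma_half_gt0.
rewrite /carlson_const -/s {2}/s.
have := Gamma_half_gt0; have dn0 : d%:R != 0 :> R by rewrite pnatr_eq0 -lt0n.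
move: (Gamma (d%:R / 2 : R)) => g g0; field.
by rewrite dn0 !gt_eqF.
Qed.

End radial.

(** * Carlson's inequality *)

Section carlson.
Context {R : realType}.

Lemma cauchy_schwarz dT (T : measurableType dT) (m : {measure set T -> \bar R})
    (g h : T -> R) (P Q : R) :
  measurable_fun setT g -> measurable_fun setT h ->
  (forall x, 0 <= g x) -> (forall x, 0 <= h x) ->
  (\int[m]_x (g x ^+ 2)%:E = P%:E)%E -> (\int[m]_x (h x ^+ 2)%:E = Q%:E)%E ->
  (\int[m]_x (g x * h x)%:E <= (Num.sqrt (P * Q))%:E)%E.
Proof.
move=> mg mh g0 h0 gP hQ.
have P0 : 0 <= P by rewrite -lee_fin -gP; apply: integral_ge0 => x _; rewrite lee_fin sqr_ge0.
have Q0 : 0 <= Q by rewrite -lee_fin -hQ; apply: integral_ge0 => x _; rewrite lee_fin sqr_ge0.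
have p2 : (2^-1 + 2^-1 = 1 :> R) by field.
have := @hoelder _ _ _ m g h 2 2 mg mh (ltr0Sn _ _) (ltr0Sn _ _) p2.
have N2 (k : T -> R) (p : R) : (forall x, 0 <= k x) -> (\int[m]_x (k x ^+ 2)%:E = p%:E)%E ->
    0 <= p -> Lnorm m 2%:E (EFin \o k) = (Num.sqrt p)%:E.
  move=> k0 kp p0; rewrite unlock -powR12_sqrt// -poweR_EFin -kp; congr (_ `^ _)%E.
  by apply: eq_integral => x _; rewrite abse_EFin ger0_norm// poweR_EFin powR_mulrn.
rewrite (N2 g P)// (N2 h Q)// -EFinM -sqrtrM//.
apply: le_trans; rewrite unlock invr1 poweRe1 ?integral_ge0//; last by move=> x _; rewrite poweR_ge0.
rewrite le_eqVlt; apply/orP; left; apply/eqP; apply: eq_integral => x _.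
by rewrite abse_EFin ger0_norm ?mulr_ge0// poweR_EFin powRr1// mulr_ge0.
Qed.

Context {d : nat}.
Variable mu : {sigma_finite_measure set (d.-tuple R) -> \bar R}.
Hypothesis lmu : is_lebesgue_measure mu.
Hypothesis d0 : (0 < d)%N.

(* The weight [1 + u |x - xbar|^(2a)] in Cauchy-Schwarz is optimised at
   [u = s A / ((1 - s) B)]. *)
Lemma carlson (a A B : R) xbar (g : d.-tuple R -> R) : d%:R / 2 < a ->
  measurable_fun setT g -> (forall x, 0 <= g x) -> 0 < A -> 0 < B ->
  (\int[mu]_x (g x ^+ 2)%:E = A%:E)%E ->
  (\int[mu]_x (rdist xbar x `^ (2 * a) * g x ^+ 2)%:E = B%:E)%E ->
  exists2 N, (\int[mu]_x (g x)%:E = N%:E)%E &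
    N ^+ 2 <= Kconst d a * A `^ (1 - d%:R / (2 * a)) * B `^ (d%:R / (2 * a)).
Proof.
move=> da mg g0 A0 B0 gA gB.
have a0 : 0 < a by apply: le_lt_trans da; rewrite divr_ge0.
set s := d%:R / (2 * a).
have s0 : 0 < s by rewrite divr_gt0 ?ltr0n// mulr_gt0.
have s1 : s < 1 by rewrite ltr_pdivrMr ?mulr_gt0// mul1r -ltr_pdivrMl// mulrC.
have s1' : 0 < 1 - s by rewrite subr_gt0.
pose u := s / (1 - s) * (A / B).
have u0 : 0 < u by rewrite mulr_gt0// divr_gt0.
pose W x := 1 + u * rdist xbar x `^ (2 * a).
have W0 x : 0 < W x by rewrite ltr_wpDr// mulr_ge0 ?powR_ge0// ltW.
have mep := measurable_rdist_powR xbar (2 * a).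
have mW : measurable_fun setT W by apply: measurable_funD => //; exact: measurable_funM.
have mq : measurable_fun setT (fun x => Num.sqrt (W x)).
  by apply: measurableT_comp mW; apply: continuous_measurable_fun; exact: sqrt_continuous.
have mqV : measurable_fun setT (fun x => Num.sqrt ((W x)^-1)).
  apply: measurableT_comp; first by apply: continuous_measurable_fun; exact: sqrt_continuous.
  rewrite (_ : (fun x => (W x)^-1) = (@powR R ^~ (-1)) \o W).
    by apply: measurableT_comp mW; exact: measurable_powR.
  by apply/funext => x; rewrite /= powR_inv1// ltW.
have mg2 : measurable_fun setT (fun x => (g x ^+ 2)%:E) by exact: measurable_sq.
have I1 : (\int[mu]_x ((g x * Num.sqrt (W x)) ^+ 2)%:E = (A + u * B)%:E)%E.
  have g20 x : setT x -> (0 <= (g x ^+ 2)%:E)%E by rewrite lee_fin sqr_ge0.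
  have eg0 x : setT x -> (0 <= (rdist xbar x `^ (2 * a) * g x ^+ 2)%:E)%E.
    by rewrite lee_fin mulr_ge0 ?sqr_ge0 ?powR_ge0.
  have meg : measurable_fun setT (fun x => (rdist xbar x `^ (2 * a) * g x ^+ 2)%:E).
    by apply/measurable_EFinP; apply: measurable_funM => //; exact: measurable_funX.
  have ueg0 x : setT x -> (0 <= u%:E * (rdist xbar x `^ (2 * a) * g x ^+ 2)%:E)%E.
    by move=> h; rewrite mule_ge0 ?eg0// lee_fin ltW.
  have mueg := measurable_funeM u%:E meg.
  have u0' : (0 <= u%:E)%E by rewrite lee_fin ltW.
  rewrite EFinD EFinM -gA -gB -ge0_integralZl// -ge0_integralD//.
  apply: eq_integral => x _; rewrite -EFinM -EFinD exprMn sqr_sqrtr ?(ltW (W0 x))// /W.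
  by congr EFin; ring.
have I2 : (\int[mu]_x (Num.sqrt ((W x)^-1) ^+ 2)%:E = (u `^ (- s) * @carlson_const R d a)%:E)%E.
  rewrite -(integral_weight lmu d0 xbar da u0); apply: eq_integral => x _.
  by rewrite sqr_sqrtr// invr_ge0 ltW.
have gM : (\int[mu]_x (g x)%:E = \int[mu]_x (g x * Num.sqrt (W x) * Num.sqrt ((W x)^-1))%:E)%E.
  apply: eq_integral => x _; rewrite -mulrA -sqrtrM ?(ltW (W0 x))// divff ?gt_eqF//.
  by rewrite sqrtr1 mulr1.
have CS : (\int[mu]_x (g x)%:E <=
    (Num.sqrt ((A + u * B) * (u `^ (- s) * @carlson_const R d a)))%:E)%E.
  rewrite gM; apply: cauchy_schwarz => //; first exact: measurable_funM.
  by move=> x; rewrite mulr_ge0 ?sqrtr_ge0.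
have G0 : (0 <= \int[mu]_x (g x)%:E)%E by apply: integral_ge0 => x _; rewrite lee_fin.
have Gf : (\int[mu]_x (g x)%:E)%E \is a fin_num.
  by rewrite ge0_fin_numE//; apply: le_lt_trans CS _; rewrite ltry.
exists (fine (\int[mu]_x (g x)%:E)%E); first by rewrite fineK.
have N0 : 0 <= fine (\int[mu]_x (g x)%:E)%E by rewrite fine_ge0.
move: CS; rewrite -{1}(fineK Gf) lee_fin; move: (fine _) N0 => N N0 NS.
have X0 : 0 <= (A + u * B) * (u `^ (- s) * @carlson_const R d a).
  apply: mulr_ge0; first by rewrite addr_ge0 ?(ltW A0)// mulr_ge0 ?(ltW u0) ?(ltW B0).
  apply: mulr_ge0; first exact: powR_ge0.
  apply: mulr_ge0; last exact: Gamma_ge0.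
  apply: mulr_ge0; last exact: Gamma_ge0.
  apply: mulr_ge0; last by rewrite invr_ge0 Gamma_ge0.
  by rewrite divr_ge0 ?powR_ge0// ltW.
have -> : Kconst d a * A `^ (1 - s) * B `^ s = (A + u * B) * (u `^ (- s) * @carlson_const R d a).
  have -> : A + u * B = A / (1 - s) by rewrite /u; field; rewrite !gt_eqF.
  have -> : u `^ (- s) = (2 * a / d%:R - 1) `^ s * (B / A) `^ s.
    rewrite -powRM; last 2 first.
    - by rewrite subr_ge0 ler_pdivlMr ?ltr0n// mul1r mulrC -ler_pdivrMr// ltW.
    - by rewrite divr_ge0// ltW.
    have -> : u `^ (- s) = u^-1 `^ s by rewrite -(powR_inv1 (ltW u0)) -powRrM mulN1r.
    congr (_ `^ _).
    have -> : 2 * a / d%:R = s^-1 by rewrite /s invf_div.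
    by rewrite /u; clearbody s; field; rewrite !gt_eqF.
  rewrite powRM ?invr_ge0 ?(ltW A0) ?(ltW B0)// powRB; last by rewrite (gt_eqF A0) implybT.
  rewrite powRr1 ?(ltW A0)// -(powR_inv1 (ltW A0)) -powRrM mulN1r powRN.
  by rewrite /Kconst /carlson_const -/s; ring.
rewrite -[leRHS](sqr_sqrtr X0) ler_pXn2r// nnegrE//; exact: sqrtr_ge0.
Qed.

End carlson.

(** * The uncertainty inequalities *)

Section assembly.
Context {R : realType} {d : nat}.
Variable mu : {sigma_finite_measure set (d.-tuple R) -> \bar R}.
Hypothesis lmu : is_lebesgue_measure mu.
Hypothesis d0 : (0 < d)%N.
Implicit Types (g : d.-tuple R -> R[i]) (x w : d.-tuple R).

Lemma cmod2_eq0 (z : R[i]) : (cmod2 z == 0) = (z == 0).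
Proof. by case: z => p q; rewrite /cmod2 paddr_eq0 ?sqr_ge0// !sqrf_eq0 eq_complex. Qed.

Lemma cmod2_ge0 (z : R[i]) : 0 <= cmod2 z.
Proof. by rewrite addr_ge0 ?sqr_ge0. Qed.

Lemma measurable_cmod2 g : cmeasurable g -> measurable_fun setT (fun x => cmod2 (g x)).
Proof. by move=> [mr mi]; apply: measurable_funD; exact: measurable_funX. Qed.

Lemma cmod2_weighted xbar a g x :
  cmod2 (weighted xbar a g x) = rdist xbar x `^ (2 * a) * cmod2 (g x).
Proof.
rewrite (mulrC 2 a) powRrM powR_mulrn ?powR_ge0// /weighted /cmod2 -/(rdist xbar x).
by case: (g x) => p q /=; rewrite !mul0r subr0 addr0; ring.
Qed.

Lemma measurable_supp g : cmeasurable g -> measurable (supp g).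
Proof.
move=> mg; rewrite (_ : supp g = (fun x => cmod2 (g x)) @^-1` [set~ 0]).
  rewrite -[X in measurable X]setTI; apply: measurable_cmod2 => //; exact: measurableC.
by apply/seteqP; split => x; rewrite /supp/= -cmod2_eq0 => /eqP.
Qed.

(** The set lies in the degenerate box at [xbar], whose volume has a zero factor since there is at
    least one coordinate. *)
Lemma rdist0_null xbar : mu [set x | rdist xbar x = 0] = 0%E.
Proof.
have mS : measurable [set x | rdist xbar x = 0].
  rewrite (_ : [set _ | _] = rdist xbar @^-1` [set 0])//.
  by rewrite -[X in measurable X]setTI; apply: measurable_rdist.
apply/eqP; rewrite eq_le measure_ge0 andbT.
have -> : 0%E = mu [set x | forall i, tnth xbar i <= tnth x i <= tnth xbar i].
  rewrite lmu// (bigD1 (Ordinal d0))//= subrr mul0r//.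
apply: le_measure; rewrite ?inE//; first exact: measurable_box.
move=> x /= x0 i; rewrite -eq_le eq_sym -subr_eq0 -normr_le0 -x0 /rdist.
by have := tnth_le_enorm (tsub x xbar) i; rewrite tnth_mktuple.
Qed.

Lemma supp_gt0 g : cmeasurable g -> ~ mu.-negligible (supp g) -> (0 < mu (supp g))%E.
Proof.
move=> mg ng; rewrite lt0e measure_ge0 andbT; apply/eqP => s0; apply: ng.
by exists (supp g); split => //; exact: measurable_supp.
Qed.

(** The weight can vanish only at [xbar], a null set, so a zero integral would make the support of
    [g] negligible. *)
Lemma integral_cmod2_weighted_gt0 g xbar p : cmeasurable g -> ~ mu.-negligible (supp g) ->
  (0 < \int[mu]_x (rdist xbar x `^ p * cmod2 (g x))%:E)%E.
Proof.
move=> mg ng; rewrite lt0e integral_ge0 ?andbT; last first.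
  by move=> x _; rewrite lee_fin mulr_ge0 ?powR_ge0 ?cmod2_ge0.
apply/eqP => I0; apply: ng.
have mF : measurable_fun setT (fun x => (rdist xbar x `^ p * cmod2 (g x))%:E).
  apply/measurable_EFinP; apply: measurable_funM; last exact: measurable_cmod2.
  exact: measurable_rdist_powR.
have := (ae_eq_integral_abs mu measurableT mF).1.
rewrite (_ : (\int[mu]_x `|_|)%E = 0%E); last first.
  rewrite -[RHS]I0; apply: eq_integral => x _.
  by rewrite gee0_abs// lee_fin mulr_ge0 ?powR_ge0 ?cmod2_ge0.
move=> /(_ erefl) [N [mN N0 sN]].
have nN : mu.-negligible N by exists N; split.
have nr : mu.-negligible [set x | rdist xbar x = 0].
  exists [set x | rdist xbar x = 0]; split => //; last exact: rdist0_null.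
  rewrite (_ : [set _ | _] = rdist xbar @^-1` [set 0])//.
  by rewrite -[X in measurable X]setTI; apply: measurable_rdist.
apply: negligibleS (negligibleU nN nr).
move=> x gx; have [r0|r0] := eqVneq (rdist xbar x) 0; first by right.
left; apply: sN => /= /(_ I) [] /eqP; rewrite mulf_eq0 cmod2_eq0 (negbTE gx) orbF.
by rewrite powR_eq0 (negbTE r0).
Qed.

Lemma integral_cmod2_gt0 g : cmeasurable g -> ~ mu.-negligible (supp g) ->
  (0 < \int[mu]_x (cmod2 (g x))%:E)%E.
Proof.
move=> mg ng; have := @integral_cmod2_weighted_gt0 g (tzero : d.-tuple R) 0 mg ng.
by under eq_integral do rewrite powRr0 mul1r.
Qed.

(** Cauchy-Schwarz against the indicator of [S]. Vanishing off [S] is asked only almost everywhere,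
    because |F| agrees with |fhat| only in that sense. *)
Lemma integral_supported (k : d.-tuple R -> R) S (A m : R) :
  measurable_fun setT k -> (forall x, 0 <= k x) -> measurable S ->
  {ae mu, forall x, ~ S x -> k x = 0} ->
  (\int[mu]_x (k x ^+ 2)%:E = A%:E)%E -> mu S = m%:E ->
  (\int[mu]_x (k x)%:E <= (Num.sqrt (A * m))%:E)%E.
Proof.
move=> mk k0 mS ae kA Sm.
have mi : measurable_fun setT (\1_S : _ -> R) by [].
have -> : (\int[mu]_x (k x)%:E = \int[mu]_x (k x * \1_S x)%:E)%E.
  apply: ge0_ae_eq_integral => //.
  - exact/measurable_EFinP.
  - by apply/measurable_EFinP; exact: measurable_funM.
  - by move=> x _; rewrite lee_fin.
  - by move=> x _; rewrite lee_fin mulr_ge0.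
  - apply: filterS ae => x kS _; rewrite indicE; case: (boolP (x \in S)) => [|/negP xS].
      by rewrite mulr1.
    by rewrite kS ?mul0r// => /mem_set.
apply: cauchy_schwarz => //.
rewrite -Sm -[in RHS](setIT S) -integral_indic//; apply: eq_integral => x _.
by rewrite indicE; case: (x \in S); rewrite ?expr1n ?expr0n.
Qed.

(** Square [A < M * N], insert the two bounds and cancel A^(2 - s). That [K] is positive is read off
    the resulting inequality. *)
Lemma uncertainty_arith (A M N m B K s : R) : 0 < A -> 0 < m -> 0 < B -> 0 <= M -> 0 <= N ->
  A < M * N -> M ^+ 2 <= m * A -> N ^+ 2 <= K * A `^ (1 - s) * B `^ s ->
  K^-1 * A `^ s < m * B `^ s.
Proof.
move=> A0 m0 B0 M0 N0 AMN Mm NK.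
have As : 0 < A `^ s by exact: powR_gt0.
have As1 : 0 < A `^ (1 - s) by exact: powR_gt0.
have AA : A = A `^ (1 - s) * A `^ s.
  by rewrite -powRD ?(gt_eqF A0) ?implybT// subrK powRr1// ltW.
have h : A ^+ 2 < (m * A) * (K * A `^ (1 - s) * B `^ s).
  apply: (@lt_le_trans _ _ ((M * N) ^+ 2)); first by rewrite ltr_pXn2r// nnegrE ?mulr_ge0 ?(ltW A0).
  by rewrite exprMn ler_pM// sqr_ge0.
have h1 : A `^ s < K * (m * B `^ s).
  rewrite -(ltr_pM2l (mulr_gt0 A0 As1)); apply: (le_lt_trans _ (lt_le_trans h _)).
    by rewrite -mulrA -AA expr2.
  by rewrite le_eqVlt; apply/orP; left; apply/eqP; ring.
have K0 : 0 < K.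
  have := lt_trans As h1.
  by rewrite pmulr_lgt0// mulr_gt0 ?powR_gt0.
by rewrite mulrC ltr_pdivrMr// mulrC.
Qed.

Variables (f fhat : d.-tuple R -> R[i]).
Hypothesis fL2 : in_L2 mu f.
Hypothesis ffhat : is_fourier_L2 mu f fhat.
Hypothesis f_neq0 : ~ mu.-negligible (supp f).
Let u x := complex.Re (f x).
Let v x := complex.Im (f x).
Let mf : cmeasurable f. Proof. by case: fL2. Qed.
Let mfh : cmeasurable fhat. Proof. by case: ffhat. Qed.

Let A : R := fine (\int[mu]_x (cmod2 (f x))%:E)%E.

Let AE : (\int[mu]_x (cmod2 (f x))%:E = A%:E)%E.
Proof.
rewrite /A fineK// ge0_fin_numE; first by case: fL2.
by apply: integral_ge0 => x _; rewrite lee_fin cmod2_ge0.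
Qed.

Let A0 : 0 < A.
Proof. by rewrite -lte_fin -AE integral_cmod2_gt0. Qed.

Let sqintA : sqint2 mu u v = A%:E.
Proof. by rewrite -AE sqint2E//; case: mf. Qed.

Lemma fourier_supp_neq0 : ~ mu.-negligible (supp fhat).
Proof.
move=> nf; have : sqint2 mu u v = 0%E.
  apply: (fourier_L2_eq0 lmu fL2 ffhat); apply: negligibleS nf => w /= h.
  by apply: contra_notN h => /eqP ->.
by rewrite sqintA => -[] /eqP; rewrite gt_eqF.
Qed.

Let m w := modulus (ftre mu u v w) (ftim mu u v w).

(** What both inequalities draw from the integrability of f. The finite [M] comes from
    Cauchy-Schwarz in one case and from Carlson in the other. *)
Lemma fourier_modulus M : (\int[mu]_x (modulus (u x) (v x))%:E = M%:E)%E ->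
  [/\ measurable_fun setT m, (\int[mu]_w (m w ^+ 2)%:E = A%:E)%E,
      {ae mu, forall w, cmod2 (fhat w) = m w ^+ 2} &
      (A%:E < M%:E * \int[mu]_w (m w)%:E)%E].
Proof.
move=> fM; have [mu_ mv_] := mf.
have mmod : measurable_fun setT (fun x => modulus (u x) (v x)) by exact: measurable_modulus.
have imod : mu.-integrable setT (EFin \o (fun x => modulus (u x) (v x))).
  apply/integrableP; split; first exact/measurable_EFinP.
  under eq_integral do rewrite abse_EFin ger0_norm ?modulus_ge0//.
  by rewrite fM ltry.
have iu : mu.-integrable setT (EFin \o u).
  apply: le_integrable (imod) => //; first exact/measurable_EFinP.
  move=> x _; rewrite !abse_EFin lee_fin [leRHS]ger0_norm ?modulus_ge0//.
  by rewrite -sqrtr_sqr ler_sqrt ?addr_ge0 ?sqr_ge0// lerDl sqr_ge0.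
have iv : mu.-integrable setT (EFin \o v).
  apply: le_integrable (imod) => //; first exact/measurable_EFinP.
  move=> x _; rewrite !abse_EFin lee_fin [leRHS]ger0_norm ?modulus_ge0//.
  by rewrite -sqrtr_sqr ler_sqrt ?addr_ge0 ?sqr_ge0// lerDr sqr_ge0.
have uvoo : (sqint2 mu u v < +oo)%E by rewrite sqintA ltry.
split.
- by apply: measurable_modulus; [exact: measurable_ftre|exact: measurable_ftim].
- rewrite -sqintA -(plancherel lmu iu iv uvoo); apply: eq_integral => w _.
  by rewrite /m modulus_sq.
- have := fourier_L2_ae fL2 ffhat iu iv; apply: filterS => w [Uw Vw].
  by rewrite /m modulus_sq -Uw -Vw.
- rewrite -sqintA (_ : M = \int[mu]_x modulus (u x) (v x)); last by rewrite /Rintegral fM.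
  by apply: strict_energy_bound => //; rewrite sqintA lte_fin.
Qed.

Variables (a : R) (tbar wbar : d.-tuple R).
Hypothesis da : d%:R / 2 < a.
Let s := d%:R / (2 * a).

Lemma uncertainty_supp (sf B : R) : mu (supp f) = sf%:E ->
  (\int[mu]_w (rdist wbar w `^ (2 * a) * cmod2 (fhat w))%:E = B%:E)%E ->
  (Kconst d a)^-1 * A `^ s < sf * B `^ s.
Proof.
move=> fsf fB; have [mu_ mv_] := mf.
have mmod : measurable_fun setT (fun x => modulus (u x) (v x)) by exact: measurable_modulus.
have sf0 : 0 < sf by rewrite -lte_fin -fsf supp_gt0.
have B0 : 0 < B.
  by rewrite -lte_fin -fB integral_cmod2_weighted_gt0//; exact: fourier_supp_neq0.
have leM : (\int[mu]_x (modulus (u x) (v x))%:E <= (Num.sqrt (A * sf))%:E)%E.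
  apply: (integral_supported mmod _ (measurable_supp mf) _ _ fsf) => //.
  - by move=> x; exact: modulus_ge0.
  - apply: aeW => x /negP; rewrite negbK -cmod2_eq0 => /eqP f0.
    by rewrite /modulus -[X in Num.sqrt X]/(cmod2 (f x)) f0 sqrtr0.
  - by rewrite -AE; apply: eq_integral => x _; rewrite modulus_sq.
have M0 : (0 <= \int[mu]_x (modulus (u x) (v x))%:E)%E.
  by apply: integral_ge0 => x _; rewrite lee_fin modulus_ge0.
have Mf : (\int[mu]_x (modulus (u x) (v x))%:E)%E \is a fin_num.
  by rewrite ge0_fin_numE// (le_lt_trans leM)// ltry.
have ME := esym (fineK Mf); move: M0 leM; rewrite ME !lee_fin.
move: (fine _) ME => M ME M0 leM.
have [mm mA mae lt] := fourier_modulus ME.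
have mB : (\int[mu]_w (rdist wbar w `^ (2 * a) * m w ^+ 2)%:E = B%:E)%E.
  have mr := measurable_rdist_powR wbar (2 * a).
  rewrite -fB; apply: ge0_ae_eq_integral => //.
  - by apply/measurable_EFinP; apply: measurable_funM => //; exact: measurable_funX.
  - by apply/measurable_EFinP; apply: measurable_funM => //; exact: measurable_cmod2.
  - by move=> w _; rewrite lee_fin mulr_ge0 ?powR_ge0 ?sqr_ge0.
  - by move=> w _; rewrite lee_fin mulr_ge0 ?powR_ge0 ?cmod2_ge0.
  - by apply: filterS mae => w -> _.
have [|N NE leN] := carlson lmu d0 da mm _ A0 B0 mA mB; first by move=> w; exact: modulus_ge0.
have N0 : 0 <= N.
  by rewrite -lee_fin -NE; apply: integral_ge0 => w _; rewrite lee_fin modulus_ge0.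
move: lt; rewrite NE -EFinM lte_fin => lt.
apply: (uncertainty_arith A0 sf0 B0 M0 N0 lt _ leN).
rewrite mulrC -[leRHS]sqr_sqrtr ?mulr_ge0 ?(ltW A0) ?(ltW sf0)//.
by rewrite ler_pXn2r// nnegrE sqrtr_ge0.
Qed.

Lemma uncertainty_fourier_supp (sf B : R) : mu (supp fhat) = sf%:E ->
  (\int[mu]_x (rdist tbar x `^ (2 * a) * cmod2 (f x))%:E = B%:E)%E ->
  (Kconst d a)^-1 * A `^ s < sf * B `^ s.
Proof.
move=> fsf fB; have [mu_ mv_] := mf.
have mmod : measurable_fun setT (fun x => modulus (u x) (v x)) by exact: measurable_modulus.
have sf0 : 0 < sf by rewrite -lte_fin -fsf supp_gt0//; exact: fourier_supp_neq0.
have B0 : 0 < B by rewrite -lte_fin -fB integral_cmod2_weighted_gt0.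
have [|||M ME leM] := @carlson _ _ mu lmu d0 a A B tbar _ da mmod _ A0 B0.
- by move=> x; exact: modulus_ge0.
- by rewrite -AE; apply: eq_integral => x _; rewrite modulus_sq.
- by rewrite -fB; apply: eq_integral => x _; rewrite modulus_sq.
have M0 : 0 <= M.
  by rewrite -lee_fin -ME; apply: integral_ge0 => x _; rewrite lee_fin modulus_ge0.
have [mm mA mae lt] := fourier_modulus ME.
have leN : (\int[mu]_w (m w)%:E <= (Num.sqrt (A * sf))%:E)%E.
  apply: (integral_supported mm _ (measurable_supp mfh) _ mA fsf) => //.
  - by move=> w; exact: modulus_ge0.
  - apply: filterS mae => w mw /negP; rewrite negbK -cmod2_eq0 mw => /eqP/eqP.
    by rewrite sqrf_eq0 => /eqP.
have N0 : (0 <= \int[mu]_w (m w)%:E)%E.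
  by apply: integral_ge0 => w _; rewrite lee_fin modulus_ge0.
have Nf : (\int[mu]_w (m w)%:E)%E \is a fin_num.
  by rewrite ge0_fin_numE// (le_lt_trans leN)// ltry.
move: N0 leN lt; rewrite -(fineK Nf) -EFinM !lee_fin lte_fin.
move: (fine _) => N N0 leN lt.
(* The bound by the support now concerns the integral [N] of |F|, so the two factors change roles in
   [uncertainty_arith]. *)
rewrite mulrC in lt.
apply: (uncertainty_arith A0 sf0 B0 N0 M0 lt _ leM).
rewrite mulrC -[leRHS]sqr_sqrtr ?mulr_ge0 ?(ltW A0) ?(ltW sf0)//.
by rewrite ler_pXn2r// nnegrE sqrtr_ge0.
Qed.

Lemma L2norm_powR g : (L2norm mu g `^ (d%:R / a) = (\int[mu]_x (cmod2 (g x))%:E) `^ s)%E.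
Proof.
rewrite /L2norm -poweRrM; congr (_ `^ _)%E; rewrite /s.
have a0 : 0 < a by apply: le_lt_trans da; rewrite divr_ge0.
by field; rewrite gt_eqF.
Qed.

Lemma L2norm_weighted_powR xbar g :
  (L2norm mu (weighted xbar a g) `^ (d%:R / a) =
   (\int[mu]_x (rdist xbar x `^ (2 * a) * cmod2 (g x))%:E) `^ s)%E.
Proof.
rewrite L2norm_powR; congr (_ `^ _)%E; apply: eq_integral => x _.
by rewrite cmod2_weighted.
Qed.

(** Reduction to finite factors: with [s > 0], an infinite factor times a positive one is infinite
    and exceeds the real [k]. *)
Lemma ereal_uncertainty (sf B : \bar R) (k : R) : (0 < sf)%E -> (0 < B)%E ->
  (forall p q, sf = p%:E -> B = q%:E -> k < p * q `^ s) ->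
  (k%:E < sf * B `^ s)%E.
Proof.
have s0 : 0 < s.
  have a0 : 0 < a by apply: le_lt_trans da; rewrite divr_ge0.
  by rewrite divr_gt0 ?ltr0n// mulr_gt0.
move: sf B => [p| |] [q| |]// p0 q0 h.
- by rewrite poweR_EFin -EFinM lte_fin; exact: h.
- by rewrite poweRyr ?gt_eqF// gt0_muley// ltry.
- by rewrite gt0_mulye ?ltry// poweR_gt0.
- by rewrite poweRyr ?gt_eqF// gt0_mulye// ltry.
Qed.

Theorem uncertainty :
  (((Kconst d a)^-1)%:E * L2norm mu f `^ (d%:R / a)
     < mu (supp f) * L2norm mu (weighted wbar a fhat) `^ (d%:R / a))%E /\
  (((Kconst d a)^-1)%:E * L2norm mu f `^ (d%:R / a)
     < mu (supp fhat) * L2norm mu (weighted tbar a f) `^ (d%:R / a))%E.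
Proof.
rewrite !L2norm_weighted_powR L2norm_powR AE poweR_EFin -EFinM.
split; apply: ereal_uncertainty.
- exact: supp_gt0.
- by apply: integral_cmod2_weighted_gt0 => //; exact: fourier_supp_neq0.
- exact: uncertainty_supp.
- by apply: supp_gt0 => //; exact: fourier_supp_neq0.
- exact: integral_cmod2_weighted_gt0.
- exact: uncertainty_fourier_supp.
Qed.

End assembly.

Unset Implicit Arguments.

Theorem theorem4p5 (R : realType) (d : nat)
    (mu : {measure set (d.-tuple R) -> \bar R})
    (f fhat : d.-tuple R -> R[i]) (a : R) (tbar wbar : d.-tuple R) :
  (0 < d)%N ->
  is_lebesgue_measure mu ->
  in_L2 mu f ->
  ~ mu.-negligible (supp f) ->
  d%:R / 2 < a ->
  is_fourier_L2 mu f fhat ->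
  (((Kconst d a)^-1)%:E * L2norm mu f `^ (d%:R / a)
     < mu (supp f) * L2norm mu (weighted wbar a fhat) `^ (d%:R / a))%E /\
  (((Kconst d a)^-1)%:E * L2norm mu f `^ (d%:R / a)
     < mu (supp fhat) * L2norm mu (weighted tbar a f) `^ (d%:R / a))%E.
Proof.
move=> d0 lmu fL2 f0 da ffhat.
pose nu := sigma_finite_pack (lebesgue_sigma_finite lmu).
exact: (@uncertainty R d nu lmu d0 f fhat fL2 ffhat f0 a tbar wbar da).
Qed.
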